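(* Let $D=3x\frac{\partial}{\partial x}$ and let $$T=L^{(3)}(x;w)+w+1-\frac{1}{2x^2},$$ $$V=w^{-2}\Big((1+2w)^2L^{(3)}\big(x(1+2w)^{1/2};\tfrac{w}{1+2w}\big)+(1-2w)^2L^{(3)}\big(x(1-2w)^{1/2};\tfrac{w}{1-2w}\big)-2L^{(3)}(x;w)\Big),$$ where $L^{(3)}(x;w)$ is the generating series for rooted locally orientable cubic maps defined in the context. Then $$4x^4w^2(D+12)^2(D+8)(D+4)T-(D+6)DT+12x^4(D+12)\big((D+4)T\big)^2$$ $$=V\Big(2x^4w^2(D+12)(D+8)(D+4)T-\tfrac12(D+6)T+6x^4\big((D+4)T\big)^2\Big).$$
   Context: A map is a connected graph (loops and multiple edges allowed) embedded in a compact connected surface without boundary so that the faces are homeomorphic to open discs. A rooted map is one with a distinguished corner (angular sector at a vertex), together with a local orientation there; on an orientable surface this is the orientation of the surface. Rooted maps are counted up to homeomorphisms preserving the root structure. A locally orientable map is a map on any such surface, orientable or non-orientable. A cubic map is a map all of whose vertices have degree $3$. Let $L^{(3)}(x,y)=\sum_{n,k\ge1}c_{n,k}\,x^ny^k$, where $c_{n,k}$ is the number of rooted locally orientable cubic maps with $n$ vertices and $k$ faces. It is a formal power series in $x$ (only even powers of $x$ occur) whose coefficients are polynomials in $y$. With a semicolon between the arguments, $L^{(3)}(x;w)$ denotes the different series $$L^{(3)}(x;w)=w^2\,L^{(3)}(x,y)\big|_{x\mapsto xw^{1/2},\;y\mapsto w^{-1}},$$ so that by Euler's formula $x$ marks vertices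 and the exponent of $w$ is $2$ minus the Euler characteristic of the underlying surface. It is a formal power series in $x$ with coefficients polynomial in $w$. In products of operators such as $(D+12)(D+8)$, numbers denote multiplication operators and products denote composition; $(D+12)$ applied to a square means the operator applied to that square. *)

(* Defs.v *)
From HB Require Import structures.
From mathcomp Require Import all_boot all_order all_algebra all_fingroup.
From mathcomp Require boolp classical_sets functions fsbigop.

Set Implicit Arguments.
Unset Strict Implicit.
Unset Printing Implicit Defensive.

Import Order.TTheory GRing.Theory Num.Theory.
Local Open Scope ring_scope.

(** * Rooted locally orientable maps

  A map on a compact connected surface without boundary, orientable or not, is
  encoded by its set of flags (half-edge, side) and three fixed-point free
  involutions: [t0 f] is the flag at the other end of the same side of the edge
  of [f], [t1 f] is the other flag of the corner of [f], and [t2 f] is the flag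
  on the other side of the half-edge of [f].  Vertices, edges and faces are the
  orbits of <t1, t2>, <t0, t2> and <t0, t1>; the map is connected when
  <t0, t1, t2> is transitive.  The condition that [t0 t2] is an involution
  without fixed point says that every edge has exactly four flags.
  Homeomorphisms of maps correspond to bijections of flags commuting with the
  three involutions, and choosing a corner together with a local orientation
  there amounts to choosing a flag.  On an orientable surface the flag also
  selects the orientation, so that each map on an oriented surface rooted at a
  corner is obtained exactly once. *)

Section RootedMaps.
Variable F : finType.
Implicit Type M : {perm F} * {perm F} * {perm F} * F.

Definition mt0 M : {perm F} := M.1.1.1.
Definition mt1 M : {perm F} := M.1.1.2.
Definition mt2 M : {perm F} := M.1.2.
Definition mroot M : F := M.2.

Definition fpf_involution (s : {perm F}) : bool :=
  [forall f, (s (s f) == f) && (s f != f)].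

Definition flag_orbits (A : {set {perm F}}) : {set {set F}} :=
  orbit 'P <<A>> @: [set: F].

Definition is_rooted_map M : bool :=
  [&& fpf_involution (mt0 M), fpf_involution (mt1 M), fpf_involution (mt2 M),
      fpf_involution (mt0 M * mt2 M)%g
    & [transitive <<[set mt0 M; mt1 M; mt2 M]>>, on [set: F] | 'P]].

Definition mvertices M : {set {set F}} := flag_orbits [set mt1 M; mt2 M].
Definition mfaces M : {set {set F}} := flag_orbits [set mt0 M; mt1 M].

(** A half-edge at a vertex carries two flags. *)
Definition vertex_degree (v : {set F}) : nat := #|v|./2.

Definition is_cubic M : bool :=
  [forall v in mvertices M, vertex_degree v == 3].

Definition rooted_iso M M' : bool :=
  [exists s : {perm F},
    [&& [forall f, s (mt0 M f) == mt0 M' (s f)],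
        [forall f, s (mt1 M f) == mt1 M' (s f)],
        [forall f, s (mt2 M f) == mt2 M' (s f)]
      & s (mroot M) == mroot M']].

Lemma rooted_iso_equiv : equivalence_rel rooted_iso.
Proof.
have sym M M' : rooted_iso M M' -> rooted_iso M' M.
  case/existsP=> s /and4P[/forallP h0 /forallP h1 /forallP h2 /eqP hr].
  apply/existsP; exists s^-1%g.
  apply/and4P; split; last by rewrite -hr permK.
  - by apply/forallP=> f; rewrite -{1}(permKV s f) -(eqP (h0 _)) permK.
  - by apply/forallP=> f; rewrite -{1}(permKV s f) -(eqP (h1 _)) permK.
  - by apply/forallP=> f; rewrite -{1}(permKV s f) -(eqP (h2 _)) permK.
have trans M1 M2 M3 : rooted_iso M1 M2 -> rooted_iso M2 M3 -> rooted_iso M1 M3.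
  case/existsP=> s /and4P[/forallP h0 /forallP h1 /forallP h2 /eqP hr].
  case/existsP=> t /and4P[/forallP k0 /forallP k1 /forallP k2 /eqP kr].
  apply/existsP; exists (s * t)%g.
  apply/and4P; split; last by rewrite permM hr kr.
  - by apply/forallP=> f; rewrite !permM (eqP (h0 _)) (eqP (k0 _)).
  - by apply/forallP=> f; rewrite !permM (eqP (h1 _)) (eqP (k1 _)).
  - by apply/forallP=> f; rewrite !permM (eqP (h2 _)) (eqP (k2 _)).
move=> M1 M2 M3; split.
  apply/existsP; exists 1%g; rewrite !perm1 eqxx andbT.
  by apply/and3P; split; apply/forallP=> f; rewrite !perm1.
move=> h; apply/idP/idP; first exact/trans/sym.
exact: trans.
Qed.

End RootedMaps.

(** The [c_{n,k}]: the vertices of a cubic map with [n] vertices carry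
  [6 n] flags in total, so ['I_(6 * n)] may be taken as set of flags. *)
Definition cubic_rooted_maps (n k : nat) :=
  [set M : {perm 'I_(6 * n)} * {perm 'I_(6 * n)} * {perm 'I_(6 * n)} * 'I_(6 * n)
    | [&& is_rooted_map M, is_cubic M, #|mvertices M| == n & #|mfaces M| == k]].

Definition num_cubic_maps (n k : nat) : nat :=
  #|equivalence_partition (@rooted_iso _) (cubic_rooted_maps n k)|.

Lemma num_cubic_maps_gt n k : (6 * n < k)%N -> num_cubic_maps n k = 0%N.
Proof.
move=> lt_k; rewrite /num_cubic_maps (_ : cubic_rooted_maps n k = set0).
  by rewrite /equivalence_partition imset0 cards0.
apply/setP=> M; rewrite !inE; apply/negbTE/negP=> /and4P[_ _ _ /eqP Mk].
have := leq_imset_card (orbit 'P <<[set mt0 M; mt1 M]>>) [set: 'I_(6 * n)].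
by rewrite -/(flag_orbits _) -/(mfaces M) Mk cardsT card_ord leqNgt lt_k.
Qed.

(** * Formal Laurent series, with finitely many negative exponents *)

Import boolp classical_sets functions fsbigop.
From mathcomp Require Import zify.

Section Laurent.
Variable K : fieldType.
Implicit Types (f g h : int -> K^o) (n : int).

Definition order_bounded : {pred int -> K^o} :=
  fun f => `[< exists N : nat, forall n, n < - N%:Z -> f n = 0 >].

Lemma order_boundedP f :
  reflect (exists N : nat, forall n, n < - N%:Z -> f n = 0)
          (f \in order_bounded).
Proof. exact: asboolP. Qed.

Lemma order_bounded_submod_closed : submod_closed order_bounded.
Proof.
split; first by apply/order_boundedP; exists 0%N.
move=> a f g /order_boundedP[N Nf] /order_boundedP[N' N'g].
apply/order_boundedP; exists (maxn N N') => n nN.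
rewrite /GRing.add /= /GRing.scale /= Nf ?N'g ?scaler0 ?addr0 ?mulr0 //.
  by apply: lt_le_trans nN _; rewrite lerN2 lez_nat leq_maxr.
by apply: lt_le_trans nN _; rewrite lerN2 lez_nat leq_maxl.
Qed.

HB.instance Definition _ :=
  GRing.isSubmodClosed.Build K (int -> K^o) order_bounded
    order_bounded_submod_closed.

Record laurent := Laurent { lcoef :> int -> K^o; _ : lcoef \in order_bounded }.

HB.instance Definition _ := [isSub for lcoef].
HB.instance Definition _ := gen_eqMixin laurent.
HB.instance Definition _ := gen_choiceMixin laurent.
HB.instance Definition _ := [SubChoice_isSubLmodule of laurent by <:].

Implicit Types p q r : laurent.

Lemma laurentP p q : (forall n, p n = q n) -> p = q.
Proof. by move=> pq; apply/val_inj/funext. Qed.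

Lemma laurent_bounded p : exists N : nat, forall n, n < - N%:Z -> p n = 0.
Proof. exact/order_boundedP/(valP p). Qed.

Lemma lcoefD p q n : (p + q) n = p n + q n. Proof. by []. Qed.
Lemma lcoefN p n : (- p) n = - p n. Proof. by []. Qed.
Lemma lcoefZ a p n : (a *: p) n = a * p n. Proof. by []. Qed.
Lemma lcoef0 n : (0 : laurent) n = 0. Proof. by []. Qed.

Definition conv f g : int -> K :=
  fun n => \sum_(i \in [set: int]) f i * g (n - i).

Definition window (N B : nat) f : {poly K} := \poly_(i < B) f (i%:Z - N%:Z).

Lemma conv_window f g (M N B k : nat) :
    (forall n, n < - M%:Z -> f n = 0) -> (forall n, n < - N%:Z -> g n = 0) ->
    (k < B)%N ->
  conv f g (k%:Z - (M + N)%N%:Z) = (window M B f * window N B g)`_k.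
Proof.
move=> Mf Ng kB; pose r := [seq i%:Z - M%:Z | i <- index_iota 0 k.+1].
have ur : uniq r by rewrite map_inj_uniq ?iota_uniq // => i j /addIr [].
rewrite /conv -(fsbig_widen [set` r]) //; last first.
  move=> i [_ /= ir]; case: (ltP i (- M%:Z)) => [/Mf -> | Mi].
    by rewrite mul0r.
  rewrite [X in _ * X]Ng ?mulr0 //; rewrite ltNge; apply/negP => Ni; apply: ir.
  apply/mapP; exists (absz (i + M%:Z)%R); last by lia.
  by rewrite mem_index_iota; lia.
rewrite -fsbig_seq // {ur} big_map coefM.
rewrite big_mkord; apply: eq_bigr => i _.
have ik : (i <= k)%N by rewrite -ltnS.
rewrite !coef_poly (leq_ltn_trans ik kB) (leq_ltn_trans (leq_subr _ _) kB).
by congr (_ * g _); lia.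
Qed.

Lemma conv_lt f g (M N : nat) :
    (forall n, n < - M%:Z -> f n = 0) -> (forall n, n < - N%:Z -> g n = 0) ->
  forall n, n < - (M + N)%N%:Z -> conv f g n = 0.
Proof.
move=> Mf Ng n nMN; apply: fsbig1 => i _.
case: (ltP i (- M%:Z)) => [/Mf -> | Mi]; first by rewrite mul0r.
rewrite [X in _ * X]Ng ?mulr0 // ltrBlDl (lt_le_trans nMN) //.
by rewrite PoszD opprD lerD2r.
Qed.

Lemma conv_bounded p q : conv p q \in order_bounded.
Proof.
have [M Mp] := laurent_bounded p; have [N Nq] := laurent_bounded q.
by apply/order_boundedP; exists (M + N)%N; exact: conv_lt.
Qed.

Definition lmul p q : laurent := Laurent (conv_bounded p q).

Definition monomial_fun (m : int) : int -> K := fun n => (n == m)%:R.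

Lemma monomial_bounded m : monomial_fun m \in order_bounded.
Proof.
apply/order_boundedP; exists `|m|%N => n nm; rewrite /monomial_fun lt_eqF //.
by apply: lt_le_trans nm _; rewrite lerNl abszE -normrN ler_norm.
Qed.

(** [lX m] is x^m. *)
Definition lX m : laurent := Laurent (monomial_bounded m).

Lemma lmulC : commutative lmul.
Proof.
move=> p q; apply: laurentP => n.
have [M Mp] := laurent_bounded p; have [N Nq] := laurent_bounded q.
case: (ltP n (- (M + N)%N%:Z)) => [lt_n | le_n].
  by rewrite /= (conv_lt Mp Nq lt_n) (conv_lt Nq Mp) // addnC.
have n0 : 0 <= n + (M + N)%N%:Z by rewrite -lerBlDr sub0r.
rewrite -[n](addrK (M + N)%N%:Z) -(gez0_abs n0) /=.
rewrite (conv_window Mp Nq (ltnSn _)) mulrC -(conv_window Nq Mp (ltnSn _)).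
by rewrite addnC.
Qed.

Lemma lmulA : associative lmul.
Proof.
move=> p q r; apply: laurentP => n.
have [M Mp] := laurent_bounded p; have [N Nq] := laurent_bounded q.
have [L Lr] := laurent_bounded r.
have Hpq := conv_lt Mp Nq; have Hqr := conv_lt Nq Lr.
case: (ltP n (- (M + N + L)%N%:Z)) => [lt_n | le_n].
  by rewrite /= (conv_lt Hpq Lr lt_n) (conv_lt Mp Hqr) // addnA.
have n0 : 0 <= n + (M + N + L)%N%:Z by rewrite -lerBlDr sub0r.
rewrite -[n](addrK (M + N + L)%N%:Z) -(gez0_abs n0) /=; set k := absz _.
rewrite (conv_window Hpq Lr (ltnSn k)) -addnA (conv_window Mp Hqr (ltnSn k)).
transitivity (window M k.+1 p * window N k.+1 q * window L k.+1 r)`_k.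
  rewrite -mulrA !coefM; apply: eq_bigr => i _; congr (_ * _).
  have ki : (k - i < k.+1)%N by rewrite ltnS leq_subr.
  by rewrite -(conv_window Nq Lr ki) coef_poly ki.
rewrite !coefM; apply: eq_bigr => i _; congr (_ * _).
by rewrite -(conv_window Mp Nq (ltn_ord i)) coef_poly ltn_ord.
Qed.

Lemma lmul1 : left_id (lX 0) lmul.
Proof.
move=> p; apply: laurentP => n; rewrite /= /conv.
rewrite -(fsbig_widen [set 0]) //; last first.
  by move=> i [_ /= /eqP i0]; rewrite /monomial_fun (negbTE i0) mul0r.
by rewrite fsbig_set1 /monomial_fun eqxx mul1r subr0.
Qed.

Lemma lmulDl : left_distributive lmul +%R.
Proof.
move=> p p' q; apply: laurentP => n; rewrite lcoefD.
have [M Mp] := laurent_bounded p; have [M' M'p'] := laurent_bounded p'.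
have [N Nq] := laurent_bounded q.
pose Q := maxn M M'.
have Qp m : m < - Q%:Z -> p m = 0.
  by move=> mQ; apply: Mp; apply: lt_le_trans mQ _; rewrite lerN2 lez_nat leq_maxl.
have Qp' m : m < - Q%:Z -> p' m = 0.
  by move=> mQ; apply: M'p'; apply: lt_le_trans mQ _; rewrite lerN2 lez_nat leq_maxr.
have Qpp m : m < - Q%:Z -> (p + p') m = 0.
  by move=> mQ; rewrite lcoefD Qp // Qp' // addr0.
case: (ltP n (- (Q + N)%N%:Z)) => [lt_n | le_n].
  by rewrite /= (conv_lt Qpp Nq lt_n) (conv_lt Qp Nq lt_n) (conv_lt Qp' Nq lt_n) addr0.
have n0 : 0 <= n + (Q + N)%N%:Z by rewrite -lerBlDr sub0r.
rewrite -[n](addrK (Q + N)%N%:Z) -(gez0_abs n0) /=; set k := absz _.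
rewrite (conv_window Qpp Nq (ltnSn k)) (conv_window Qp Nq (ltnSn k)).
rewrite (conv_window Qp' Nq (ltnSn k)) -coefD -mulrDl.
congr (nth 0 (polyseq (_ * _)) k).
by apply/polyP=> i; rewrite coefD !coef_poly; case: ifP => // _; rewrite addr0.
Qed.

Lemma lX0_neq0 : lX 0 != 0.
Proof.
apply/eqP => /(congr1 (fun p : laurent => p 0)) /= /eqP.
by rewrite /monomial_fun eqxx oner_eq0.
Qed.

HB.instance Definition _ :=
  GRing.Zmodule_isComNzRing.Build laurent lmulA lmulC lmul1 lmulDl lX0_neq0.

Lemma lmulZ a p q : a *: (p * q) = a *: p * q.
Proof.
apply: laurentP => n; rewrite lcoefZ.
have [M Mp] := laurent_bounded p; have [N Nq] := laurent_bounded q.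
have Map m : m < - M%:Z -> (a *: p) m = 0.
  by move=> /Mp pm; rewrite lcoefZ pm mulr0.
case: (ltP n (- (M + N)%N%:Z)) => [lt_n | le_n].
  by rewrite /= (conv_lt Mp Nq lt_n) (conv_lt Map Nq lt_n) mulr0.
have n0 : 0 <= n + (M + N)%N%:Z by rewrite -lerBlDr sub0r.
rewrite -[n](addrK (M + N)%N%:Z) -(gez0_abs n0) /=; set k := absz _.
rewrite (conv_window Mp Nq (ltnSn k)) (conv_window Map Nq (ltnSn k)) -coefZ.
rewrite scalerAl; congr (nth 0 (polyseq (_ * _)) k).
by apply/polyP=> i; rewrite coefZ !coef_poly; case: ifP => // _; rewrite mulr0.
Qed.

HB.instance Definition _ := GRing.Lmodule_isLalgebra.Build K laurent lmulZ.

Lemma pointwise_bounded (a : int -> K) p :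
  (fun n => a n * p n) \in order_bounded.
Proof.
have [N Np] := laurent_bounded p.
by apply/order_boundedP; exists N => n /Np ->; rewrite mulr0.
Qed.

Lemma lXD m n : lX (m + n) = lX m * lX n.
Proof.
apply: laurentP => k; rewrite [RHS]/= /conv.
rewrite -(fsbig_widen [set m]) //; last first.
  by move=> i [_ /= /eqP im]; rewrite /monomial_fun (negbTE im) mul0r.
by rewrite fsbig_set1 /= /monomial_fun eqxx mul1r subr_eq addrC.
Qed.

(** [euler p] is x (d/dx) p. *)
Definition euler p : laurent :=
  Laurent (pointwise_bounded (fun n => n%:~R) p).

(** The substitution x |-> x u^(1/2) in a series all of whose exponents are
  even (on other series the value is meaningless). *)
Definition subst_sqrt (u : K) p : laurent :=
  Laurent (pointwise_bounded (fun n => u ^ (n %/ 2)%Z) p).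

Definition power_series_fun (a : nat -> K) : int -> K :=
  fun n => if n is Posz m then a m else 0.

Lemma power_series_bounded a : power_series_fun a \in order_bounded.
Proof. by apply/order_boundedP; exists 0%N; case. Qed.

Definition power_series a : laurent := Laurent (power_series_bounded a).

(** The coefficient of x^n in L(x,y), a polynomial in y.  The truncation of the
  sum loses nothing, by [num_cubic_maps_gt]. *)
Definition L3xy (n : nat) : {poly K} :=
  \sum_(1 <= k < (6 * n).+1) (num_cubic_maps n k)%:R *: 'X^k.

(** L(x;v), for [v != 0]. *)
Definition L3 (v : K) : laurent :=
  v ^+ 2 *: subst_sqrt v (power_series (fun n : nat => (L3xy n).[v^-1])).

End Laurent.

(** The field Q(w); an identity of series with coefficients polynomial in [w]
  (up to a power of [w]) is read in it. *)
Definition Qw : fieldType := {fraction {poly rat}}.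
Definition w : Qw := FracField.tofrac 'X.

(* Main.v *)
(** The Gaussian integral over real symmetric matrices [M] of size [N], with the
  weight [exp (x tr M^3 / 6)], is by Wick's theorem a generating function of
  cubic vertices with glued half-edges and coloured faces, and the logarithmic
  derivative of its value [Z_N] is [L(x, N)], up to a factor.  For [N = 2 n] it
  is also a Pfaffian: integration by parts gives loop equations with a unique
  solution, and these are satisfied by the alternating functions obtained from
  the Pfaffian of the skew moments of [sign (y - x)].  The Pluecker relations
  between such Pfaffians give a bilinear equation between [Z_(N-2)], [Z_N] and
  [Z_(N+2)] (from the BKP hierarchy); its terms involve multiplications by
  power sums, which the loop equations reduce to derivatives in [x].  The result
  is [6 Z_(N-2) Z_(N+2) = Z_N^2 A] with [A] a differential polynomial in
  [L(x, N)], whose logarithmic derivative is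
  [2 D A = (L(x, N+2) + L(x, N-2) - 2 L(x, N)) A].  Each coefficient is
  polynomial in [N], hence the equation holds for an indeterminate [N]; setting
  [N = 1 / w] and rescaling [x] yields the theorem. *)

From HB Require Import structures.
Require Import Defs.
From mathcomp Require Import all_boot all_order all_algebra all_fingroup.
From mathcomp Require ssrcomplements mpoly.
From mathcomp Require Import ring lra zify.
Set Implicit Arguments.
Unset Strict Implicit.
Unset Printing Implicit Defensive.
Import Order.TTheory GRing.Theory Num.Theory.
Local Open Scope ring_scope.

(** * Pfaffians *)

(** No integral is evaluated. The Gaussian mean is a linear functional on polynomials, the Pfaffian
    side consists of functions of lists of exponents built from rational numbers given by a
    recursion, and de Bruijn's integration formula, which would equate the two sides, is bypassed.
    What remains of the eigenvalue density is the first power of the Vandermonde determinant,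
    encoded by the list [iota 0 N]. The obstacle is normalisation: the two sides can only be
    compared once the Pfaffian at [x = 0] is known to be nonzero. In place of a Mehta-type integral,
    the constant term of the bilinear equation, [Z_(N-2) Z_(N+2) = Z_N^2 (N^2 - N)], propagates
    nonvanishing from one even size to the next. The factor between the logarithmic derivative and
    the count of maps comes from a double count of maps with labelled flags, coloured faces and an
    identification of their vertices with standard ones. A root kills all automorphisms, so every
    class of rooted maps with [n] vertices has as many labellings as there are permutations of [6 n]
    flags. *)

Section SignedSum.
Variable R : comNzRingType.
Implicit Types (f : nat -> seq nat -> R) (l : seq nat).

(** Shape of an expansion along a row: [c] is the removed entry, [r] the list of the others, and the
    sign alternates with the position of [c]. *)
Fixpoint ssum f l : R :=
  if l is b :: l' then f b l' - ssum (fun c r => f c (b :: r)) l' else 0.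

Lemma eq_ssum f g l : (forall c r, f c r = g c r) -> ssum f l = ssum g l.
Proof.
elim: l f g => //= b l IH f g fg; rewrite fg; congr (_ - _).
by apply: IH => c r; exact: fg.
Qed.

Lemma ssumD f g l : ssum (fun c r => f c r + g c r) l = ssum f l + ssum g l.
Proof. by elim: l f g => [|b l IH] f g /=; rewrite ?addr0 // IH; ring. Qed.

Lemma ssumZ a f l : ssum (fun c r => a * f c r) l = a * ssum f l.
Proof. by elim: l f => [|b l IH] f /=; rewrite ?mulr0 // IH; ring. Qed.

Lemma ssum0 l : ssum (fun _ _ => 0) l = 0.
Proof. by elim: l => //= b l ->; rewrite subrr. Qed.

Lemma ssumN f l : ssum (fun c r => - f c r) l = - ssum f l.
Proof. by elim: l f => [|b l IH] f /=; rewrite ?oppr0 // IH; ring. Qed.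

Lemma ssumB f g l : ssum (fun c r => f c r - g c r) l = ssum f l - ssum g l.
Proof. by rewrite ssumD ssumN. Qed.

Lemma ssum_sum (I : Type) (s : seq I) (F : I -> nat -> seq nat -> R) l :
  ssum (fun c r => \sum_(i <- s) F i c r) l = \sum_(i <- s) ssum (F i) l.
Proof.
elim: s => [|i s IH].
  by rewrite big_nil -[RHS](ssum0 l); apply: eq_ssum => c r; rewrite big_nil.
rewrite big_cons -IH -ssumD; apply: eq_ssum => c r; exact: big_cons.
Qed.

Lemma ssum_eq0 f l : (forall c r, c \in l -> f c r = 0) -> ssum f l = 0.
Proof.
elim: l f => //= b l IH f f0; rewrite f0 ?mem_head // IH ?subrr // => c r cl.
by rewrite f0 // inE cl orbT.
Qed.

Lemma ssum_cat f l1 l2 :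
  ssum f (l1 ++ l2) = ssum (fun c r => f c (r ++ l2)) l1 +
    (-1) ^+ size l1 * ssum (fun c r => f c (l1 ++ r)) l2.
Proof.
elim: l1 f => [|b l1 IH] f /=; first by rewrite add0r expr0 mul1r.
by rewrite IH exprS; ring.
Qed.

Lemma ssum_exchange (h : nat -> seq nat -> nat -> seq nat -> R) l1 l2 :
  ssum (fun i r => ssum (fun j s => h i r j s) l2) l1 =
  ssum (fun j s => ssum (fun i r => h i r j s) l1) l2.
Proof.
elim: l1 h => [|b l1 IH] h /=; first by rewrite ssum0.
by rewrite IH -ssumB.
Qed.

(** Removing two entries in the other order shifts the position of exactly one of them, hence the
    sign. *)
Lemma ssum_ssumC (h : nat -> nat -> seq nat -> R) l :
  ssum (fun b r => ssum (h b) r) l =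
  - ssum (fun b r => ssum (fun c s => h c b s) r) l.
Proof.
elim: l h => [|d l IH] h /=; first by rewrite oppr0.
rewrite !ssumB (IH (fun b c s => h b c (d :: s))) /=; ring.
Qed.

End SignedSum.

Section Alternating.
Variable R : comNzRingType.
Implicit Types F : seq nat -> R.

Definition alternating F :=
  forall l1 x y l2, F (l1 ++ x :: y :: l2) = - F (l1 ++ y :: x :: l2).

Lemma alternating_cons a F : alternating F -> alternating (fun l => F (a :: l)).
Proof. by move=> altF l1 x y l2; exact: (altF (a :: l1)). Qed.

Lemma ssum_alternating (f : nat -> seq nat -> R) :
  (forall c, alternating (f c)) -> alternating (ssum f).
Proof.
move=> altf l1; elim: l1 f altf => [|b l1 IH] f altf x y l2 /=.
  rewrite (@eq_ssum _ (fun c r => f c (x :: y :: r))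
                      (fun c r => - f c (y :: x :: r))) ?ssumN; first by ring.
  by move=> c r; exact: (altf c [::]).
by rewrite altf IH ?opprD ?opprK // => c; exact: alternating_cons.
Qed.

Lemma alternating_move F l1 x l2 l3 : alternating F ->
  F (l1 ++ x :: l2 ++ l3) = (-1) ^+ size l2 * F (l1 ++ l2 ++ x :: l3).
Proof.
move=> altF; elim: l2 l1 => [|y l2 IH] l1 /=; first by rewrite mul1r.
by rewrite altF -cat_rcons IH cat_rcons exprS mulN1r mulNr.
Qed.

Lemma alternating_swap F l1 x l2 y l3 : alternating F ->
  F (l1 ++ x :: l2 ++ y :: l3) = - F (l1 ++ y :: l2 ++ x :: l3).
Proof.
move=> altF; rewrite (alternating_move _ _ _ (y :: l3)) //.
rewrite [in RHS](_ : y :: _ = (y :: l2) ++ x :: l3) //.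
rewrite (catA l1) altF -catA mulrN; congr (- _).
rewrite [RHS](alternating_move l1 y l2 (x :: l3)) //.
Qed.

(** Regularity of 2 in the form needed for repeated entries, whose swap both negates the value and
    preserves it. It is instantiated with [rat] and with Laurent series over it. *)
Hypothesis two_reg : forall a : R, a = - a -> a = 0.

Lemma alternating_dup F l1 x l2 l3 : alternating F ->
  F (l1 ++ x :: l2 ++ x :: l3) = 0.
Proof. by move=> altF; apply: two_reg; exact: alternating_swap. Qed.

Lemma alternating_nuniq F l : alternating F -> ~~ uniq l -> F l = 0.
Proof.
elim: l F => //= a l IH F altF; rewrite negb_and negbK => /orP[al|nul].
  case/path.splitPr: al => p1 p2; exact: (alternating_dup [::]).
by apply: (IH (fun l => F (a :: l))) => //; exact: alternating_cons.
Qed.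

Lemma mkseq_split2 (T : Type) (f : nat -> T) i j N : (i < j < N)%N ->
  mkseq f N = mkseq f i ++ f i :: [seq f t | t <- iota i.+1 (j - i.+1)]
    ++ f j :: [seq f t | t <- iota j.+1 (N - j.+1)].
Proof.
case/andP=> ij jN; rewrite {1}/mkseq.
rewrite (_ : N = i + (1 + ((j - i.+1) + (1 + (N - j.+1)))))%N; last by lia.
rewrite !iotaD !map_cat /= add0n; congr (_ ++ _ :: _).
rewrite addn1 (_ : (i.+1 + (j - i.+1))%N = j); last by lia.
by rewrite addn1; congr (_ ++ _ :: [seq f t | t <- iota _ _]); lia.
Qed.

Lemma alternating_mkseq F (f g : nat -> nat) i j N :
    alternating F -> (i < j < N)%N -> g i = f j -> g j = f i ->
    (forall t, t != i -> t != j -> g t = f t) ->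
  F (mkseq g N) = - F (mkseq f N).
Proof.
move=> altF ijN gi gj gt; rewrite !(mkseq_split2 _ ijN) gi gj.
rewrite alternating_swap //; congr (- F (_ ++ _ :: _ ++ _ :: _)).
- by apply/eq_in_map => t; rewrite mem_iota => tN; apply: gt; lia.
- by apply/eq_in_map => t; rewrite mem_iota => tN; apply: gt; lia.
- by apply/eq_in_map => t; rewrite mem_iota => tN; apply: gt; lia.
Qed.

Lemma alternating_mkseq0 F (f : nat -> nat) i j N :
  alternating F -> (i < j < N)%N -> f i = f j -> F (mkseq f N) = 0.
Proof.
by move=> altF ijN fij; apply: two_reg; apply: (alternating_mkseq altF ijN).
Qed.

End Alternating.

Section Slots.
Variable R : comNzRingType.
Implicit Types (F : seq nat -> R) (op : nat -> seq (R * nat)).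

(** The derivation on products of monomials induced by the one-variable operator that sends [x^a] to
    the combination listed in [op a], transposed to act on functions of the exponents. *)
Fixpoint slot op F (l : seq nat) : R :=
  if l is a :: l' then
    \sum_(p <- op a) p.1 * F (p.2 :: l') + slot op (fun r => F (a :: r)) l'
  else 0.

Lemma eq_slot op F G l : F =1 G -> slot op F l = slot op G l.
Proof.
elim: l F G => //= a l IH F G FG; congr (_ + _); last by apply: IH => r.
by apply: eq_bigr => p _; rewrite FG.
Qed.

Lemma slotD op F G l : slot op (fun r => F r + G r) l = slot op F l + slot op G l.
Proof.
elim: l F G => [|a l IH] F G /=; first by rewrite addr0.
rewrite IH addrACA -big_split; congr (_ + _).
by apply: eq_bigr => p _; rewrite mulrDr.
Qed.

Lemma slotZ op c F l : slot op (fun r => c * F r) l = c * slot op F l.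
Proof.
elim: l F => [|a l IH] F /=; first by rewrite mulr0.
rewrite IH mulrDr mulr_sumr; congr (_ + _).
by apply: eq_bigr => p _; rewrite mulrCA.
Qed.

Lemma slotN op F l : slot op (fun r => - F r) l = - slot op F l.
Proof.
rewrite -mulN1r -slotZ; apply: eq_slot => r; by rewrite mulN1r.
Qed.

Lemma slot0 op l : slot op (fun=> 0) l = 0.
Proof.
by elim: l => //= a l ->; rewrite addr0 big1 // => p _; rewrite mulr0.
Qed.

Lemma slot_cat op F l1 l2 :
  slot op F (l1 ++ l2) =
  slot op (fun r => F (r ++ l2)) l1 + slot op (fun r => F (l1 ++ r)) l2.
Proof.
by elim: l1 F => [|a l1 IH] F /=; rewrite ?add0r // IH addrA.
Qed.

Lemma slot_mkseq op F (f : nat -> nat) N :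
  slot op F (mkseq f N) =
  \sum_(i < N) \sum_(p <- op (f i))
    p.1 * F (mkseq (fun t => if t == i then p.2 else f t) N).
Proof.
elim: N F f => [|N IH] F f; first by rewrite big_ord0.
rewrite big_ord_recl /mkseq -[N.+1]/(1 + N)%N iotaD /=.
rewrite -[iota 1 N]/(iota (1 + 0) N) !iotaDl; congr (_ + _).
  apply: eq_bigr => p _; congr (_ * F (_ :: _)); rewrite -!map_comp.
  by apply: eq_map => t /=.
rewrite -map_comp -/(mkseq _ N) (IH _ (f \o _)); apply: eq_bigr => i _.
apply: eq_bigr => p _; congr (_ * F (_ :: _)); rewrite /mkseq -map_comp.
by apply: eq_map.
Qed.

Lemma slot_alternating op F : alternating F -> alternating (slot op F).
Proof.
move=> altF l1; elim: l1 F altF => [|a l1 IH] F altF x y l2 /=.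
  rewrite (eq_slot _ _ (altF [::] x y)) slotN !opprD !addrA; congr (_ + _).
  rewrite addrC; congr (_ + _); rewrite -sumrN; apply: eq_bigr => p _.
    by rewrite (altF [::]) mulrN.
  by rewrite (altF [::]) mulrN.
rewrite IH; last exact: alternating_cons.
rewrite opprD -sumrN; congr (_ + _); apply: eq_bigr => p _.
by rewrite (altF (_ :: _)) mulrN.
Qed.

Lemma slot_ssum op (f : nat -> seq nat -> R) l :
  slot op (ssum f) l =
  ssum (fun b r => \sum_(p <- op b) p.1 * f p.2 r + slot op (f b) r) l.
Proof.
elim: l f => //= b l IH f.
rewrite slotD slotN IH !ssumD ssum_sum.
under eq_bigr => p _ do rewrite mulrBr.
rewrite sumrB.
under [in X in _ - (_ + (X + _))]eq_bigr => p _ do rewrite ssumZ.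
ring.
Qed.

End Slots.

Section Pfaffian.
Variables (R : comNzRingType) (m : nat -> nat -> R).
Hypothesis m_skew : forall a b, m a b = - m b a.

(** The Pfaffian of the matrix [m (nth l i) (nth l j)], for [l] of size [2 * n];
  zero for other lists. *)
Fixpoint pf (n : nat) (l : seq nat) : R :=
  if n is n'.+1 then
    if l is a :: l' then ssum (fun b r => m a b * pf n' r) l' else 0
  else if l is [::] then 1 else 0.

Lemma pfS n a l : pf n.+1 (a :: l) = ssum (fun b r => m a b * pf n r) l.
Proof. by []. Qed.

(** Only the swap of the first two entries needs an argument: expanding along both turns it into an
    exchange of the two removed entries, settled by [ssum_ssumC]. Later swaps pass through the
    induction. *)
Lemma pf_alternating n : alternating (pf n).
Proof.
elim: n => [|n IH] l1 x y l2; first by case: l1 => [|a [|b l1]]; rewrite /= oppr0.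
case: l1 => [|a l1] /=; last first.
  by apply: ssum_alternating => c r1 u v r2; rewrite IH mulrN.
rewrite (m_skew y x) opprB mulNr addrC opprK; congr (_ + _).
case: n {IH} => [|n].
  by rewrite /= -ssumN; apply: eq_ssum => c r; rewrite !mulr0 oppr0.
under eq_ssum => b r do rewrite pfS -ssumZ.
under [RHS]eq_ssum => b r do rewrite pfS -ssumZ.
rewrite ssum_ssumC opprK; apply: eq_ssum => b r; apply: eq_ssum => c s.
by rewrite mulrCA.
Qed.

(** Expanding the second factor of each product along its first entry gives the same double sum over
    [i] and [j], with [m i j] in one and [m j i] in the other. *)
Lemma pf_plucker_sum p q l1 l2 :
  ssum (fun i r => pf p r * pf q.+1 (i :: l2)) l1 +
  ssum (fun j s => pf q s * pf p.+1 (j :: l1)) l2 = 0.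
Proof.
under eq_ssum => i r do rewrite pfS -ssumZ.
under [X in _ + X]eq_ssum => j s do rewrite pfS -ssumZ.
rewrite ssum_exchange -ssumD -[RHS](ssum0 _ l2); apply: eq_ssum => j s.
rewrite -ssumD -[RHS](ssum0 _ l1); apply: eq_ssum => i r.
rewrite (m_skew i j); ring.
Qed.

(** Leibniz rule for [d] on one side, [slot_ssum] on the other. With [d = 0] it yields the loop
    equations of the sign kernel, with [d = euler] the deformation by the cubic weight. *)
Lemma pf_derivation n op (d : R -> R) :
    {morph d : u v / u - v} -> (forall u v, d (u * v) = d u * v + u * d v) ->
    (forall a b, d (m a b) = \sum_(p <- op a) p.1 * m p.2 b
                           + \sum_(p <- op b) p.1 * m a p.2) ->
  forall l, d (pf n l) = slot op (pf n) l.
Proof.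
move=> dB dM dm.
have d0 : d 0 = 0 by rewrite -[X in d X](subrr 0) dB subrr.
have d1 : d 1 = 0.
  by apply: (addrI (d 1)); rewrite addr0 -[in RHS](mulr1 1) dM mul1r mulr1.
have d_ssum f l : d (ssum f l) = ssum (fun c r => d (f c r)) l.
  by elim: l f => [|b l IH] f //=; rewrite dB IH.
have pf0 l : slot op (pf 0) l = 0.
  case: l => [|a [|b l]] //=; first by rewrite big1 ?addr0 // => p _; rewrite mulr0.
  rewrite slot0 !big1 ?addr0 // => p _; exact: mulr0.
elim: n => [|n IH] l; first by rewrite pf0; case: l.
case: l => [|a l]; first by rewrite d0.
rewrite pfS d_ssum /= slot_ssum.
under eq_bigr => p _ do rewrite -ssumZ.
rewrite -ssum_sum -ssumD; apply: eq_ssum => b r.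
rewrite dM dm IH slotZ mulrDl !mulr_suml addrA; congr (_ + _ + _).
  by apply: eq_bigr => p _; rewrite mulrA.
by apply: eq_bigr => p _; rewrite mulrA.
Qed.

Hypothesis two_reg : forall a : R, a = - a -> a = 0.

Lemma pf_plucker n A a b c d : ~~ odd (size A) ->
  pf n A * pf n.+2 (A ++ [:: a; b; c; d]) =
    pf n.+1 (A ++ [:: a; b]) * pf n.+1 (A ++ [:: c; d])
  - pf n.+1 (A ++ [:: a; c]) * pf n.+1 (A ++ [:: b; d])
  + pf n.+1 (A ++ [:: b; c]) * pf n.+1 (A ++ [:: a; d]).
Proof.
move=> evA; have sgnA : (-1) ^+ size A = 1 :> R by rewrite -signr_odd (negbTE evA).
have altp k := @pf_alternating k.
have mv k x l : pf k (x :: A ++ l) = pf k (A ++ x :: l).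
  by rewrite (alternating_move [::] x A l (altp k)) sgnA mul1r.
have dup k x l : x \in A -> pf k (x :: A ++ l) = 0.
  move=> xA; apply: (alternating_nuniq two_reg (altp k)).
  by rewrite /= mem_cat xA.
have E4 : pf n.+2 (A ++ [:: d; a; b; c]) = - pf n.+2 (A ++ [:: a; b; c; d]).
  rewrite altp -[A ++ _]/(A ++ [:: a] ++ _) catA altp -catA.
  by rewrite -[A ++ _]/(A ++ [:: a; b] ++ _) catA altp -catA opprK.
(* An entry of [A] removed from one list is still present in the other, where prefixing it gives a
   repetition; so only [a], [b], [c] and [d] contribute. *)
have := pf_plucker_sum n.+1 n (A ++ [:: a; b; c]) (A ++ [:: d]).
rewrite !ssum_cat sgnA !mul1r.
rewrite [X in X + _ + _]ssum_eq0 => [|i r iA]; last by rewrite dup ?mulr0.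
rewrite [X in _ + (X + _)]ssum_eq0 => [|i r iA]; last by rewrite dup ?mulr0.
rewrite /ssum !mv !cats0 E4 => E.
by apply/subr0_eq; rewrite -[RHS]oppr0 -[in RHS]E; ring.
Qed.

End Pfaffian.

(** * Power sums and loop equations *)

Section PowerSums.
Variable R : comNzRingType.
Implicit Types (F : seq nat -> R) (l : seq nat).

(** A list [l] stands for the alternating polynomial [det (x_i ^ l_j)]; [psum k]
  is then the multiplication by the power sum [p_k], and [low k] the derivation
  [sum_i (d/dx_i) x_i ^ k]. *)
Definition psum k F : seq nat -> R := slot (fun a => [:: (1, (a + k)%N)]) F.
Definition low k F : seq nat -> R :=
  slot (fun a => [:: ((a + k)%:R, (a + k).-1)]) F.
Definition psums (mu : seq nat) F := foldr psum F mu.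

Lemma psum_cons k F a l :
  psum k F (a :: l) = F ((a + k)%N :: l) + psum k (fun r => F (a :: r)) l.
Proof. by rewrite /psum /= big_seq1 mul1r. Qed.

Lemma low_cons k F a l :
  low k F (a :: l) =
  (a + k)%:R * F ((a + k).-1 :: l) + low k (fun r => F (a :: r)) l.
Proof. by rewrite /low /= big_seq1. Qed.

Lemma psumD k F G l : psum k (fun r => F r + G r) l = psum k F l + psum k G l.
Proof. exact: slotD. Qed.

Lemma psumZ k c F l : psum k (fun r => c * F r) l = c * psum k F l.
Proof. exact: slotZ. Qed.

Lemma eq_psum k F G : F =1 G -> psum k F =1 psum k G.
Proof. by move=> FG l; exact: eq_slot. Qed.

Lemma psum_psum_cons j k F a l :
  psum j (fun r => psum k F (a :: r)) l =
  psum j (fun r => F ((a + k)%N :: r)) l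
  + psum j (psum k (fun r => F (a :: r))) l.
Proof. by rewrite -psumD; apply: eq_psum => r; rewrite psum_cons. Qed.

Lemma psumC j k F : psum j (psum k F) =1 psum k (psum j F).
Proof.
move=> l; elim: l F => [|a l IH] F //.
rewrite !(psum_cons _ (psum _ _)) !psum_psum_cons IH !psum_cons addnAC.
ring.
Qed.

(** Commutator of a derivation with a multiplication. Operators act on functions of lists by
    transposition, so compositions read in reverse order and the correction is negative. *)
Lemma low_psum k j F l :
  low k (psum j F) l = psum j (low k F) l - j%:R * psum (k + j).-1 F l.
Proof.
elim: l F => [|a l IH] F; first by rewrite mulr0 subr0.
rewrite low_cons !psum_cons low_cons.
have -> : low k (fun r => psum j F (a :: r)) l =
          low k (fun r => F ((a + j)%N :: r)) l
          + low k (psum j (fun r => F (a :: r))) l.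
  by rewrite -slotD; apply: eq_slot => r; rewrite psum_cons.
have -> : psum j (fun r => low k F (a :: r)) l =
          (a + k)%:R * psum j (fun r => F ((a + k).-1 :: r)) l
          + psum j (low k (fun r => F (a :: r))) l.
  by rewrite -psumZ -psumD; apply: eq_psum => r; rewrite low_cons.
rewrite IH.
(* Truncated predecessors are harmless: where [a + k] or [k + j] is 0, so is the coefficient in
   front. *)
case: (ltnP 0 (a + k)) => [ak|].
  have -> : ((a + k).-1 + j = (a + j + k).-1)%N by lia.
  case: (ltnP 0 (k + j)) => [kj|kj].
    have -> : (a + (k + j).-1 = (a + j + k).-1)%N by lia.
    rewrite !natrD; ring.
  have -> : j = 0%N by lia.
  rewrite !addn0 !mul0r; ring.
case: a => // ; case: k {IH} => // _; rewrite !add0n !addn0 mul0r; ring.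
Qed.

Lemma psum_alternating k F : alternating F -> alternating (psum k F).
Proof. exact: slot_alternating. Qed.

Lemma psums_alternating mu F : alternating F -> alternating (psums mu F).
Proof. by move=> altF; elim: mu => //= k mu; exact: psum_alternating. Qed.

Lemma eq_psums mu F G : F =1 G -> psums mu F =1 psums mu G.
Proof. by move=> FG; elim: mu => //= k mu IH; exact: eq_psum. Qed.

Lemma psums_psum mu k F : psums mu (psum k F) =1 psum k (psums mu F).
Proof.
by elim: mu => //= j mu IH l; rewrite (eq_psum j IH) psumC.
Qed.

Lemma psumsZ mu c F l : psums mu (fun r => c * F r) l = c * psums mu F l.
Proof.
by elim: mu l => //= j mu IH l; rewrite (eq_psum j IH) psumZ.
Qed.

Lemma psum0 F l : psum 0 F l = (size l)%:R * F l.
Proof.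
elim: l F => [|a l IH] F; first by rewrite mul0r.
by rewrite psum_cons IH addn0 /= -natr1 mulrDl mul1r addrC.
Qed.

Lemma psum_mkseq k F (f : nat -> nat) N :
  psum k F (mkseq f N) =
  \sum_(i < N) F (mkseq (fun t => if t == i then (f i + k)%N else f t) N).
Proof.
rewrite /psum slot_mkseq; apply: eq_bigr => i _.
by rewrite big_seq1 mul1r.
Qed.

Fixpoint dsum (f : nat -> seq nat -> R) (mu : seq nat) : R :=
  if mu is b :: mu' then f b mu' + dsum (fun c r => f c (b :: r)) mu' else 0.

Lemma eq_dsum f g mu : (forall c r, f c r = g c r) -> dsum f mu = dsum g mu.
Proof.
elim: mu f g => //= b mu IH f g fg; rewrite fg; congr (_ + _).
by apply: IH => c r; exact: fg.
Qed.

Lemma dsumZ a f mu : dsum (fun c r => a * f c r) mu = a * dsum f mu.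
Proof.
by elim: mu f => [|b mu IH] f /=; rewrite ?mulr0 // IH mulrDr.
Qed.

Lemma psum_dsum k mu (G : nat -> seq nat -> seq nat -> R) l :
  psum k (fun l => dsum (fun c r => G c r l) mu) l =
  dsum (fun c r => psum k (G c r) l) mu.
Proof.
elim: mu G => [|b mu IH] G /=; first exact: slot0.
by rewrite psumD IH.
Qed.

Lemma low_psums k mu F l :
  low k (psums mu F) l + dsum (fun c r => c%:R * psums ((k + c).-1 :: r) F l) mu
  = psums mu (low k F) l.
Proof.
elim: mu l => [|j mu IH] l /=; first exact: addr0.
rewrite low_psum -(eq_psum j IH) psumD psum_dsum.
rewrite (@eq_dsum _
  (fun c r => psum j (fun l => c%:R * psums ((k + c).-1 :: r) F l) l)); last first.
  by move=> c r; rewrite psumZ /= psumC.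
ring.
Qed.

End PowerSums.

(** * Derivations and power sums on the Vandermonde determinant *)

Section Staircase.
Variable R : comNzRingType.
Hypothesis two_reg : forall a : R, a = - a -> a = 0.
Variable F : seq nat -> R.
Hypothesis altF : alternating F.

Definition two_upd (i j u v t : nat) : nat :=
  if t == i then u else if t == j then v else t.

(** An exponent [i + a] strictly between [i] and [j] already belongs to the staircase, so its term
    vanishes; from [a = j - i] on, [a] and [j - i + k - a] exchange the two exponents and their
    terms cancel. Only [a = 0] survives. *)
Lemma staircase_pair k i j N : (i < j < N)%N ->
  \sum_(a < k.+1) F (mkseq (two_upd i j (i + a) (j + (k - a))) N)
  = F (mkseq (two_upd i j i (j + k)) N).
Proof.
move=> ijN; rewrite big_ord_recl /= addn0 subn0 -[RHS]addr0; congr (_ + _).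
pose G a := F (mkseq (two_upd i j (i + a) (j + (k - a))) N).
have G0 a : (0 < a)%N -> (a < j - i)%N -> G a = 0.
  move=> a0 aji; apply: (@alternating_mkseq0 _ two_reg _ _ i (i + a)%N) => //.
    by lia.
  rewrite /two_upd eqxx; case: eqP => [|_]; first lia.
  by case: eqP => // ; lia.
rewrite (_ : \sum_i _ = \sum_(1 <= a < k.+1) G a); last first.
  rewrite big_add1 big_mkord; apply: eq_bigr => a _.
  by rewrite /G; congr (F (mkseq _ N)).
have [dk|kd] := leqP (j - i) k; last first.
  by rewrite big_nat big1 // => a /andP[a1 ak]; apply: G0 => //; lia.
rewrite (big_cat_nat _ (n := j - i)) /=; [|lia|lia].
rewrite big_nat big1 ?add0r => [|a /andP[a1 ak]]; last by apply: G0.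
apply: two_reg; rewrite [LHS]big_nat_rev -sumrN /= big_nat [RHS]big_nat.
apply: eq_bigr => a /andP[a1 ak].
apply: (alternating_mkseq (i := i) (j := j) altF) => //.
- by rewrite /two_upd eqxx; case: (j =P i) => [|_]; rewrite ?eqxx; lia.
- by rewrite /two_upd eqxx; case: (j =P i) => [|_]; rewrite ?eqxx; lia.
- by move=> t /negbTE ti /negbTE tj; rewrite /two_upd ti tj.
Qed.

(** Diagonal terms contribute [k.+1]. Off the diagonal, [staircase_pair] raises only the larger of
    two positions; [i] is the larger one in [i] pairs, each met in two orders, whence [i.*2]. *)
Lemma psum_psum_staircase k N :
  \sum_(a < k.+1) psum a (psum (k - a) F) (iota 0 N) =
  \sum_(i < N) (i.*2 + k.+1)%:R *
    F (mkseq (fun t => if t == i then (i + k)%N else t) N).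
Proof.
have mk f g : f =1 g -> F (mkseq f N) = F (mkseq g N).
  by move=> fg; congr (F _); exact: eq_map.
pose G i j a := F (mkseq (two_upd i j (i + a) (j + (k - a))) N).
pose H i := F (mkseq (fun t => if t == i then (i + k)%N else t) N).
transitivity (\sum_(a < k.+1) \sum_(i < N) \sum_(j < N)
                if i == j then H i else G i j a).
  apply: eq_bigr => a _.
  rewrite -{1}(map_id (iota 0 N)) -/(mkseq id N) psum_mkseq.
  apply: eq_bigr => i _; rewrite psum_mkseq; apply: eq_bigr => j _.
  rewrite -val_eqE; case: (val i =P val j) => /= [->|ij]; apply: mk => t.
    rewrite eqxx; case: eqP => // _.
    by rewrite -addnA subnKC // -ltnS.
  by rewrite /two_upd; case: (t =P val j) => [->|//]; case: eqP ij => // ->; case.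
rewrite exchange_big /=.
under eq_bigr => i _ do rewrite exchange_big /=.
have HG i j : (i < j < N)%N -> \sum_(a < k.+1) G i j a = H j.
  move=> ijN; rewrite staircase_pair //; apply: mk => t.
  by rewrite /two_upd; case: (t =P i) => [->|//]; case: eqP => //; lia.
have GC i j : \sum_(a < k.+1) G i j a = \sum_(a < k.+1) G j i a.
  have [->//|/eqP ij] := eqVneq i j.
  rewrite (reindex_inj rev_ord_inj); apply: eq_bigr => a _.
  apply: mk => t; rewrite /two_upd /= subSS subKn; last by rewrite -ltnS.
  by case: (t =P i) => [->|//]; case: (i =P j).
transitivity (\sum_(i < N) \sum_(j < N)
   ((i == j)%:R * (k.+1%:R * H i) + (i < j)%N%:R * H j + (j < i)%N%:R * H i)).
  apply: eq_bigr => i _; apply: eq_bigr => j _.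
  case: (ltngtP i j) => [ij|ji|/val_inj->].
  - rewrite -val_eqE ltn_eqF // HG ?ij ?ltn_ord //.
    by rewrite !mul0r mul1r add0r addr0.
  - rewrite -val_eqE gtn_eqF // GC HG ?ji ?ltn_ord //.
    by rewrite !mul0r mul1r !add0r.
  - by rewrite eqxx sumr_const card_ord mul1r !mul0r !addr0 mulr_natl.
transitivity (\sum_(i < N) (\sum_(j < N) (i == j)%:R * (k.+1%:R * H i)
    + \sum_(j < N) (i < j)%N%:R * H j + \sum_(j < N) (j < i)%N%:R * H i)).
  by apply: eq_bigr => i _; rewrite !big_split.
rewrite !big_split /=.
rewrite [X in _ + X + _]exchange_big /=.
rewrite -!big_split /=; apply: eq_bigr => i _.
rewrite -!mulr_suml.
have -> : \sum_(j < N) (i == j)%:R = 1 :> R.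
  by rewrite (bigD1 i) //= eqxx big1 ?addr0 // => j /negbTE; rewrite eq_sym => ->.
have -> : \sum_(j < N) (j < i)%N%:R = i%:R :> R.
  rewrite -natr_sum; congr (_%:R); rewrite -big_mkcond /= sum1_card.
  rewrite -[RHS]card_ord -(card_image (f := widen_ord (ltnW (ltn_ord i)))).
    apply: eq_card => j; apply/idP/imageP => [ji|[h _ ->]]; last exact: (ltn_ord h).
    by exists (Ordinal ji) => //; exact: val_inj.
  by move=> a b /(congr1 val) /= /val_inj.
rewrite mul1r -addnn !natrD -/(H i); ring.
Qed.

(** Translation invariance of the Vandermonde determinant: lowering an exponent repeats the previous
    one, and lowering 0 has coefficient 0. *)
Lemma low0_staircase N : low 0 F (iota 0 N) = 0.
Proof.
rewrite -{1}(map_id (iota 0 N)) -/(mkseq id N) /low slot_mkseq.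
apply: big1 => i _; rewrite big_seq1 /= addn0.
case: i => -[|i] iN /=; first by rewrite mul0r.
rewrite (@alternating_mkseq0 _ two_reg _ _ i i.+1) ?mulr0 //; first by lia.
by rewrite eqxx ltn_eqF.
Qed.

(** Twice the coefficient [i + k.+1] of the derivation is [i.*2 + k.+1], as in
    [psum_psum_staircase], plus another [k.+1]. This surplus is the linear term that distinguishes
    real symmetric from Hermitian matrices. *)
Lemma lowS_staircase k N :
  2 * low k.+1 F (iota 0 N) =
  \sum_(a < k.+1) psum a (psum (k - a) F) (iota 0 N)
  + k.+1%:R * psum k F (iota 0 N).
Proof.
rewrite psum_psum_staircase.
rewrite -(map_id (iota 0 N)) -/(mkseq id N) psum_mkseq /low slot_mkseq.
rewrite !mulr_sumr -big_split /=; apply: eq_bigr => i _.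
rewrite big_seq1 /= addnS /= -[(i + k).+1]addn1 -[k.+1]addn1 -addnn !natrD; ring.
Qed.

End Staircase.

Section LoopEquations.
Implicit Types (W : seq nat -> rat) (mu : seq nat).

(** [W mu] stands for the mean of a product of traces of powers, with exponents [mu], of a Gaussian
    real symmetric matrix. Predecessors are truncated only under a factor 0 or in an empty sum. *)
Definition loop_equations (N : nat) W :=
  [/\ W [::] = 1,
      forall mu, W (0%N :: mu) = N%:R * W mu
    & forall k mu, W (k.+1 :: mu) =
        \sum_(a < k) W [:: (a : nat), (k.-1 - a)%N & mu] + k%:R * W (k.-1 :: mu)
        + 2 * dsum (fun c r => c%:R * W ((k + c).-1 :: r)) mu].

Lemma dsum_eq_mem (f g : nat -> seq nat -> rat) mu :
  (forall c r, (size r).+1 = size mu -> (c + sumn r = sumn mu)%N -> f c r = g c r) ->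
  dsum f mu = dsum g mu.
Proof.
elim: mu f g => //= b mu IH f g fg; rewrite fg //; congr (_ + _).
by apply: IH => c r sz sr; rewrite fg //= ?sz // addnCA sr.
Qed.

(** Size plus sum of the list is smaller in every term on the right, so the equations are a
    recursion. *)
Lemma loop_equations_unique N W W' :
  loop_equations N W -> loop_equations N W' -> W =1 W'.
Proof.
move=> [W0 WN WS] [W'0 W'N W'S] mu.
have [n le_n] := ubnP (size mu + sumn mu).
elim: n mu le_n => // n IH [|[|k] mu] /= le_n; first by rewrite W0 W'0.
  by rewrite WN W'N IH //; lia.
rewrite WS W'S; congr (_ + _ + _ * _).
- apply: eq_bigr => a _; apply: IH => /=; have := ltn_ord a; lia.
- case: k le_n => [|k] le_n; first by rewrite !mul0r.
  by rewrite IH //=; lia.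
- apply: dsum_eq_mem => c r sr cr; case: c cr => [|c] cr; first by rewrite !mul0r.
  by rewrite IH //=; lia.
Qed.

End LoopEquations.

Lemma rat_two_reg (a : rat) : a = - a -> a = 0.
Proof. lra. Qed.

(** * Skew moments of the sign kernel *)

Fixpoint gauss (n : nat) : rat :=
  match n with 0%N => 1 | 1%N => 0 | (n'.+1 as n1).+1 => n1%:R * gauss n' end.

Lemma gaussS n : gauss n.+1 = n%:R * gauss n.-1.
Proof. by case: n => [|n] //; rewrite mul0r. Qed.

Fixpoint sgn_row (j : nat) : rat :=
  match j with
  | 0%N => 0 | 1%N => 2
  | (j'.+1 as j1).+1 => 2 * j1%:R * sgn_row j' + 2 * gauss j1
  end.

(** Up to normalisation, [sgn_moment i j] is the integral of
  [sign (y - x) x^i y^j exp (- (x^2 + y^2) / 4)] and [gauss n] is the [n]-th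
  moment of [exp (- x^2 / 2)]; the recursion is an integration by parts in [x],
  the derivative of the sign being a delta function on the diagonal. *)
Fixpoint sgn_moment (i j : nat) : rat :=
  match i with
  | 0%N => sgn_row j | 1%N => - 2 * gauss j
  | (i'.+1 as i1).+1 => 2 * i1%:R * sgn_moment i' j - 2 * gauss (i1 + j)
  end.

Lemma sgn_momentS i j :
  sgn_moment i.+1 j = 2 * i%:R * sgn_moment i.-1 j - 2 * gauss (i + j).
Proof. by case: i => [|i] //=; rewrite mulr0 mul0r sub0r mulNr. Qed.

Lemma sgn_rowS j : sgn_row j.+1 = 2 * j%:R * sgn_row j.-1 + 2 * gauss j.
Proof. by case: j => [|j] //=; rewrite mulr0 mul0r add0r mulr1. Qed.

(** The recursion concerns the first index only. In an induction on [i + j], applying it to both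
    indices leaves Gaussian moments, which match by the recursion of [gauss]; the row of index 0 is
    separate, [sgn_row] being built to obey the recursion in the second index. *)
Lemma sgn_moment_skew i j : sgn_moment i j = - sgn_moment j i.
Proof.
have [n le_n] := ubnP (i + j); elim: n i j le_n => // n IH.
have row j : (j < n.+1)%N -> sgn_moment j 0 = - sgn_row j.
  elim/ltn_ind: j => -[|j] IHj jn; first by rewrite /= oppr0.
  rewrite sgn_momentS sgn_rowS addn0; case: j IHj jn => [|j] IHj jn.
    by rewrite /=; ring.
  by rewrite IHj //=; [ring|lia].
case=> [|i] [|j] le_n; [by rewrite /= oppr0| | |].
- by rewrite (row j.+1) ?opprK //; lia.
- by rewrite (row i.+1) //; lia.
have Ei : i%:R * sgn_moment i.-1 j.+1 = - (i%:R * sgn_moment j.+1 i.-1) :> rat.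
  case: i le_n => [|i] le_n; first by rewrite !mul0r oppr0.
  by rewrite IH ?mulrN //=; lia.
have Ej : j%:R * sgn_moment j.-1 i.+1 = - (j%:R * sgn_moment i.+1 j.-1) :> rat.
  case: j le_n {Ei} => [|j] le_n; first by rewrite !mul0r oppr0.
  by rewrite IH ?mulrN //=; lia.
have E : i%:R * (j%:R * sgn_moment j.-1 i.-1)
       = - (j%:R * (i%:R * sgn_moment i.-1 j.-1)) :> rat.
  case: i le_n {Ei Ej} => [|i] le_n; first by rewrite !mul0r mulr0 oppr0.
  case: j le_n => [|j] le_n; first by rewrite !mul0r mulr0 oppr0.
  by rewrite IH //=; [ring|lia].
have Gi : i%:R * gauss (j + i.-1) = i%:R * gauss (i + j).-1.
  by case: i {IH le_n E Ei Ej} => [|i]; rewrite ?mul0r // addnC.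
have Gj : j%:R * gauss (i + j.-1) = j%:R * gauss (i + j).-1.
  by case: j {IH le_n E Ei Ej Gi} => [|j]; rewrite ?mul0r // addnS.
rewrite !sgn_momentS -!mulrA Ei Ej !sgn_momentS !addnS !gaussS [(j + i)%N]addnC.
rewrite !mulrBr -!mulrA.
rewrite [i%:R * (2 * (j%:R * _))]mulrCA E.
rewrite [i%:R * (2 * _)]mulrCA Gi [j%:R * (2 * gauss _)]mulrCA Gj natrD /=; ring.
Qed.

(** Half of it is [d/dx x^k] twisted by the weight [exp (- x^2 / 4)]. *)
Definition loop_op (k a : nat) : seq (rat * nat) :=
  [:: (2 * (a + k)%:R, (a + k).-1); (-1, (a + k.+1)%N)].

Lemma slot_loop_op k F l : slot (loop_op k) F l = 2 * low k F l - psum k.+1 F l.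
Proof.
elim: l F => [|a l IH] F; first by rewrite mulr0 subr0.
rewrite /= low_cons psum_cons IH /loop_op big_cons big_seq1 /=; ring.
Qed.

(** [loop_op] is a total derivative for the weight, and in a skew moment the delta contributions of
    the two variables cancel. So it annihilates the moments and, by [pf_derivation] with [d = 0],
    their Pfaffian. *)
Lemma low_pf k n l : 2 * low k (pf sgn_moment n) l = psum k.+1 (pf sgn_moment n) l.
Proof.
apply/eqP; rewrite -subr_eq0 -slot_loop_op.
rewrite -(@pf_derivation _ sgn_moment n _ (fun=> 0)) //.
- by move=> u v /=; rewrite mul0r mulr0 addr0.
move=> a b; rewrite /loop_op !big_cons !big_nil /= !addr0 !addnS sgn_momentS.
rewrite [sgn_moment a (b + k).+1]sgn_moment_skew sgn_momentS.
rewrite [sgn_moment (b + k).-1 a]sgn_moment_skew.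
rewrite (_ : b + k + a = a + k + b)%N; last by lia.
ring.
Qed.

(** The expression that de Bruijn's formula gives for the mean of a product of power sums of
    eigenvalues; the identification goes through the loop equations instead. *)
Definition pf_moment n (mu : seq nat) : rat :=
  psums mu (pf sgn_moment n) (iota 0 n.*2) / pf sgn_moment n (iota 0 n.*2).

(** Two evaluations of one derivation, moved across the power sums by [low_psums]: inside them it
    acts on the Pfaffian by [low_pf], outside on the staircase. *)
Lemma pf_moment_loop n :
  pf sgn_moment n (iota 0 n.*2) != 0 -> loop_equations n.*2 (pf_moment n).
Proof.
move=> nz; have altF mu : alternating (psums mu (pf sgn_moment n)).
  apply: psums_alternating; apply: pf_alternating; exact: sgn_moment_skew.
split=> [|mu|k mu]; rewrite /pf_moment.
- by rewrite divff.
- by rewrite /= psum0 size_iota mulrA.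
rewrite -!mulr_suml !mulrA -mulrDl.
have -> : dsum (fun c r => c%:R * (psums ((k + c).-1 :: r) (pf sgn_moment n)
     (iota 0 n.*2) / pf sgn_moment n (iota 0 n.*2))) mu =
  dsum (fun c r => c%:R * psums ((k + c).-1 :: r) (pf sgn_moment n)
     (iota 0 n.*2)) mu / pf sgn_moment n (iota 0 n.*2).
  by rewrite mulrC -dsumZ; apply: eq_dsum => c r; ring.
rewrite mulrA -mulrDl; congr (_ / _).
have := low_psums k mu (pf sgn_moment n) (iota 0 n.*2).
have -> : psums (k.+1 :: mu) (pf sgn_moment n) (iota 0 n.*2)
        = 2 * psums mu (low k (pf sgn_moment n)) (iota 0 n.*2).
  by rewrite /= -psums_psum -psumsZ; apply: eq_psums => l; rewrite low_pf.
move=> <-; rewrite mulrDr; congr (_ + _).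
case: k => [|k]; last exact: (lowS_staircase rat_two_reg).
by rewrite (low0_staircase rat_two_reg) // big_ord0 mul0r mulr0 addr0.
Qed.

Section SchurFunctions.
Variable R : comNzRingType.
Hypothesis two_reg : forall a : R, a = - a -> a = 0.
Variable n : nat.
Implicit Types F : seq nat -> R.

(** For [a < b < c < d] this is the product of the Vandermonde determinant in
  [n + 4] variables with the Schur function of the partition
  [(d - 3, c - 2, b - 1, a)]. *)
Definition tail4 F a b c d :=
  F (iota 0 n ++ [:: n + a; n + b; n + c; n + d]%N).

Lemma tail4_swap F a b c d : alternating F ->
  [/\ tail4 F a b c d = - tail4 F b a c d,
      tail4 F a b c d = - tail4 F a c b d
    & tail4 F a b c d = - tail4 F a b d c].
Proof.
move=> altF; split; rewrite /tail4; first exact: altF.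
  by rewrite -cat_rcons altF cat_rcons.
by rewrite -!(cat_rcons _ (iota 0 n)) -2!(cat_rcons (n + b)%N) altF !cat_rcons.
Qed.

Lemma tail4_dup F a b c d : alternating F -> ~~ uniq [:: a; b; c; d] ->
  tail4 F a b c d = 0.
Proof.
move=> altF nu; apply: (alternating_nuniq two_reg altF).
rewrite -[X in ~~ uniq (_ ++ X)]/(map (addn n) [:: a; b; c; d]) cat_uniq.
by rewrite map_inj_uniq ?(negbTE nu) ?andbF //; exact: addnI.
Qed.

(** An exponent below [n] raised by [k] either stays below [n], on an occupied place, or becomes one
    of [n], ..., [n + k - 1], which the hypothesis puts in the tail. Both give a repetition. *)
Lemma psum_tail4 k F a b c d : alternating F -> (0 < k)%N ->
    {subset iota 0 k <= [:: a; b; c; d]} ->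
  psum k F (iota 0 n ++ [:: n + a; n + b; n + c; n + d]%N) =
  tail4 F (a + k) b c d + tail4 F a (b + k) c d + tail4 F a b (c + k) d
  + tail4 F a b c (d + k).
Proof.
move=> altF k0 kabcd; rewrite /psum slot_cat.
rewrite -[X in X + _ = _]/(psum k (fun r => F (r ++ _)) (iota 0 n)).
rewrite -{1}(map_id (iota 0 n)) -/(mkseq id n) psum_mkseq big1 ?add0r; last first.
  move=> i _; apply: (alternating_nuniq two_reg altF).
  set t := [:: _; _; _; _]; set s := mkseq _ n.
  have si : nth 0%N s i = (i + k)%N by rewrite nth_mkseq ?eqxx.
  have ss : size s = n by rewrite size_mkseq.
  rewrite cat_uniq; apply/and3P => -[us st _].
  have is_ : (i + k)%N \in s by rewrite -si mem_nth ?ss.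
  have [ik|ik] := ltnP (i + k) n.
    have := nth_uniq 0%N _ _ us => /(_ i (i + k)%N).
    rewrite ss si nth_mkseq // => /(_ (ltn_ord i) ik).
    by rewrite -[X in (_ + X)%N == _]/k; case: (_ =P nat_of_ord i); rewrite ?eqxx //; lia.
  case/hasP: st; exists (i + k)%N => //.
  have : (i + k - n)%N \in [:: a; b; c; d].
    by apply: kabcd; rewrite mem_iota; have := ltn_ord i; lia.
  move/(map_f (addn n)); rewrite subnKC //.
by rewrite /slot /= !big_seq1 !mul1r addr0 !addrA /tail4 !addnA.
Qed.

Lemma tail4_psum k F a b c d : alternating F -> (0 < k)%N ->
    all [in [:: a; b; c; d]] (iota 0 k) ->
  tail4 (psum k F) a b c d =
  tail4 F (a + k) b c d + tail4 F a (b + k) c d + tail4 F a b (c + k) d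
  + tail4 F a b c (d + k).
Proof. by move=> altF k0 /allP kabcd; exact: psum_tail4. Qed.

Ltac tail4_compute :=
  repeat match goal with |- context [tail4 ?F ?a ?b ?c ?d] =>
    let alt := constr:(
      ltac:(repeat apply: psum_alternating; assumption) : alternating F) in
    let a' := eval compute in a in let b' := eval compute in b in
    let c' := eval compute in c in let d' := eval compute in d in
    first
    [ progress change (tail4 F a b c d) with (tail4 F a' b' c' d')
    | rewrite (@tail4_dup F a b c d alt isT)
    | match F with psum ?k ?G =>
        rewrite (@tail4_psum k G a b c d
          (ltac:(repeat apply: psum_alternating; assumption)) isT isT) end
    | match eval compute in (b < a)%N with true =>
        let H := fresh in have [H _ _] := @tail4_swap F a b c d alt; rewrite {}H end
    | match eval compute in (c < b)%N with true =>
        let H := fresh in have [_ H _] := @tail4_swap F a b c d alt; rewrite {}H end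
    | match eval compute in (d < c)%N with true =>
        let H := fresh in have [_ _ H] := @tail4_swap F a b c d alt; rewrite {}H end
    ] end.

(** Coefficients are characters of symmetric groups; the right-hand sides are multiples of the Schur
    functions of (1), (2), (1,1), (2,1) and (2,2). *)
Lemma schur_power_sums F : alternating F -> let t := tail4 F in
  let p mu := tail4 (psums mu F) 0 1 2 3 in
  [/\ p [:: 1%N] = t 0%N 1%N 2%N 4%N,
      p [:: 1; 1]%N + p [:: 2%N] = 2 * t 0%N 1%N 2%N 5%N,
      p [:: 1; 1]%N - p [:: 2%N] = 2 * t 0%N 1%N 3%N 4%N,
      p [:: 1; 1; 1]%N - p [:: 3%N] = 3 * t 0%N 1%N 3%N 5%N
    & p [:: 1; 1; 1; 1]%N + 3 * p [:: 2; 2]%N - 4 * p [:: 3; 1]%N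
      = 12 * t 0%N 1%N 4%N 5%N].
Proof.
move=> altF t p; rewrite {}/t {}/p /psums /foldr.
split; tail4_compute; ring.
Qed.

End SchurFunctions.

(** * Gaussian matrices and gluings *)

(** A Gaussian real symmetric matrix [gm_entry], [gm_E] being the expectation
  and [gm_d i j] the derivation dual to the entry [(i, j)]. *)
Record gaussian_matrix (N : nat) := GaussianMatrix {
  gm_ring : comNzRingType;
  gm_entry : 'I_N -> 'I_N -> gm_ring;
  gm_d : 'I_N -> 'I_N -> gm_ring -> gm_ring;
  gm_E : {additive gm_ring -> rat};
  gm_sym : forall i j, gm_entry i j = gm_entry j i;
  gm_dD : forall i j, {morph gm_d i j : p q / p + q};
  gm_dM : forall i j p q, gm_d i j (p * q) = gm_d i j p * q + p * gm_d i j q;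
  gm_d_entry : forall i j k l, gm_d i j (gm_entry k l)
    = ((i == k) && (j == l))%:R + ((i == l) && (j == k))%:R;
  gm_E1 : gm_E 1 = 1;
  gm_E_entry : forall i j p, gm_E (gm_entry i j * p) = gm_E (gm_d i j p)
}.

Section Existence.
Import ssrcomplements mpoly.
Variable N : nat.
Let n := #|{: 'I_N * 'I_N}|.
Let A := {mpoly rat[n]}.

(** Moments of a Gaussian of variance 1/2: if [X] has independent entries of this law, the sum of
    [X] and its transpose has the covariance prescribed by [gm_d_entry]. *)
Fixpoint half_gauss (k : nat) : rat :=
  match k with 0%N => 1 | 1%N => 0
  | (k'.+1 as k1).+1 => k1%:R / 2 * half_gauss k' end.

Lemma half_gaussS k : half_gauss k.+1 = k%:R / 2 * half_gauss k.-1.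
Proof. by case: k => [|k] //; rewrite !mul0r. Qed.

Definition gauss_weight (m : 'X_{1..n}) : rat :=
  \prod_v half_gauss (m v).

Definition gauss_E (p : A) : rat := \sum_(m <- msupp p) p@_m * gauss_weight m.

Lemma gauss_EE p k : (msize p <= k)%N ->
  gauss_E p = \sum_(m : 'X_{1..n < k}) p@_m * gauss_weight m.
Proof.
move=> le_pk; set I : subFinType _ := 'X_{1..n < k}.
rewrite /gauss_E (big_mksub I) ?msupp_uniq //=; last first.
  by move=> m /msize_mdeg_lt /leq_trans; apply.
by rewrite big_rmcond //= => m /memN_msupp_eq0 ->; rewrite mul0r.
Qed.

Lemma gauss_E_additive : zmod_morphism gauss_E.
Proof.
move=> p q; pose k := maxn (msize (p - q)) (maxn (msize p) (msize q)).
rewrite (@gauss_EE (p - q) k) ?(@gauss_EE p k) ?(@gauss_EE q k) /k;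
  rewrite ?leq_max ?leqnn ?orbT //.
by rewrite -sumrB; apply: eq_bigr => m _; rewrite mcoeffB mulrBl.
Qed.

HB.instance Definition _ := GRing.isZmodMorphism.Build A rat gauss_E gauss_E_additive.

Lemma gauss_EX m : gauss_E 'X_[m] = gauss_weight m.
Proof. by rewrite /gauss_E msuppX big_seq1 mcoeffX eqxx mul1r. Qed.

Lemma gauss_EZ c p : gauss_E (c *: p) = c * gauss_E p.
Proof.
rewrite (@gauss_EE (c *: p) (msize p)) ?(@gauss_EE p (msize p)) ?msizeZ_le //.
by rewrite mulr_sumr; apply: eq_bigr => m _; rewrite mcoeffZ mulrA.
Qed.

Lemma gauss_E_var v p : gauss_E ('X_v * p) = 2^-1 * gauss_E p^`M(v).
Proof.
have -> : gauss_E ('X_v * p) = \sum_(m <- msupp p) p@_m * gauss_E ('X_v * 'X_[m]).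
  rewrite {1}[p]mpolyE mulr_sumr raddf_sum; apply: eq_bigr => m _.
  by rewrite /= -scalerAr gauss_EZ.
have -> : gauss_E p^`M(v) = \sum_(m <- msupp p) p@_m * gauss_E 'X_[m]^`M(v).
  rewrite {1}[p]mpolyE (raddf_sum (mderiv v)) raddf_sum; apply: eq_bigr => m _.
  by rewrite /= mderivZ gauss_EZ.
rewrite mulr_sumr; apply: eq_bigr => m _; rewrite [RHS]mulrCA; congr (_ * _).
rewrite -mpolyXD gauss_EX mderivX gauss_EZ gauss_EX /gauss_weight.
rewrite (bigD1 v) //= [in RHS](bigD1 v) //= mnmDE mnmBE mnm1E eqxx add1n subn1.
rewrite half_gaussS -!mulrA mulrCA; congr (_ * (_ * (_ * _))).
apply: eq_bigr => u uv; rewrite mnmDE mnmBE mnm1E eq_sym (negbTE uv).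
by rewrite add0n subn0.
Qed.

Let idx (i j : 'I_N) : 'I_n := enum_rank (i, j).
Let entry i j : A := 'X_(idx i j) + 'X_(idx j i).
Let der (i j : 'I_N) (p : A) : A := 2^-1 *: (p^`M(idx i j) + p^`M(idx j i)).

Lemma gaussian_matrix_exists : gaussian_matrix N.
Proof.
have derX i j k l : ('X_(idx k l) : A)^`M(idx i j) = ((i == k) && (j == l))%:R.
  rewrite mderivX mnm1E (inj_eq enum_rank_inj) xpair_eqE eq_sym (eq_sym l).
  case: eqP => [->|_]; case: eqP => [->|_]; rewrite ?scale0r //= scale1r.
  rewrite (_ : (_ - _)%MM = 0%MM) ?mpolyX0 //.
  by apply/mnmP => t; rewrite mnmBE subnn mnm0E.
refine (@GaussianMatrix N A entry der gauss_E _ _ _ _ _ _).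
- by move=> i j; rewrite /entry addrC.
- by move=> i j p q; rewrite /der !mderivD -scalerDr addrACA.
- move=> i j p q; rewrite /der !mderivM -scalerAl -scalerAr -scalerDr.
  by congr (_ *: _); ring.
- move=> i j k l; rewrite /der /entry !mderivD !derX.
  rewrite [in X in _ *: (_ + X)]addrC (andbC (j == l)) (andbC (j == k)).
  by rewrite -mulr2n -scaler_nat scalerA mulVf ?scale1r.
- by rewrite /= -[1]mpolyX0 gauss_EX; apply: big1 => v _; rewrite mnm0E.
- move=> i j p; rewrite /= /entry /der mulrDl raddfD /= !gauss_E_var.
  by rewrite gauss_EZ raddfD /= mulrDr.
Qed.

End Existence.

Section MatrixLoopEquations.
Variables (N : nat) (G : gaussian_matrix N).
Local Notation A := (gm_ring G).
Local Notation M := (gm_entry G).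
Local Notation d := (@gm_d N G).
Local Notation E := (gm_E G).

Fixpoint mpow (k : nat) (i j : 'I_N) : A :=
  if k is k'.+1 then \sum_c M i c * mpow k' c j else (i == j)%:R.

Definition mtrace k : A := \sum_i mpow k i i.

Lemma sum_delta_l (i : 'I_N) (f : 'I_N -> A) : \sum_c (i == c)%:R * f c = f i.
Proof.
rewrite (bigD1 i) //= eqxx mul1r big1 ?addr0 // => c /negbTE.
by rewrite eq_sym => ->; rewrite mul0r.
Qed.

Lemma mpowD a b i j : mpow (a + b) i j = \sum_c mpow a i c * mpow b c j.
Proof.
elim: a i => [|a IH] i /=; first by rewrite sum_delta_l.
under eq_bigr => c _ do rewrite IH mulr_sumr.
rewrite exchange_big /=; apply: eq_bigr => c _.
by rewrite mulr_suml; apply: eq_bigr => c' _; rewrite mulrA.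
Qed.

Lemma mpow1 i j : mpow 1 i j = M i j.
Proof.
rewrite /= (bigD1 j) //= eqxx mulr1 big1 ?addr0 // => c /negbTE ->.
by rewrite mulr0.
Qed.

Lemma mpow_sym k i j : mpow k i j = mpow k j i.
Proof.
elim: k i j => [|k IH] i j; first by rewrite /= eq_sym.
rewrite -[in LHS]addn1 mpowD [RHS]/=; apply: eq_bigr => c _.
by rewrite mpow1 IH gm_sym mulrC.
Qed.

Lemma sum_mpow_mpow k l : \sum_a \sum_c mpow k c a * mpow l c a = mtrace (k + l).
Proof.
apply: eq_bigr => a _; rewrite mpowD; apply: eq_bigr => c _.
by rewrite mpow_sym.
Qed.

Lemma gm_d1 i j : d i j 1 = 0.
Proof.
by apply: (addrI (d i j 1)); rewrite addr0 -[in RHS](mulr1 1) gm_dM mul1r mulr1.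
Qed.

Lemma gm_d0 i j : d i j 0 = 0.
Proof. by apply: (addrI (d i j 0)); rewrite -gm_dD !addr0. Qed.

Lemma gm_d_sum (I : Type) (r : seq I) (P : pred I) F i j :
  d i j (\sum_(t <- r | P t) F t) = \sum_(t <- r | P t) d i j (F t).
Proof. by apply: (big_morph (d i j)); [exact: gm_dD|exact: gm_d0]. Qed.

Lemma gm_d_mpow k a b i j :
  d a b (mpow k i j) = \sum_(s < k)
    (mpow s i a * mpow (k.-1 - s) b j + mpow s i b * mpow (k.-1 - s) a j).
Proof.
elim: k i j => [|k IH] i j /=.
  by rewrite big_ord0; case: eqP => _; rewrite ?gm_d1 ?gm_d0.
rewrite gm_d_sum big_ord_recl /= subn0.
under eq_bigr => c _ do rewrite gm_dM gm_d_entry IH.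
rewrite big_split /=; congr (_ + _).
  under eq_bigr => c _ do
    rewrite mulrDl [(a == c) && _]andbC -!mulnb !natrM -!mulrA.
  by rewrite big_split /= -!mulr_sumr !sum_delta_l ![in RHS](eq_sym i).
under eq_bigr => c _ do rewrite mulr_sumr.
rewrite exchange_big /=; apply: eq_bigr => s _; rewrite !add0n /bump /= !add1n.
rewrite (_ : k - s.+1 = k.-1 - s)%N; last by lia.
rewrite !mulr_suml -big_split; apply: eq_bigr => c _ /=; ring.
Qed.

Lemma gm_d_mtrace k a b : d a b (mtrace k) = (2 * k)%:R * mpow k.-1 b a.
Proof.
rewrite /mtrace gm_d_sum.
under eq_bigr => i _ do rewrite gm_d_mpow.
rewrite exchange_big /=; transitivity (\sum_(s < k) 2 * mpow k.-1 b a).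
  apply: eq_bigr => s _; rewrite big_split /=.
  have E' x y : \sum_i mpow s i x * mpow (k.-1 - s) y i = mpow k.-1 y x.
    rewrite [in RHS](_ : k.-1 = k.-1 - s + s)%N; last by have := ltn_ord s; lia.
    by rewrite mpowD; apply: eq_bigr => i _; rewrite mulrC.
  by rewrite !E' (mpow_sym _ a b) -mulr2n mulr_natl.
by rewrite sumr_const card_ord -[LHS]mulr_natl mulrA -natrM mulnC.
Qed.

Definition mtraces mu : A := \prod_(k <- mu) mtrace k.

Lemma mtrace_d_mtraces k mu :
  \sum_a \sum_c mpow k c a * d a c (mtraces mu) =
  2 * dsum (fun m r => m%:R * mtraces ((k + m).-1 :: r)) mu.
Proof.
elim: mu => [|b mu IH].
  rewrite /= mulr0; apply: big1 => a _; apply: big1 => c _.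
  by rewrite /mtraces big_nil gm_d1 mulr0.
transitivity (\sum_a \sum_c (mpow k c a * d a c (mtrace b) * mtraces mu)
   + mtrace b * \sum_a \sum_c mpow k c a * d a c (mtraces mu)).
  rewrite mulr_sumr -big_split; apply: eq_bigr => a _ /=.
  rewrite mulr_sumr -big_split; apply: eq_bigr => c _ /=.
  rewrite /mtraces big_cons gm_dM; ring.
rewrite IH /= mulrDr; congr (_ + _); last first.
  rewrite mulrCA; congr (_ * _); rewrite -dsumZ; apply: eq_dsum => m r.
  rewrite /mtraces !big_cons; ring.
rewrite /mtraces big_cons mulrA mulrA.
under eq_bigr => a _ do rewrite -mulr_suml.
rewrite -mulr_suml; congr (_ * _).
under eq_bigr => a _ do
  (under eq_bigr => c _ do rewrite gm_d_mtrace mulrCA; rewrite -mulr_sumr).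
rewrite -mulr_sumr natrM -!mulrA; congr (_ * _).
case: b => [|b]; first by rewrite !mul0r.
by rewrite sum_mpow_mpow addnS.
Qed.

Lemma gm_E_nat k p : E (k%:R * p) = k%:R * E p.
Proof. by rewrite !mulr_natl raddfMn. Qed.

Lemma gm_E_dsum (f : nat -> seq nat -> A) mu :
  E (dsum f mu) = dsum (fun c r => E (f c r)) mu.
Proof.
by elim: mu f => [|b mu IH] f /=; rewrite ?raddf0 // raddfD /= IH.
Qed.

(** Integration by parts of the factor [M a c] in the trace of [M M^k]. The two terms of
    [gm_d_entry] split [M^k] into a product of two traces and, by symmetry of the powers, into a
    single trace; the derivative of another trace merges it with the first. *)
Lemma matrix_loop_equations : loop_equations N (fun mu => E (mtraces mu)).
Proof.
split=> [|mu|k mu]; first by rewrite /mtraces big_nil gm_E1.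
  rewrite /mtraces big_cons -gm_E_nat; congr (E (_ * _)).
  rewrite /mtrace /= (eq_bigr (fun=> 1)) => [|i _]; last by rewrite eqxx.
  by rewrite sumr_const card_ord.
transitivity (E ((\sum_(a < k) mtrace a * mtrace (k.-1 - a) + k%:R * mtrace k.-1)
   * mtraces mu + \sum_a \sum_c mpow k c a * d a c (mtraces mu))).
  transitivity (\sum_a \sum_c E (d a c (mpow k c a * mtraces mu))).
    rewrite {1}/mtraces big_cons /mtrace /= mulr_suml raddf_sum.
    apply: eq_bigr => a _; rewrite mulr_suml raddf_sum.
    by apply: eq_bigr => c _; rewrite -mulrA gm_E_entry.
  under eq_bigr => a _ do rewrite -raddf_sum.
  rewrite -raddf_sum; congr (E _) => /=.
  transitivity (\sum_a \sum_c (d a c (mpow k c a) * mtraces mu)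
     + \sum_a \sum_c mpow k c a * d a c (mtraces mu)).
    rewrite -big_split; apply: eq_bigr => a _; rewrite -big_split.
    by apply: eq_bigr => c _; rewrite gm_dM.
  congr (_ + _); transitivity ((\sum_a \sum_c d a c (mpow k c a)) * mtraces mu).
    by rewrite mulr_suml; apply: eq_bigr => a _; rewrite mulr_suml.
  congr (_ * _).
  transitivity (\sum_a \sum_c (\sum_(s < k) mpow s c c * mpow (k.-1 - s) a a
                 + \sum_(s < k) mpow s c a * mpow (k.-1 - s) c a)).
    apply: eq_bigr => a _; apply: eq_bigr => c _.
    by rewrite gm_d_mpow big_split addrC.
  under [LHS]eq_bigr => a _ do rewrite big_split /=.
  rewrite big_split /=; congr (_ + _).
    under [LHS]eq_bigr => a _ do rewrite exchange_big /=.
    rewrite exchange_big /=; apply: eq_bigr => s _.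
    rewrite exchange_big /= /mtrace mulr_suml; apply: eq_bigr => c _.
    by rewrite mulr_sumr.
  under [LHS]eq_bigr => a _ do rewrite exchange_big /=.
  rewrite exchange_big /= (eq_bigr (fun=> mtrace k.-1)).
    by rewrite sumr_const card_ord mulr_natl.
  move=> s _; rewrite -[in RHS](subnKC (_ : s <= k.-1)%N) -?sum_mpow_mpow //.
  by have := ltn_ord s; lia.
rewrite mtrace_d_mtraces raddfD /= gm_E_nat gm_E_dsum; congr (_ + _).
  rewrite mulrDl raddfD /= mulr_suml raddf_sum -mulrA gm_E_nat.
  rewrite /mtraces big_cons; congr (_ + _); apply: eq_bigr => a _.
  by rewrite !big_cons mulrA.
by congr (_ * _); apply: eq_dsum => c r; rewrite gm_E_nat.
Qed.

End MatrixLoopEquations.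

(** * Wick's theorem as a count of gluings of half-edges *)

Section Gluings.
Variables (H : finType) (C : eqType) (u : H * bool -> C).
Implicit Types (X : {set H}) (f : H * bool).

(** Plays the role of [t2]. *)
Definition flip f : H * bool := (f.1, ~~ f.2).

(** The gluings of the half-edges in [X] compatible with the colouring [u] of
  the flags; [g] plays the role of [t0] on the flags of [X]. *)
Definition is_gluing X (g : {ffun H * bool -> H * bool}) : bool :=
  [forall f, if f.1 \in X then
     [&& (g f).1 \in X, (g f).1 != f.1, g (g f) == f, g (flip f) == flip (g f)
       & u (g f) == u f]
   else g f == f].

Definition gluings X := [set g : {ffun H * bool -> H * bool} | is_gluing X g].

Lemma is_gluingP X (g : {ffun H * bool -> H * bool}) :
  reflect (forall f, if f.1 \in X then
     [/\ (g f).1 \in X, (g f).1 != f.1, g (g f) = f, g (flip f) = flip (g f)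
       & u (g f) = u f]
   else g f = f) (is_gluing X g).
Proof.
apply: (iffP forallP) => gl f; have := gl f; case: ifP => // _.
- by case/and5P=> -> -> /eqP-> /eqP-> /eqP->.
- by move/eqP.
- by case=> -> -> -> -> ->; rewrite !eqxx.
- by move->.
Qed.

Lemma gluings0 : gluings set0 = [set finfun id].
Proof.
apply/setP=> g; rewrite !inE; apply/is_gluingP/eqP => [gl|-> f].
  by apply/ffunP=> f; have := gl f; rewrite inE ffunE.
by rewrite inE ffunE.
Qed.

Section Extend.
Variables (X : {set H}) (h h' : H) (b : bool).
Hypotheses (hX : h \in X) (h'X : h' \in X) (hh' : h' != h).
Hypothesis uhh' : (u (h', b) == u (h, false)) && (u (h', ~~ b) == u (h, true)).

Definition glue_extend (g : {ffun H * bool -> H * bool}) :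
    {ffun H * bool -> H * bool} :=
  [ffun f => if f.1 == h then (h', f.2 (+) b)
             else if f.1 == h' then (h, f.2 (+) b) else g f].

Definition glue_restrict (g : {ffun H * bool -> H * bool}) :
    {ffun H * bool -> H * bool} :=
  [ffun f => if (f.1 == h) || (f.1 == h') then f else g f].

(** As an involution commuting with [flip], [g] is determined on all flags of [h] and [h'] by its
    value at [(h, false)]; [b] selects one of the two ways of matching the sides. *)
Lemma glue_image :
  [set g : {ffun H * bool -> H * bool} in gluings X | g (h, false) == (h', b)]
  = glue_extend @: gluings (X :\ h :\ h').
Proof.
have hNh' : (h == h') = false by rewrite eq_sym (negbTE hh').
have u' c : u (h', c (+) b) = u (h, c).
  by case/andP: uhh' => /eqP E1 /eqP E2; case: c; rewrite ?addTb ?addFb.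
apply/setP=> g; rewrite !inE; apply/andP/imsetP => [[/is_gluingP gl /eqP ghh']|].
  have gh c : g (h, c) = (h', c (+) b).
    case: c => //; have := gl (h, false); rewrite /= hX => -[_ _ _ + _].
    by rewrite ghh' /flip /= => ->; rewrite -addTb.
  have gh' c : g (h', c) = (h, c (+) b).
    have := gl (h, c (+) b); rewrite /= hX => -[_ _ + _ _].
    by rewrite gh addbK.
  exists (glue_restrict g).
    rewrite inE; apply/is_gluingP => f; rewrite !inE !ffunE.
    case: (eqVneq f.1 h') => [//|fh']; first by rewrite orbT.
    case: (eqVneq f.1 h) => [//|fh] /=.
    have := gl f; case: ifP => // fX [gfX gff ggf gfl ugf].
    have gfh : (g f).1 != h.
      apply: contraNneq fh' => gfh; rewrite -ggf (surjective_pairing (g f)) gfh gh.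
      by [].
    have gfh' : (g f).1 != h'.
      apply: contraNneq fh => gfh'; rewrite -ggf (surjective_pairing (g f)) gfh' gh'.
      by [].
    rewrite /= (negbTE gfh) (negbTE gfh') ?fh ?fh' ?(negbTE fh) ?(negbTE fh') /=.
    by rewrite gfX.
  apply/ffunP=> -[f c]; rewrite !ffunE /=.
  case: (eqVneq f h) => [->|fh]; first exact: gh.
  by case: (eqVneq f h') => [->|fh'] //; exact: gh'.
case=> g'; rewrite inE => /is_gluingP gl ->; split; last by rewrite ffunE /= eqxx.
apply/is_gluingP => -[f c]; rewrite !ffunE /=.
case: (eqVneq f h) => [->|fh].
  rewrite hX /= (negbTE hh') eqxx h'X addbK u' addNb; split=> //.
case: (eqVneq f h') => [->|fh'].
  by rewrite h'X /= hNh' eqxx hX addbK -u' addbK addNb.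
have := gl (f, c); rewrite !inE /= fh fh' /=.
case: ifP => // fX [/and3P[gh' gh gX] gff ggf gfl ugf].
by rewrite (negbTE gh) (negbTE gh').
Qed.

Lemma card_glue_image :
  #|[set g : {ffun H * bool -> H * bool} in gluings X | g (h, false) == (h', b)]|
  = #|gluings (X :\ h :\ h')|.
Proof.
rewrite glue_image card_in_imset // => g1 g2; rewrite !inE.
move=> /is_gluingP gl1 /is_gluingP gl2 /ffunP g12; apply/ffunP => f.
have := g12 f; rewrite !ffunE; have := gl1 f; have := gl2 f; rewrite !inE.
case: (eqVneq f.1 h) => [_|fh] /=; first by rewrite andbF => -> ->.
by case: (eqVneq f.1 h') => [_|//] /= -> ->.
Qed.

End Extend.

Lemma card_gluings X h : h \in X ->
  #|gluings X| = (\sum_(h' in X :\ h)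
    ((u (h, false) == u (h', false)) && (u (h, true) == u (h', true))
    + (u (h, false) == u (h', true)) && (u (h, true) == u (h', false)))
     * #|gluings (X :\ h :\ h')|)%N.
Proof.
move=> hX; pose P := [pred p : H * bool | p.1 \in X :\ h].
rewrite -sum1_card (partition_big (fun g : {ffun _} => g (h, false)) P) /=; last first.
  by move=> g; rewrite !inE => /is_gluingP/(_ (h, false)); rewrite /= hX => -[-> ->].
rewrite (eq_bigr (fun p : H * bool => ((u p == u (h, false))
   && (u (flip p) == u (h, true))) * #|gluings (X :\ h :\ p.1)|)%N); last first.
  move=> [h' b]; rewrite !inE /= => /andP[hh' h'X].
  rewrite (eq_bigl (mem [set g : {ffun H * bool -> H * bool} in gluings X
                          | g (h, false) == (h', b)])); last first.
    by move=> g; rewrite !inE.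
  rewrite sum1_card /flip /=.
  have [uu|uu] := boolP (_ && _); first by rewrite mul1n card_glue_image.
  rewrite mul0n; apply: eq_card0 => g; rewrite !inE.
  apply: contraNF uu => /andP[/is_gluingP gl /eqP gh].
  have := gl (h, false); rewrite /= hX gh => -[_ _ ghh gfl ->]; rewrite eqxx /=.
  have := gl (h, true); rewrite /= hX => -[_ _ _ _ <-].
  by rewrite -[(h, true)]/(flip (h, false)) gfl.
transitivity (\sum_(h' in X :\ h) \sum_(b : bool)
    ((u (h', b) == u (h, false)) && (u (h', ~~ b) == u (h, true)))
     * #|gluings (X :\ h :\ h')|)%N.
  by rewrite pair_big /=; apply: eq_big => [[h' b]|[h' b] _]; rewrite /= ?andbT.
apply: eq_bigr => h' _; rewrite big_bool /= -mulnDl addnC; congr (_ * _)%N.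
by rewrite /flip /= !(eq_sym (u (h', _))).
Qed.

End Gluings.

Section GaussianGluings.
Variables (N : nat) (G : gaussian_matrix N) (H : finType).
Variable u : H * bool -> 'I_N.

Definition edge_entry (h : H) : gm_ring G := gm_entry G (u (h, false)) (u (h, true)).

Lemma gm_d_prod i j (X : {set H}) :
  gm_d i j (\prod_(h in X) edge_entry h) =
  \sum_(h in X) gm_d i j (edge_entry h) * \prod_(h' in X :\ h) edge_entry h'.
Proof.
have [n] := ubnP #|X|; elim: n X => // n IH X Xn.
have [->|[h hX]] := set_0Vmem X; first by rewrite !big_set0 gm_d1.
rewrite (big_setD1 h) //= [RHS](big_setD1 h) //= gm_dM; congr (_ + _).
rewrite IH; last by rewrite -ltnS; move: Xn; rewrite (cardsD1 h) hX.
rewrite mulr_sumr; apply: eq_bigr => h' h'X.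
rewrite [X in _ = _ * X](big_setD1 h) /=; last first.
  by move: h'X; rewrite !inE eq_sym => /andP[-> _].
rewrite mulrCA; congr (_ * (_ * _)); apply: eq_bigl => t.
by rewrite !inE andbCA.
Qed.

(** Both sides obey the same recursion: the two ways of gluing [h] to [h'] in [card_gluings] mirror
    the two terms of [gm_d_entry] in an integration by parts. *)
Lemma wick (X : {set H}) :
  #|gluings u X|%:R = gm_E G (\prod_(h in X) edge_entry h).
Proof.
have [n] := ubnP #|X|; elim: n X => // n IH X Xn.
have [->|[h hX]] := set_0Vmem X; first by rewrite gluings0 cards1 big_set0 gm_E1.
rewrite (card_gluings u hX) [in RHS](big_setD1 h hX) /= {1}/edge_entry gm_E_entry.
rewrite natr_sum gm_d_prod [RHS]raddf_sum.
apply: eq_bigr => h' h'X; rewrite natrM IH; last first.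
  move: Xn h'X; rewrite (cardsD1 h) hX => + h'X.
  by rewrite (cardsD1 h') h'X /=; lia.
by rewrite gm_d_entry -natrD gm_E_nat.
Qed.

End GaussianGluings.

(** * Coloured gluings of cubic vertices and their connected components *)

Section Configurations.
Variables (N : nat) (V : finType).
Local Notation flag := (V * 'I_3 * bool)%type.
Local Notation corners := ({ffun 'I_3 -> 'I_N.+1}).
Local Notation config := ({ffun flag -> flag} * {ffun V -> corners})%type.
Implicit Types (S K : {set V}) (g : {ffun flag -> flag}) (x y : config) (f : flag).

(** Corner [r] of a cubic vertex lies between its half-edges [r - 1] and [r];
  [a v r] is its colour. *)
Definition flag_colour (a : {ffun V -> corners}) f : 'I_N.+1 :=
  a f.1.1 (if f.2 then f.1.2 + 1 else f.1.2).

Definition half_edges S : {set V * 'I_3} := [set h | h.1 \in S].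

(** Forced outside [S], so that configurations on all subsets share one type and [cut] undoes
    [paste]. The number of colours is written [N.+1] to have [ord0]. *)
Definition no_colour : corners := [ffun=> ord0].

Definition configs S : {set config} :=
  [set x : config | [forall v, (v \notin S) ==> (x.2 v == no_colour)]
           && is_gluing (flag_colour x.2) (half_edges S) x.1].

Lemma configsP S x : reflect
  ((forall v, v \notin S -> x.2 v = no_colour) /\
   (forall f, if f.1.1 \in S then
     [/\ (x.1 f).1.1 \in S, (x.1 f).1 != f.1, x.1 (x.1 f) = f,
         x.1 (flip f) = flip (x.1 f) & flag_colour x.2 (x.1 f) = flag_colour x.2 f]
    else x.1 f = f)) (x \in configs S).
Proof.
rewrite inE; apply: (iffP andP) => [[/forallP sup /is_gluingP gl]|[x2 gl]].
  split=> [v vS|f]; last by have := gl f; rewrite !inE.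
  by have := sup v; rewrite vS /= => /eqP.
split; last by apply/is_gluingP => f; have := gl f; rewrite !inE.
by apply/forallP => v; apply/implyP => /x2 ->; rewrite eqxx.
Qed.

Definition stable g S : bool := [forall f, (f.1.1 \in S) ==> ((g f).1.1 \in S)].

Lemma stableP g S : reflect (forall f, f.1.1 \in S -> (g f).1.1 \in S) (stable g S).
Proof. by apply: (iffP forallP) => gS f; apply/implyP; exact: gS. Qed.

Definition connected_config g S : bool :=
  [forall K : {set V}, [&& K \subset S, K != set0 & stable g K] ==> (K == S)].

Definition conn_configs S : {set config} :=
  [set x in configs S | connected_config x.1 S].

Definition component g (v : V) : {set V} :=
  \bigcap_(K : {set V} | stable g K && (v \in K)) K.

Lemma mem_component g v : v \in component g v.
Proof. by apply/bigcapP => K /andP[]. Qed.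

Lemma component_stable g v : stable g (component g v).
Proof.
apply/stableP => f /bigcapP fK; apply/bigcapP => K Kv.
by have /andP[/stableP gK _] := Kv; apply: gK; exact: fK.
Qed.

Lemma component_sub g v K : stable g K -> v \in K -> component g v \subset K.
Proof. by move=> gK vK; apply: bigcap_inf; rewrite gK. Qed.

Lemma configs_stable S x : x \in configs S -> stable x.1 S.
Proof.
by move=> /configsP[_ gl]; apply/stableP => f fS; have := gl f; rewrite fS; case.
Qed.

Definition paste K (p : config * config) : config :=
  ([ffun f => if f.1.1 \in K then p.1.1 f else p.2.1 f],
   [ffun v => if v \in K then p.1.2 v else p.2.2 v]).

Definition cut K x : config :=
  ([ffun f => if f.1.1 \in K then x.1 f else f],
   [ffun v => if v \in K then x.2 v else no_colour]).

Lemma stable_compl S x K : x \in configs S -> K \subset S -> stable x.1 K ->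
  forall f, f.1.1 \notin K -> (x.1 f).1.1 \notin K.
Proof.
move=> /configsP[_ gl] KS /stableP gK f; apply: contra => /gK.
have := gl f; case: ifP => [fS [_ _ -> //]|fS ->].
by move=> gfK; have := gl f; rewrite fS => <-.
Qed.

Lemma cut_configs S x K : x \in configs S -> K \subset S ->
  (forall f, f.1.1 \in K -> (x.1 f).1.1 \in K) -> cut K x \in configs K.
Proof.
move=> /configsP[x2 gl] KS gK; apply/configsP; split=> [v vK|f].
  by rewrite ffunE (negbTE vK).
case: ifP => fK; last by rewrite ffunE fK.
have := gl f; rewrite (subsetP KS _ fK) => -[gS gf ggf gfl cf].
rewrite !ffunE /= fK gK //; split=> //.
by rewrite /flag_colour !ffunE fK gK.
Qed.

Lemma cut_connected S x v : x \in configs S -> v \in S ->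
  cut (component x.1 v) x \in conn_configs (component x.1 v).
Proof.
move=> xS vS; have xK := component_stable x.1 v.
have KS := component_sub (configs_stable xS) vS.
rewrite inE (cut_configs xS KS) /=; last exact/stableP.
apply/forallP => K'; apply/implyP => /and3P[K'K /set0Pn[t tK'] /stableP gK'].
have stK' : stable x.1 K'.
  apply/stableP => f fK'; have := gK' f fK'.
  by rewrite ffunE (subsetP K'K _ fK').
rewrite eqEsubset K'K /=; have [vK'|vK'] := boolP (v \in K').
  exact: component_sub.
have /subsetP/(_ _ (subsetP K'K _ tK')) : component x.1 v \subset ~: K'.
  apply: component_sub; last by rewrite inE.
  apply/stableP => f; rewrite !inE; apply: (stable_compl xS _ stK').
  exact: subset_trans KS.
by rewrite inE tK'.
Qed.

Lemma paste_configs S K x y : K \subset S ->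
  x \in configs K -> y \in configs (S :\: K) -> paste K (x, y) \in configs S.
Proof.
move=> KS /configsP[x2 glx] /configsP[y2 gly]; apply/configsP; split=> [v vS|f].
  rewrite ffunE ifN; last by apply: contra vS; exact: (subsetP KS).
  by rewrite y2 // inE negb_and vS orbT.
case: (boolP (f.1.1 \in K)) => fK.
  have := glx f; rewrite fK => -[gK gf ggf gfl cf].
  rewrite (subsetP KS _ fK) !ffunE /= fK gK; split=> //.
    exact: (subsetP KS).
  by rewrite /flag_colour !ffunE gK fK.
have := gly f; rewrite inE fK /=; case: ifP => fS; last by rewrite ffunE (negbTE fK).
rewrite inE => -[/andP[gK gS] gf ggf gfl cf].
rewrite !ffunE /= (negbTE fK) (negbTE gK); split=> //.
by rewrite /flag_colour !ffunE (negbTE gK) (negbTE fK).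
Qed.

Lemma component_paste S K x y v : v \in K -> K \subset S ->
  x \in conn_configs K -> y \in configs (S :\: K) ->
  component (paste K (x, y)).1 v = K.
Proof.
move=> vK KS; rewrite inE => /andP[xK /forallP conn] yK.
have pS := paste_configs KS xK yK.
have pxE f : f.1.1 \in K -> (paste K (x, y)).1 f = x.1 f by rewrite ffunE => ->.
have stK : stable (paste K (x, y)).1 K.
  by apply/stableP => f fK; rewrite pxE //; exact: (stableP _ _ (configs_stable xK)).
have sub := component_sub stK vK.
apply/eqP; have /implyP := conn (component (paste K (x, y)).1 v); apply.
rewrite sub /=; apply/andP; split; first by apply/set0Pn; exists v; exact: mem_component.
apply/stableP => f fC; rewrite -pxE; last exact: (subsetP sub).
exact: (stableP _ _ (component_stable _ v)).
Qed.

(** [paste] glues a connected configuration on [K] to an arbitrary one on the rest, bijectively. *)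
Lemma card_component S K v : v \in K -> K \subset S ->
  #|[set x in configs S | component x.1 v == K]|
    = (#|conn_configs K| * #|configs (S :\: K)|)%N.
Proof.
move=> vK KS; rewrite -cardsX.
rewrite -(card_in_imset (f := paste K)).
  apply: eq_card => x; rewrite inE; apply/andP/imsetP => [[xS /eqP xK]|].
    have vS := subsetP KS _ vK.
    exists (cut K x, cut (S :\: K) x).
      rewrite inE /= -{1 2}xK (cut_connected xS vS) /=.
      apply: (cut_configs xS (subsetDl _ _)) => f; rewrite !inE => /andP[fK fS].
      rewrite (stable_compl xS KS) -?xK ?component_stable ?xK //=.
      exact: (stableP _ _ (configs_stable xS)).
    have [x2 gl] := configsP _ _ xS.
    rewrite [LHS]surjective_pairing; congr (_, _); apply/ffunP => t; rewrite !ffunE /=.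
      case: ifP => [->//|tK]; rewrite inE tK /=.
      by case: ifP => // tS; have := gl t; rewrite tS.
    case: ifP => [->//|tK]; rewrite inE tK /=.
    by case: ifP => // tS; rewrite x2 ?tS.
  case=> -[y z]; rewrite inE /= => /andP[yK zK] ->.
  rewrite (component_paste vK KS) // eqxx; split=> //.
  by apply: paste_configs => //; move: yK; rewrite inE => /andP[].
move=> [x y] [x' y'] /setXP[xK yK] /setXP[xK' yK'].
have {}xK : x \in configs K by move: xK; rewrite inE => /andP[].
have {}xK' : x' \in configs K by move: xK'; rewrite inE => /andP[].
have inj S1 z z' : z \in configs S1 -> z' \in configs S1 ->
    (forall f, f.1.1 \in S1 -> z.1 f = z'.1 f) ->
    (forall t, t \in S1 -> z.2 t = z'.2 t) -> z = z'.
  move=> /configsP[z2 glz] /configsP[z2' glz'] e1 e2.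
  rewrite [z]surjective_pairing [z']surjective_pairing.
  congr (_, _); apply/ffunP => t.
    have := glz t; have := glz' t; case: (boolP (t.1.1 \in S1)) => tS.
      by rewrite e1.
    by move=> -> ->.
  have [tS|tS] := boolP (t \in S1); first by rewrite e2.
  by rewrite z2 ?z2'.
move=> /pair_equal_spec[/ffunP E1 /ffunP E2]; congr (_, _).
  apply: (inj K) => // [f fK|t tK]; first by have := E1 f; rewrite !ffunE fK.
  by have := E2 t; rewrite !ffunE tK.
apply: (inj (S :\: K)) => // [f|t]; rewrite inE => /andP[/negbTE tK _].
  by have := E1 f; rewrite !ffunE tK.
by have := E2 t; rewrite !ffunE tK.
Qed.

Lemma card_configs_component S v : v \in S ->
  #|configs S| = (\sum_(K : {set V} | (v \in K) && (K \subset S))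
                   #|conn_configs K| * #|configs (S :\: K)|)%N.
Proof.
move=> vS; rewrite -sum1_card.
rewrite (partition_big (fun x : config => component x.1 v)
  (fun K : {set V} => (v \in K) && (K \subset S))) /=; last first.
  by move=> x xS; rewrite mem_component component_sub // configs_stable.
apply: eq_bigr => K /andP[vK KS]; rewrite -(card_component vK KS) -sum1_card.
by apply: eq_bigl => x; rewrite inE.
Qed.

Lemma sum_subsets (A : {set V}) (F : nat -> rat) :
  \sum_(B : {set V} | B \subset A) F #|B| =
  \sum_(i < #|A|.+1) 'C(#|A|, i)%:R * F i.
Proof.
rewrite (partition_big (fun B : {set V} => inord #|B| : 'I_#|A|.+1) xpredT) //=.
apply: eq_bigr => i _.
rewrite (eq_bigr (fun=> F i)); last first.
  by move=> B /andP[BA /eqP <-]; rewrite inordK // ltnS subset_leq_card.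
rewrite sumr_const mulr_natl -cards_draws; congr (_ *+ _); apply: eq_card => B.
rewrite !inE [_ \in _]unfold_in; apply: andb_id2l => BA.
by rewrite -val_eqE /= inordK // ltnS subset_leq_card.
Qed.

Lemma sum_subsets_through S v (F : nat -> rat) : v \in S ->
  \sum_(K : {set V} | (v \in K) && (K \subset S)) F #|K|
   = \sum_(i < #|S|) 'C(#|S|.-1, i)%:R * F i.+1.
Proof.
move=> vS; have cS : #|S| = #|S :\ v|.+1 by rewrite (cardsD1 v S) vS.
rewrite [in RHS]cS /= -(sum_subsets (S :\ v) (fun i => F i.+1)).
rewrite (reindex_onto (fun B => v |: B) (fun K => K :\ v)) /=; last first.
  by move=> K /andP[vK _]; rewrite setD1K.
apply: eq_big => [B|B /andP[_ /eqP vB]]; last first.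
  by rewrite cardsU1 -vB !inE eqxx.
rewrite setU11 /= subUset sub1set vS /= subsetD1.
apply: andb_id2l => BS; apply/eqP/idP => [vB|vB].
  by rewrite -vB; apply/setD1P => -[/eqP].
exact: setU1K.
Qed.

End Configurations.

Section CountingConfigurations.
Variables (N : nat) (G : gaussian_matrix N.+1).

Definition cubic_moment (s : nat) : rat := gm_E G (mtraces G (nseq s 3%N)).

(** The indices are the colours of the three corners of a cubic vertex, and each entry is a
    half-edge carrying the colours of its two sides. *)
Lemma mtrace3 : mtrace G 3 = \sum_(a : {ffun 'I_3 -> 'I_N.+1})
   \prod_r gm_entry G (a r) (a (r + 1)).
Proof.
pose tri (p : 'I_N.+1 * 'I_N.+1 * 'I_N.+1) : {ffun 'I_3 -> 'I_N.+1} :=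
  [ffun r : 'I_3 => nth ord0 [:: p.1.1; p.1.2; p.2] r].
rewrite (reindex tri) /=; last first.
  exists (fun a : {ffun 'I_3 -> 'I_N.+1} => (a 0, a 1, a 2)).
    by move=> [[i j] k] _; rewrite !ffunE.
  move=> a _; apply/ffunP => r; rewrite ffunE.
  by case: r => -[|[|[|r]]] // ri /=; congr (a _); apply: val_inj.
rewrite -(pair_big xpredT xpredT
  (fun p c => \prod_r gm_entry G (tri (p, c) r) (tri (p, c) (r + 1)))) /=.
rewrite -(pair_big xpredT xpredT (fun i j =>
  \sum_c \prod_r gm_entry G (tri (i, j, c) r) (tri (i, j, c) (r + 1)))) /=.
apply: eq_bigr => i _; rewrite /=; apply: eq_bigr => j _.
rewrite mulr_sumr; apply: eq_bigr => k _.
rewrite -/(mpow G 1 k i) mpow1 !big_ord_recl big_ord0 mulr1 !ffunE.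
by [].
Qed.

Lemma card_configs (V : finType) (S : {set V}) :
  #|configs N S|%:R = cubic_moment #|S|.
Proof.
rewrite /cubic_moment.
have -> : mtraces G (nseq #|S| 3%N) = \prod_(v in S) mtrace G 3.
  rewrite prodr_const /mtraces; elim: #|S| => [|s IH]; first by rewrite big_nil.
  by rewrite big_cons IH exprS.
pose F (v : V) (c : {ffun 'I_3 -> 'I_N.+1}) := \prod_r gm_entry G (c r) (c (r + 1)).
rewrite (eq_bigr (fun v => \sum_c F v c)) => [|v _]; last exact: mtrace3.
rewrite (big_distr_big (no_colour N)) [RHS]raddf_sum /= -sum1_card.
pose P (a : {ffun V -> {ffun 'I_3 -> 'I_N.+1}}) := a \in pffun_on (no_colour N) S predT.
have PE a : P a = [forall v, (v \notin S) ==> (a v == no_colour N)].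
  apply/pffun_onP/forallP => [[/supportP sa _] v|sa].
    by apply/implyP => /sa ->.
  by split=> //; apply/supportP => v vS; have := sa v; rewrite vS /= => /eqP.
rewrite (partition_big snd P) /=; last by move=> x; rewrite inE PE => /andP[].
rewrite natr_sum; apply: eq_bigr => a aP.
transitivity (#|gluings (flag_colour a) (half_edges S)|%:R : rat).
  rewrite sum1_card; congr (_%:R).
  have inj : injective (fun g : {ffun V * 'I_3 * bool -> V * 'I_3 * bool} => (g, a)).
    by move=> g h [].
  rewrite -[RHS](card_imset _ inj).
  apply: eq_card => -[g b]; rewrite [LHS]unfold_in /= !inE /=.
  apply/andP/imsetP => [[/andP[_ gl] /eqP ba]|[h]].
    by rewrite ba in gl *; exists g; rewrite // inE.
  by rewrite inE => hgl [-> ->]; rewrite eqxx -PE aP.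
rewrite (wick G); congr (gm_E _ _).
rewrite /half_edges (eq_bigl (fun h => (h.1 \in S) && true)); last first.
  by move=> h; rewrite inE andbT.
rewrite -(pair_big (mem S) xpredT (fun v r => edge_entry G (flag_colour a) (v, r))) /=.
by apply: eq_bigr => v _; apply: eq_bigr => r _.
Qed.

Definition num_connected (s : nat) : nat := #|conn_configs N [set: 'I_s]|.

Lemma card_conn_rec (V : finType) (S : {set V}) v : v \in S ->
  cubic_moment #|S| = #|conn_configs N S|%:R +
    \sum_(K : {set V} | (v \in K) && (K \proper S))
       #|conn_configs N K|%:R * cubic_moment (#|S| - #|K|).
Proof.
move=> vS; rewrite -card_configs (card_configs_component N vS).
rewrite (bigD1 S) /= ?vS ?subxx // setDv natrD natrM; congr (_ + _).
  by rewrite card_configs cards0 /cubic_moment /mtraces big_nil gm_E1 mulr1.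
rewrite natr_sum; apply: eq_big => [K|K /andP[/andP[_ KS] _]].
  by rewrite properEneq -andbA [(K \subset S) && _]andbC.
by rewrite natrM card_configs cardsD (setIidPr KS).
Qed.

(** The moments depend on the cardinal alone and determine the connected counts through
    [card_conn_rec]; the recursion is run in parallel on [S] and on a standard set of the same
    size. *)
Lemma card_conn (V : finType) (S : {set V}) :
  S != set0 -> #|conn_configs N S| = num_connected #|S|.
Proof.
have [n] := ubnP #|S|; elim: n V S => // n IH V S Sn S0.
have [v vS] := set0Pn _ S0.
have [w wS] : exists w : 'I_#|S|, w \in [set: 'I_#|S|].
  have S1 : (0 < #|S|)%N by apply/card_gt0P; exists v.
  by exists (Ordinal S1); rewrite inE.
have proper_sum (U : finType) (T : {set U}) u : u \in T -> #|T| = #|S| ->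
    (forall K : {set U}, K != set0 -> (#|K| < #|S|)%N ->
       #|conn_configs N K| = num_connected #|K|) ->
    cubic_moment #|S| = #|conn_configs N T|%:R + \sum_(i < #|S|)
      'C(#|S|.-1, i)%:R * (if (i.+1 < #|S|)%N then
        (num_connected i.+1)%:R * cubic_moment (#|S| - i.+1) else 0).
  move=> uT TS IHU; rewrite -TS (card_conn_rec uT) TS; congr (_ + _).
  rewrite -TS -(sum_subsets_through (fun i => if (i < #|T|)%N then
        (num_connected i)%:R * cubic_moment (#|T| - i) else 0) uT).
  rewrite -big_mkcondr /=; apply: eq_big => [K|K /andP[uK KT]].
    by rewrite properEcard andbA.
  rewrite IHU ?TS //; first by apply/set0Pn; exists u.
  by rewrite -TS; exact: proper_card.
have IHS (U : finType) (K : {set U}) : K != set0 -> (#|K| < #|S|)%N ->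
    #|conn_configs N K| = num_connected #|K|.
  by move=> K0 KS; apply: IH => //; apply: leq_trans KS _; rewrite -ltnS.
have := proper_sum _ _ _ vS erefl (IHS V).
rewrite (proper_sum _ _ _ wS _ (IHS _)) ?cardsT ?card_ord // => /addIr/eqP.
by rewrite eqr_nat => /eqP.
Qed.

(** The exponential formula in recursive form: the sum is over the component of one marked vertex,
    whose [i] other vertices are chosen among [s.-1]. *)
Lemma cubic_moment_rec s : (0 < s)%N -> cubic_moment s =
  \sum_(i < s) 'C(s.-1, i)%:R * (num_connected i.+1)%:R * cubic_moment (s - i.+1).
Proof.
case: s => // s _; have cT : #|[set: 'I_s.+1]| = s.+1 by rewrite cardsT card_ord.
have inT : ord0 \in [set: 'I_s.+1] by rewrite inE.
rewrite -{1}cT -card_configs (card_configs_component N inT) natr_sum.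
transitivity (\sum_(K : {set 'I_s.+1} | (ord0 \in K) && (K \subset [set: 'I_s.+1]))
  (num_connected #|K|)%:R * cubic_moment (s.+1 - #|K|)).
  apply: eq_bigr => K /andP[K0 _]; rewrite natrM card_configs card_conn.
    rewrite setTD; congr (_ * cubic_moment _).
    have cC := cardsC K; rewrite card_ord in cC.
    by rewrite -[X in (X - _)%N]cC addKn.
  by apply/set0Pn; exists ord0.
rewrite (sum_subsets_through
  (fun i => (num_connected i)%:R * cubic_moment (s.+1 - i)) inT).
by rewrite cT; apply: eq_bigr => i _; rewrite mulrA.
Qed.

End CountingConfigurations.

(** * Counting rooted maps *)

Section FlagOrbits.
Variable F : finType.
Implicit Types (A : {set {perm F}}) (K : {set F}) (s t : {perm F}).

Lemma orbit_sub_stable A K f :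
    (forall t g, t \in A -> g \in K -> t g \in K) -> f \in K ->
  orbit 'P <<A>> f \subset K.
Proof.
move=> AK fK; rewrite acts_sub_orbit // gen_subG.
apply/subsetP => t tA; apply/astabsP => g; apply/idP/idP; last exact: AK.
move=> tg; have tK : [set t h | h in K] = K.
  apply/eqP; rewrite eqEcard card_imset ?leqnn ?andbT; last exact: perm_inj.
  by apply/subsetP => _ /imsetP[h hK ->]; exact: AK.
by move: tg; rewrite /= apermE -{1}tK mem_imset //; exact: perm_inj.
Qed.

Lemma mem_flag_orbit A t f g : t \in A ->
  (t g \in orbit 'P <<A>> f) = (g \in orbit 'P <<A>> f).
Proof.
by move=> tA; rewrite -[t g]/('P%act g t) orbit_actr // mem_gen.
Qed.

Lemma transitive_stable A : (0 < #|F|)%N ->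
  [transitive <<A>>, on [set: F] | 'P] <->
  forall K : {set F}, K != set0 ->
    (forall t g, t \in A -> g \in K -> t g \in K) -> K = setT.
Proof.
case/card_gt0P => f0 _; split=> [/imsetP[f _ fT] K /set0Pn[g gK] AK|H].
  apply/eqP; rewrite eqEsubset subsetT fT.
  have /orbit_eqP <- : g \in orbit 'P <<A>> f by rewrite -fT inE.
  exact: orbit_sub_stable.
apply/imsetP; exists f0; rewrite ?inE //; apply/esym/H.
  by apply/set0Pn; exists f0; exact: orbit_refl.
by move=> t g tA; rewrite mem_flag_orbit.
Qed.

Lemma flag_orbits_conj A s :
  flag_orbits (A :^ s)%g = [set [set s f | f in K] | K : {set F} in flag_orbits A].
Proof.
have E f : orbit 'P (<<A>> :^ s)%g (s f) = [set s h | h in orbit 'P <<A>> f].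
  apply/setP => g; rewrite -[g](permKV s) mem_imset; last exact: perm_inj.
  exact: (orbit_conjsg 'P%act <<A>>%g s).
apply/setP => K; apply/imsetP/imsetP => [[f _ ->]|[_ /imsetP[f _ ->] ->]].
  exists (orbit 'P <<A>> (s^-1 f)%g); first exact: imset_f.
  by rewrite -E permKV genJ.
by exists (s f); rewrite ?inE // genJ E.
Qed.

(** For [mt0] and [mt1] the orbits are the faces: a power of the number of colours thus records the
    number of faces. *)
Lemma card_invariant_colours (C : finType) (c0 : C) A :
  #|[set col : {ffun F -> C} | [forall t in A, forall f, col (t f) == col f]]|
  = (#|C| ^ #|flag_orbits A|)%N.
Proof.
pose o f := orbit 'P <<A>> f.
pose lift (b : {ffun {set F} -> C}) : {ffun F -> C} := [ffun f => b (o f)].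
rewrite -(card_pffun_on c0 (flag_orbits A) (predT : pred C)) -(card_in_imset (f := lift)).
  apply: eq_card => col; rewrite inE; apply/idP/imsetP.
    move=> /forall_inP colA; exists [ffun K => if K \in flag_orbits A then
        (if [pick f in K] is Some f then col f else c0) else c0].
      apply/pffun_onP; split=> //; apply/supportP => K /negbTE KA.
      by rewrite ffunE KA.
    apply/ffunP => f; rewrite !ffunE imset_f ?inE //.
    case: pickP => [g gf|/(_ f)]; last by rewrite orbit_refl.
    have sub : o f \subset [set h | col h == col f].
      apply: orbit_sub_stable; last by rewrite inE.
      move=> t h tA; rewrite !inE => /eqP <-.
      by have /forallP := colA t tA.
    by have := subsetP sub g gf; rewrite inE => /eqP.
  case=> b _ ->; apply/forall_inP => t tA; apply/forallP => f; rewrite !ffunE.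
  by apply/eqP; congr (b _); rewrite /o -[t f]/('P%act f t) orbit_act // mem_gen.
move=> b b' /pffun_onP[/supportP sb _] /pffun_onP[/supportP sb' _] /ffunP bb'.
apply/ffunP => K; have [/imsetP[f _ ->]|KA] := boolP (K \in flag_orbits A).
  by have := bb' f; rewrite !ffunE.
by rewrite sb ?sb'.
Qed.

End FlagOrbits.

Section Relabelling.
Variable F : finType.
Local Notation rmap := ({perm F} * {perm F} * {perm F} * F)%type.
Implicit Types (M : rmap) (s t : {perm F}).

Lemma fpf_involutionP t :
  reflect (forall f, t (t f) = f /\ t f != f) (fpf_involution t).
Proof.
apply: (iffP forallP) => H f; first by have /andP[/eqP] := H f.
by have [-> ->] := H f; rewrite eqxx.
Qed.

Lemma fpf_involutionJ s t : fpf_involution t -> fpf_involution (t ^ s)%g.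
Proof.
move=> /fpf_involutionP tf; apply/fpf_involutionP => f; rewrite -[f](permKV s).
rewrite !permJ (inj_eq perm_inj); have [-> tn] := tf (s^-1 f)%g; split=> //.
Qed.

Definition relabel s M : rmap :=
  ((mt0 M ^ s)%g, (mt1 M ^ s)%g, (mt2 M ^ s)%g, s (mroot M)).

Lemma rooted_isoP M M' : reflect (exists s, M' = relabel s M) (rooted_iso M M').
Proof.
have J s t t' : (forall f, s (t f) = t' (s f)) -> t' = (t ^ s)%g.
  by move=> st; apply/permP => f; rewrite -[f](permKV s) permJ st.
apply: (iffP existsP) => [[s /and4P[/forallP h0 /forallP h1 /forallP h2 /eqP hr]]|[s ->]].
  exists s; case: M' h0 h1 h2 hr => [[[t0 t1] t2] r] h0 h1 h2 hr.
  by rewrite /relabel hr; congr (_, _, _, _); apply: J => f; apply/eqP.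
by exists s; rewrite eqxx andbT; apply/and3P; split; apply/forallP => f; rewrite permJ.
Qed.

(** Rooted maps have no automorphisms: two relabellings with the same result agree at the root, and
    the flags where they agree form a stable set. *)
Lemma relabel_inj M : is_rooted_map M -> injective (relabel^~ M).
Proof.
case/and5P=> _ _ _ _ tr s s' [e0 e1 e2 er].
have F0 : (0 < #|F|)%N by apply/card_gt0P; exists (mroot M).
have sT : [set f | s f == s' f] = setT.
  apply: ((transitive_stable _ F0).1 tr).
    by apply/set0Pn; exists (mroot M); rewrite inE er.
  move=> t g tA; rewrite !inE => /eqP sg.
  have : (t ^ s = t ^ s')%g by move: tA; rewrite !inE -orbA => /or3P[]/eqP->.
  by move/permP => /(_ (s g)); rewrite {2}sg !permJ => ->.
by apply/permP => f; move/setP: sT => /(_ f); rewrite !inE => /eqP.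
Qed.

Lemma is_rooted_map_relabel s M : is_rooted_map M -> is_rooted_map (relabel s M).
Proof.
case/and5P=> f0 f1 f2 f02 tr; rewrite /is_rooted_map /relabel /mt0 /mt1 /mt2 /=.
rewrite !fpf_involutionJ //= -conjMg fpf_involutionJ //=.
rewrite -!conjg_set1 -!conjUg.
rewrite /atrans -/(flag_orbits _) flag_orbits_conj.
apply/imsetP; exists [set: F]; first exact: tr.
apply/setP => f; rewrite inE -[f](permKV s) mem_imset ?inE //; exact: perm_inj.
Qed.

Lemma mvertices_relabel s M :
  mvertices (relabel s M) = [set [set s f | f in K] | K : {set F} in mvertices M].
Proof. by rewrite /mvertices /relabel -flag_orbits_conj conjUg !conjg_set1. Qed.

Lemma mfaces_relabel s M :
  mfaces (relabel s M) = [set [set s f | f in K] | K : {set F} in mfaces M].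
Proof. by rewrite /mfaces /relabel -flag_orbits_conj conjUg !conjg_set1. Qed.

Lemma is_cubic_relabel s M : is_cubic M -> is_cubic (relabel s M).
Proof.
move=> /forall_inP cM; apply/forall_inP => K'.
rewrite mvertices_relabel => /imsetP[K KM ->].
by rewrite /vertex_degree card_imset; [exact: cM|exact: perm_inj].
Qed.

End Relabelling.

Lemma card_cubic_rooted_maps n k :
  #|cubic_rooted_maps n k| = (num_cubic_maps n k * (6 * n)`!)%N.
Proof.
rewrite /num_cubic_maps; apply: card_uniform_partition; last first.
  apply: equivalence_partitionP => M1 M2 M3 _ _ _; exact: rooted_iso_equiv.
move=> _ /imsetP[M MX ->]; move: (MX); rewrite inE => /and4P[rM cM /eqP vM /eqP fM].
rewrite -(card_Sn (6 * n)) -(card_imset _ (relabel_inj rM)).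
apply: eq_card => M'; rewrite inE; apply/andP/imsetP => [[_ /rooted_isoP[s ->]]|[s _ ->]].
  by exists s.
split; last by apply/rooted_isoP; exists s.
rewrite inE is_rooted_map_relabel // is_cubic_relabel // mvertices_relabel mfaces_relabel.
have inj : injective (fun K : {set 'I_(6 * n)} => [set s f | f in K]).
  exact/imset_inj/perm_inj.
by rewrite !(card_imset _ inj) vM fM !eqxx.
Qed.

(** The involution [t1] of the standard cubic vertex. *)
Definition turn (V : finType) (f : V * 'I_3 * bool) : V * 'I_3 * bool :=
  if f.2 then (f.1.1, f.1.2 + 1, false) else (f.1.1, f.1.2 - 1, true).

Lemma turnK (V : finType) : involutive (@turn V).
Proof. by case=> -[v r] []; rewrite /turn /= ?addrK ?subrK. Qed.

Lemma flipK (H : finType) : involutive (@flip H).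
Proof. by case=> h b; rewrite /flip /= negbK. Qed.

Lemma I3_cases (r : 'I_3) : [\/ r = 0, r = 1 | r = 2].
Proof.
case: r => -[|[|[|r]]] // ri; [apply: Or31|apply: Or32|apply: Or33]; exact: val_inj.
Qed.

(** [flip] and [turn] alternate around the six flags of a vertex, so an invariant property spreads
    from one of them to all. *)
Lemma hexagon_connected (V : finType) (P : V * 'I_3 * bool -> Prop) v x y :
    (forall f, P f -> P (flip f)) -> (forall f, P f -> P (turn f)) ->
  P (v, x.1, x.2) -> P (v, y.1, y.2).
Proof.
move=> Pf Pt; have Pf' f : P (flip f) -> P f by move/Pf; rewrite flipK.
have Pt' f : P (turn f) -> P f by move/Pt; rewrite turnK.
suff base z : P (v, z.1, z.2) <-> P (v, 0, false) by move/base/base.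
have step r b : P (v, r + 1, b) <-> P (v, r, b).
  have E : P (v, r + 1, false) <-> P (v, r, false).
    split=> [Pr|/Pf/Pt //].
    by apply: Pf'; apply: Pt'.
  by case: b => //; split=> /Pf /E /Pf.
have all_r r b : P (v, r, b) <-> P (v, 0, b).
  have s0 := step 0 b; have s1 := step 1 b; rewrite add0r in s0.
  by case: (I3_cases r) => -> //; split=> [/s1/s0|/s0/s1].
case: z => r b /=; rewrite all_r; case: b => //; split=> [/Pf|/Pf] //.
Qed.

Section CubicVertices.
Variables (F : finType) (t1 t2 : {perm F}).
Hypotheses (t1f : fpf_involution t1) (t2f : fpf_involution t2).
Local Notation orb f := (orbit 'P <<[set t1; t2]>>%g f).

Let rho f := t1 (t2 f).

Lemma fpf_invol (t : {perm F}) : fpf_involution t -> involutive t.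
Proof. by move/fpf_involutionP => H f; case: (H f). Qed.

Lemma fpf_neq (t : {perm F}) f : fpf_involution t -> t f != f.
Proof. by move/fpf_involutionP => /(_ f) []. Qed.

(** [t2 rho^k] is a reflection of the dihedral group of [t1] and [t2], conjugate to one of them and
    so without fixed point. Conjugation changes [k] by 2, hence the induction on two successive
    values. *)
Lemma rho_flip_neq k f : t2 (iter k rho f) != f.
Proof.
suff [] : (forall f, t2 (iter k rho f) != f) /\
          (forall f, t2 (iter k.+1 rho f) != f) by [].
elim: k {f} => [|k [IH0 IH1]].
  split=> f; first exact: fpf_neq.
  apply/eqP => /(congr1 t2); rewrite (fpf_invol t2f) /= /rho => /eqP.
  by apply/negP; exact: fpf_neq.
split=> // f; apply/eqP => /(congr1 t2); rewrite (fpf_invol t2f) iterS {1}/rho.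
move=> /(congr1 t1); rewrite (fpf_invol t1f) -/(rho f) iterSr => /eqP.
by apply/negP; exact: IH0.
Qed.

(** An orbit is a rotation cycle and its mirror image, disjoint by [rho_flip_neq]; in particular the
    halving in [vertex_degree] is exact. *)
Lemma rho_porbit f : #|orb f| = #|porbit (t2 * t1)%g f|.*2.
Proof.
set s := (t2 * t1)%g; have sE g : s g = rho g by rewrite permM.
have itE k g : (s ^+ k)%g g = iter k rho g.
  by rewrite permX; apply: eq_iter.
set A := porbit s f; pose B := [set t2 g | g in A].
have cB : #|B| = #|A| by rewrite card_imset //; exact: perm_inj.
have memA g : (s g \in A) = (g \in A).
  by rewrite -!eq_porbit_mem -[s g]/((s ^+ 1)%g g) porbit_perm.
have orbT2 g : (t2 g \in orb f) = (g \in orb f).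
    by rewrite mem_flag_orbit // !inE eqxx orbT.
have orbT1 g : (t1 g \in orb f) = (g \in orb f) by rewrite mem_flag_orbit // !inE eqxx.
have -> : orb f = A :|: B.
  apply/eqP; rewrite eqEsubset; apply/andP; split.
    apply: orbit_sub_stable; last by rewrite inE porbit_id.
    have t2AB g : g \in A :|: B -> t2 g \in A :|: B.
      rewrite !inE => /orP[gA|/imsetP[h hA ->]]; first by rewrite imset_f ?orbT.
      by rewrite (fpf_invol t2f) hA.
    move=> t g; rewrite !inE => /orP[]/eqP-> gAB; last first.
      by have := t2AB g; rewrite !inE; apply.
    case/orP: gAB => [gA|/imsetP[h hA ->]].
      have gs : g = s (s^-1 g)%g by rewrite permKV.
      rewrite {1 2}gs sE /rho (fpf_invol t1f) [X in _ || X]imset_f ?orbT //.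
      by rewrite -memA -gs.
    by rewrite -[t1 _]/(rho h) -sE memA hA.
  have AO g : g \in A -> g \in orb f.
    case/porbitP => i ->; rewrite itE; elim: i => [|i IH]; first exact: orbit_refl.
    by rewrite iterS /rho orbT1 orbT2.
  rewrite subUset; apply/andP; split; first by apply/subsetP.
  by apply/subsetP => _ /imsetP[g /AO gO ->]; rewrite orbT2.
have dAB : A :&: B = set0.
  apply/setP => g; rewrite !inE; apply/andP => -[gA /imsetP[h hA gh]].
  have : h \in porbit s g.
    rewrite porbit_sym -eq_porbit_mem; move: hA gA.
    by rewrite -!eq_porbit_mem => /eqP-> /eqP->.
  case/porbitP => k hk; have := rho_flip_neq k g.
  by rewrite -itE -hk -gh eqxx.
by rewrite cardsU dAB cards0 subn0 cB addnn.
Qed.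

Hypothesis cubic : forall f, #|orb f|./2 = 3.

Lemma card_cubic_orbit f : #|orb f| = 6.
Proof. by have := cubic f; rewrite rho_porbit doubleK => ->. Qed.

Lemma rho3 f : rho (rho (rho f)) = f.
Proof.
have := iter_porbit (t2 * t1)%g f; have := cubic f; rewrite rho_porbit doubleK => -> /=.
by rewrite !permM.
Qed.

Definition hexagon (f : F) (x : 'I_3 * bool) : F :=
  let g := iter x.1 rho f in if x.2 then t2 g else g.

Lemma hexagon_flip f r b : hexagon f (r, ~~ b) = t2 (hexagon f (r, b)).
Proof. by case: b; rewrite /hexagon /= ?(fpf_invol t2f). Qed.

Lemma hexagon_turn f r b :
  hexagon f (if b then (r + 1, false) else (r - 1, true)) = t1 (hexagon f (r, b)).
Proof.
have up q : hexagon f (q + 1, false) = t1 (hexagon f (q, true)).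
  by case: (I3_cases q) => ->; rewrite /hexagon //= -/(rho _) rho3.
case: b; first exact: up.
by rewrite -{2}[r](subrK 1) up (fpf_invol t1f).
Qed.

Lemma hexagon_image f : [set hexagon f x | x in [set: 'I_3 * bool]] = orb f.
Proof.
apply/eqP; rewrite eqEsubset; apply/andP; split.
  apply/subsetP => _ /imsetP[[r b] _ ->].
  have orbT2 g : (t2 g \in orb f) = (g \in orb f).
    by rewrite mem_flag_orbit // !inE eqxx orbT.
  have orbT1 g : (t1 g \in orb f) = (g \in orb f) by rewrite mem_flag_orbit // !inE eqxx.
  have it k : iter k rho f \in orb f.
    by elim: k => [|k IH]; rewrite ?orbit_refl // iterS /rho orbT1 orbT2.
  by rewrite /hexagon /=; case: b; rewrite ?orbT2 it.
apply: orbit_sub_stable; last first.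
  by apply/imsetP; exists (0, false).
move=> t g; rewrite !inE => /orP[]/eqP-> /imsetP[[r b] _ ->].
  by rewrite -hexagon_turn imset_f.
by rewrite -hexagon_flip imset_f.
Qed.

Lemma hexagon_inj f : injective (hexagon f).
Proof.
have : {in [set: 'I_3 * bool] &, injective (hexagon f)}.
  apply/imset_injP; rewrite hexagon_image card_cubic_orbit cardsT card_prod.
  by rewrite card_ord card_bool.
by move=> H x y; apply: H.
Qed.

Lemma card_vertices : (6 * #|flag_orbits [set t1; t2]|)%N = #|F|.
Proof.
rewrite mulnC -cardsT; apply/esym/card_uniform_partition.
  by move=> _ /imsetP[f _ ->]; exact: card_cubic_orbit.
apply: orbit_partition; rewrite gen_subG; apply/subsetP => t _.
by apply/astabsP => f; rewrite !inE.
Qed.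

Variable n : nat.
Hypothesis cardF : #|F| = (6 * n)%N.

(** Identifications with the flags of [n] standard cubic vertices; only the vertex structure is
    matched, [t0] being left to become the gluing. *)
Definition frames : {set {ffun 'I_n * 'I_3 * bool -> F}} :=
  [set phi : {ffun 'I_n * 'I_3 * bool -> F} | injectiveb phi &&
    [forall f, (phi (flip f) == t2 (phi f)) && (phi (turn f) == t1 (phi f))]].

Lemma framesP (phi : {ffun 'I_n * 'I_3 * bool -> F}) :
  reflect [/\ injective phi, (forall f, phi (flip f) = t2 (phi f))
            & (forall f, phi (turn f) = t1 (phi f))] (phi \in frames).
Proof.
rewrite inE; apply: (iffP andP) => [[/injectiveP inj /forallP H]|[inj H2 H1]].
  by split=> // f; have /andP[/eqP ? /eqP ?] := H f.
split; first exact/injectiveP.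
by apply/forallP => f; rewrite H1 H2 !eqxx.
Qed.

Let bases : {set {ffun 'I_n -> F}} :=
  [set be : {ffun 'I_n -> F} | injectiveb (fun v => orb (be v))].

Let frame_of (be : {ffun 'I_n -> F}) : {ffun 'I_n * 'I_3 * bool -> F} :=
  [ffun f => hexagon (be f.1.1) (f.1.2, f.2)].

Lemma hexagon_orbit f x : orb (hexagon f x) = orb f.
Proof. by apply/orbit_eqP; rewrite -hexagon_image imset_f ?inE. Qed.

Lemma frames_bases : frames = [set frame_of be | be in bases].
Proof.
apply/setP => phi; apply/framesP/imsetP => [[inj p2 p1]|[be]].
  have E v x : phi (v, x.1, x.2) = hexagon (phi (v, 0, false)) x.
    apply: (@hexagon_connected _
      (fun f => phi f = hexagon (phi (f.1.1, 0, false)) (f.1.2, f.2))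
      v (0, false) x) => [[[w r] b]|[[w r] b]|] //=.
    - by move=> H; rewrite p2 H hexagon_flip.
    - by move=> H; rewrite p1 H -hexagon_turn; case: b {H}.
  exists [ffun v => phi (v, 0, false)]; last first.
    by apply/ffunP => -[[v r] b]; rewrite !ffunE -(E v (r, b)).
  rewrite inE; apply/injectiveP => v w; rewrite !ffunE => /eqP.
  move/eqP/orbit_eqP; rewrite orbit_sym -hexagon_image => /imsetP[x _].
  by rewrite -E => /inj [].
rewrite inE => /injectiveP inj ->; split=> [[[v r] b] [[w q] c]|[[v r] b]|[[v r] b]].
- rewrite !ffunE /= => E.
  have vw : v = w by apply: inj; rewrite -(hexagon_orbit _ (r, b)) E hexagon_orbit.
  by move: E; rewrite vw => /hexagon_inj [-> ->].
- by rewrite !ffunE /= hexagon_flip.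
- by rewrite !ffunE /= -hexagon_turn /turn /=; case: b.
Qed.

(** A frame is an ordering of the vertices and a base flag, one of 6, at each. *)
Lemma card_frames : #|frames| = (n`! * 6 ^ n)%N.
Proof.
rewrite frames_bases card_imset; last first.
  move=> be be' /ffunP E; apply/ffunP => v; have := E (v, 0, false).
  by rewrite !ffunE.
pose o (be : {ffun 'I_n -> F}) : {ffun 'I_n -> {set F}} := [ffun v => orb (be v)].
pose I := [set O : {ffun 'I_n -> {set F}} in ffun_on (flag_orbits [set t1; t2])
            | injectiveb O].
rewrite -sum1_card (partition_big o (mem I)) /=; last first.
  move=> be; rewrite !inE => /injectiveP inj; apply/andP; split.
    by apply/ffun_onP => v; rewrite ffunE imset_f.
  by apply/injectiveP => v w; rewrite !ffunE => /inj.
rewrite (eq_bigr (fun=> 6 ^ n)%N) => [|O].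
  rewrite sum_nat_const card_inj_ffuns_on card_ord.
  have -> : #|flag_orbits [set t1; t2]| = n.
    by have := card_vertices; rewrite cardF; lia.
  by rewrite ffactnn.
rewrite inE => /andP[/ffun_onP OF /injectiveP inj].
transitivity #|family (fun v => mem (O v))|.
  rewrite sum1_card; apply: eq_card => be; rewrite [LHS]unfold_in /= inE.
  apply/andP/familyP => [[_ /eqP <-] v|beO].
    by rewrite ffunE; exact: orbit_refl.
  have oO : o be = O.
    apply/ffunP => v; rewrite ffunE; have /imsetP[f _ Of] := OF v.
    by rewrite Of; apply/orbit_eqP; rewrite -Of; exact: beO.
  split; last exact/eqP.
  by apply/injectiveP => v w vw; apply: inj; rewrite -oO !ffunE.
rewrite card_family foldrE big_map big_enum /= (eq_bigr (fun=> 6)).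
  by rewrite prod_nat_const card_ord.
by move=> v _; have /imsetP[f _ ->] := OF v; exact: card_cubic_orbit.
Qed.

End CubicVertices.

(** * Double count of coloured maps and frames *)

Section ColouredMaps.
Variables (N n : nat) (F : finType).
Hypothesis cardF : #|F| = (6 * n)%N.
Hypothesis n_gt0 : (0 < n)%N.
Local Notation flag := ('I_n * 'I_3 * bool)%type.
Local Notation trip := ({perm F} * {perm F} * {perm F})%type.
Local Notation colour := ({ffun F -> 'I_N.+1}).

Variable r0 : F.

(** Neither condition looks at the root, so [r0] is a placeholder; the [6 n] possible roots return
    in [sum_num_cubic_maps]. *)
Definition cubic_map (t : trip) : bool := is_rooted_map (t, r0) && is_cubic (t, r0).

Definition face_colouring (t : trip) (col : colour) : bool :=
  [forall u in [set t.1.1; t.1.2], forall f, col (u f) == col f].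

Definition coloured_maps : {set trip * colour} :=
  [set y : trip * colour | cubic_map y.1 && face_colouring y.1 y.2].

Lemma cubic_mapP t0 t1 t2 : cubic_map (t0, t1, t2) ->
  [/\ [/\ fpf_involution t0, fpf_involution t1 & fpf_involution t2],
      (forall f, t0 (t2 f) = t2 (t0 f)) /\ (forall f, t0 f != t2 f),
      (forall K : {set F}, K != set0 ->
         (forall f, f \in K -> [/\ t0 f \in K, t1 f \in K & t2 f \in K]) -> K = setT)
    & (forall f, #|orbit 'P <<[set t1; t2]>>%g f|./2 = 3)].
Proof.
case/andP=> /and5P[f0 f1 f2 f02 tr] /forall_inP cub; split=> //.
- have H f : t2 (t0 (t2 (t0 f))) = f.
    by have /fpf_involutionP/(_ f)[+ _] := f02; rewrite !permM.
  split=> f.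
    by rewrite -[in RHS](H (t0 f)) (fpf_invol f0) (fpf_invol f2).
  have /fpf_involutionP/(_ f)[_] := f02; rewrite permM.
  by apply: contra => /eqP ->; rewrite (fpf_invol f2).
- move=> K K0 KT; apply: ((transitive_stable _ _).1 tr) => //.
    by apply/card_gt0P; exists r0.
  move=> t f; rewrite !inE -orbA => tE fK; have [h0 h1 h2] := KT f fK.
  by case/or3P: tE => /eqP->.
- by move=> f; apply/eqP/cub/imset_f; rewrite inE.
Qed.

Lemma flag_cases (h f : flag) : h.1 = f.1 -> h = f \/ h = flip f.
Proof.
by case: h f => p b [q c] /= ->; rewrite /flip /=; case: b; case: c; auto.
Qed.

Section Transport.
Variables (phi : {ffun flag -> F}) (psi : F -> flag).
Hypotheses (phiK : cancel phi psi) (psiK : cancel psi phi).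

(** In a frame [t1] and [t2] are standard, and [t0] with the corner colours carries all the data.
    Corner [r] is read at [(v, r, false)], its other flag being [(v, r - 1, true)]. *)
Definition pull_back (y : trip * colour) :
    {ffun flag -> flag} * {ffun 'I_n -> {ffun 'I_3 -> 'I_N.+1}} :=
  ([ffun f => psi (y.1.1.1 (phi f))],
   [ffun v => [ffun r => y.2 (phi (v, r, false))]]).

Definition framed_maps : {set trip * colour} :=
  [set y in coloured_maps | phi \in frames y.1.1.2 y.1.2 n].

Lemma face_colouringP (t : trip) (col : colour) :
  reflect (forall f, col (t.1.1 f) = col f /\ col (t.1.2 f) = col f)
          (face_colouring t col).
Proof.
apply: (iffP forall_inP) => [H f|H u].
  split; apply/eqP.
    by apply/forallP: f; apply: H; rewrite !inE eqxx.
  by apply/forallP: f; apply: H; rewrite !inE eqxx orbT.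
by rewrite !inE => /orP[]/eqP->; apply/forallP => f; have [E1 E2] := H f; rewrite ?E1 ?E2.
Qed.

Lemma pull_back_colour y : y \in framed_maps ->
  forall f, flag_colour (pull_back y).2 f = y.2 (phi f).
Proof.
rewrite inE => /andP[+ /framesP[_ p2 p1]]; rewrite inE => /andP[_ /face_colouringP col].
case=> [[v r] b]; rewrite /flag_colour !ffunE /=; case: b => //.
rewrite -[(v, r + 1, false)]/(turn (v, r, true)) p1.
by have [_ ->] := col (phi (v, r, true)).
Qed.

Lemma pull_back_conn y : y \in framed_maps -> pull_back y \in conn_configs N setT.
Proof.
move=> yF; have col := pull_back_colour yF; move: (yF); rewrite inE => /andP[].
case: y yF col => -[[t0 t1] t2] c yF col; rewrite inE => /andP[cm fc] /framesP[_ p2 p1].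
have [[/= f0 f1 f2] [t02 t02n] conn _] := cubic_mapP cm.
rewrite inE; apply/andP; split.
  apply/configsP; split=> [v|f]; first by rewrite inE.
  rewrite inE; split; first by rewrite inE.
  - rewrite ffunE /=; set h := psi _.
    have hE : phi h = t0 (phi f) by rewrite psiK.
    apply/eqP => /flag_cases[] hf; move: hE; rewrite hf.
      by move/esym/eqP; apply/negP; exact: fpf_neq.
    by rewrite p2 => /esym/eqP; apply/negP.
  - by rewrite !ffunE /= psiK (fpf_invol f0) phiK.
  - rewrite !ffunE /= p2 /= t02; apply: (can_inj phiK).
    by rewrite p2 /= !psiK.
  - rewrite !col ffunE /= psiK.
    by have /face_colouringP/(_ (phi f))[] := fc.
apply/forallP => K; apply/implyP => /and3P[_ /set0Pn[v vK] /stableP gK].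
have KT : [set f | (psi f).1.1 \in K] = setT.
  apply: conn; first by apply/set0Pn; exists (phi (v, 0, false)); rewrite inE phiK.
  move=> f; rewrite !inE => fK; split.
  - by have := gK (psi f) fK; rewrite ffunE /= psiK.
  - by rewrite -{1}[f]psiK -p1 phiK; case: (psi f) fK => -[? ?] [].
  - by rewrite -{1}[f]psiK -p2 phiK.
apply/eqP/setP => w; rewrite inE.
by move/setP: KT => /(_ (phi (w, 0, false))); rewrite !inE phiK.
Qed.

Lemma pull_back_inj : {in framed_maps &, injective pull_back}.
Proof.
move=> y y' yF y'F E.
have col := pull_back_colour yF; have col' := pull_back_colour y'F.
case/setIdP: yF => _ /framesP[_ p2 p1]; case/setIdP: y'F => _ /framesP[_ p2' p1'].
case: y y' E col col' p2 p1 p2' p1' => -[[t0 t1] t2] c [[[t0' t1'] t2'] c'] /=.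
move=> E col col' p2 p1 p2' p1'.
congr (_, _, _, _).
- apply/permP => f; have /ffunP/(_ (psi f)) := congr1 fst E.
  by rewrite !ffunE /= psiK => /(can_inj psiK).
- by apply/permP => f; rewrite -[f]psiK -p1 p1'.
- by apply/permP => f; rewrite -[f]psiK -p2 p2'.
- apply/ffunP => f; rewrite -[f]psiK -col -col'; congr (flag_colour _ _).
  exact: (congr1 snd E).
Qed.

(** The involutions are transported by [phi] from [g], [turn] and [flip]. A stable set of flags is a
    union of hexagons, hence comes from a stable set of vertices, to which connectedness applies. *)
Lemma pull_back_onto x : x \in conn_configs N setT ->
  exists2 y, y \in framed_maps & x = pull_back y.
Proof.
case: x => g a; rewrite inE => /andP[/configsP[_ /= gl] /forallP conn].
have {}gl f : [/\ (g f).1 != f.1, g (g f) = f, g (flip f) = flip (g f)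
                & flag_colour a (g f) = flag_colour a f].
  by have := gl f; rewrite inE => -[].
have inv_inj h : involutive h -> injective (fun f => phi (h (psi f))).
  move=> hK f f' /(can_inj phiK)/(inv_inj hK)/(can_inj psiK) //.
have gK : involutive g by move=> f; case: (gl f).
pose t0 := perm (inv_inj _ gK).
pose t1 := perm (inv_inj _ (@turnK _)).
pose t2 := perm (inv_inj _ (@flipK _)).
pose c : colour := [ffun f => flag_colour a (psi f)].
have t0E f : t0 (phi f) = phi (g f) by rewrite permE phiK.
have t1E f : t1 (phi f) = phi (turn f) by rewrite permE phiK.
have t2E f : t2 (phi f) = phi (flip f) by rewrite permE phiK.
have fpf h (t : {perm F}) : involutive h -> (forall f, h f != f) ->
    (forall f, t (phi f) = phi (h f)) -> fpf_involution t.
  move=> hK hn tE; apply/fpf_involutionP => f; rewrite -[f]psiK !tE hK; split=> //.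
  by rewrite (can_eq phiK).
have flip_neq (f : flag) : flip f != f.
  by case: f => h b; rewrite xpair_eqE /= eqxx; case: b.
have turn_neq (f : flag) : turn f != f.
  by case: f => -[v r] []; rewrite /turn xpair_eqE andbF.
have g_neq f : g f != f.
  by have [gn _ _ _] := gl f; apply: contra gn => /eqP->.
have f0 := fpf g t0 gK g_neq t0E; have f1 := fpf _ t1 (@turnK _) turn_neq t1E.
have f2 := fpf _ t2 (@flipK _) flip_neq t2E.
have hexK (K : {set F}) v x y : (forall f, f \in K -> t1 f \in K /\ t2 f \in K) ->
    phi (v, x.1, x.2) \in K -> phi (v, y.1, y.2) \in K.
  move=> KT; apply: (@hexagon_connected _ (fun f => phi f \in K)) => f /KT[].
    by rewrite t2E.
  by rewrite t1E.
have inorb1 f h :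
    (t1 h \in orbit 'P <<[set t1; t2]>>%g f) = (h \in orbit 'P <<[set t1; t2]>>%g f).
  by rewrite mem_flag_orbit // !inE eqxx.
have inorb2 f h :
    (t2 h \in orbit 'P <<[set t1; t2]>>%g f) = (h \in orbit 'P <<[set t1; t2]>>%g f).
  by rewrite mem_flag_orbit // !inE eqxx orbT.
have cub f : #|orbit 'P <<[set t1; t2]>>%g f| = 6.
  rewrite -[f]psiK; case: (psi f) => -[v r] b.
  have -> : orbit 'P <<[set t1; t2]>>%g (phi (v, r, b))
      = [set phi (v, y.1, y.2) | y in [set: 'I_3 * bool]].
    apply/eqP; rewrite eqEsubset; apply/andP; split.
      apply: orbit_sub_stable; last by apply/imsetP; exists (r, b).
      move=> t h; rewrite !inE => /orP[]/eqP-> /imsetP[[q e] _ ->].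
        rewrite t1E /turn /=; apply/imsetP.
        by case: e; [exists (q + 1, false)|exists (q - 1, true)]; rewrite ?inE.
      by rewrite t2E; apply/imsetP; exists (q, ~~ e); rewrite ?inE.
    apply/subsetP => _ /imsetP[y _ ->]; apply: (hexK _ v (r, b)); last exact: orbit_refl.
    by move=> h; rewrite inorb1 inorb2.
  rewrite card_imset; first by rewrite cardsT card_prod card_ord card_bool.
  by move=> [q e] [q' e'] /(can_inj phiK) [-> ->].
have inj : injective phi := can_inj phiK.
exists (t0, t1, t2, c); last first.
  congr (_, _); apply/ffunP => f; rewrite !ffunE /=; first by rewrite t0E phiK.
  by apply/ffunP => r; rewrite !ffunE phiK.
rewrite inE; apply/andP; split; last first.
  by apply/framesP; split=> // f; rewrite ?t1E ?t2E.
rewrite inE; apply/andP; split; last first.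
  apply/face_colouringP => f; rewrite !ffunE -[f]psiK /= t0E t1E !phiK.
  have [_ _ _ ->] := gl (psi f); split=> //.
  by case: (psi f) => -[v r] []; rewrite /flag_colour /turn //= subrK.
apply/andP; split; last first.
  by apply/forall_inP => _ /imsetP[f _ ->]; rewrite /vertex_degree cub.
rewrite /is_rooted_map /mt0 /mt1 /mt2 /= f0 f1 f2 /=; apply/andP; split.
  apply/fpf_involutionP => f; rewrite -[f]psiK !permM !(t0E, t2E).
  have [gn _ _ _] := gl (psi f); have [_ _ gf _] := gl (g (psi f)).
  split; first by rewrite gf gK flipK.
  by rewrite (can_eq phiK); apply: contra gn => /eqP/(congr1 fst) /= ->.
apply/transitive_stable; first by apply/card_gt0P; exists r0.
move=> K /set0Pn[f fK] KT.
have KT0 h : h \in K -> t0 h \in K by apply: KT; rewrite !inE eqxx.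
have KT12 h : h \in K -> t1 h \in K /\ t2 h \in K.
  by move=> hK; split; apply: KT; rewrite // !inE eqxx ?orbT.
have base (h : flag) : (phi h \in K) = (phi (h.1.1, 0, false) \in K).
  case: h => -[v r] b; apply/idP/idP; first exact: (hexK K v (r, b) (0, false)).
  exact: (hexK K v (0, false) (r, b)).
have /implyP := conn [set v | phi (v, 0, false) \in K].
have -> : [&& [set v | phi (v, 0, false) \in K] \subset [set: 'I_n],
  [set v | phi (v, 0, false) \in K] != set0
  & stable g [set v | phi (v, 0, false) \in K]].
  rewrite subsetT /=; apply/andP; split.
    by apply/set0Pn; exists (psi f).1.1; rewrite inE -base psiK.
  by apply/stableP => h; rewrite !inE -!base => /KT0; rewrite t0E.
move=> /(_ isT)/eqP/setP all; apply/setP => h.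
rewrite inE -[h]psiK base.
by have := all (psi h).1.1; rewrite !inE.
Qed.

End Transport.

Lemma card_framed_maps (phi : {ffun flag -> F}) :
  injective phi -> #|framed_maps phi| = num_connected N n.
Proof.
move=> inj; have [psi phiK psiK] : bijective phi.
  by apply: inj_card_bij => //; rewrite cardF !card_prod !card_ord card_bool; lia.
rewrite -(card_in_imset (pull_back_inj psiK)); apply: eq_card => x.
apply/imsetP/idP => [[y yF ->]|/(pull_back_onto phiK psiK) [y yF ->]].
  exact: pull_back_conn.
by exists y.
Qed.

(** Pairs of a coloured map and a frame [phi]: a map has [card_frames] frames, and each bijection
    [phi] frames as many coloured maps as there are connected configurations. *)
Lemma card_coloured_maps :
  (#|coloured_maps| * (n`! * 6 ^ n) = (6 * n)`! * num_connected N n)%N.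
Proof.
have fr (y : trip * colour) : y \in coloured_maps ->
    #|frames y.1.1.2 y.1.2 n| = (n`! * 6 ^ n)%N.
  case: y => -[[t0 t1] t2] c; rewrite inE => /andP[/cubic_mapP[[_ f1 f2] _ _ cub] _].
  exact: card_frames.
rewrite -sum_nat_const -(eq_bigr _ fr).
transitivity (\sum_(phi : {ffun flag -> F} | injectiveb phi) #|framed_maps phi|)%N.
  under eq_bigr => y _ do rewrite -sum1_card.
  rewrite (exchange_big_dep (fun phi : {ffun flag -> F} => injectiveb phi)) /=.
    apply: eq_bigr => phi inj; rewrite -sum1_card; apply: eq_bigl => y.
    by rewrite !inE.
  by move=> y phi _; rewrite inE => /andP[].
rewrite (eq_bigr (fun=> num_connected N n)); last first.
  by move=> phi /injectiveP; exact: card_framed_maps.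
rewrite sum_nat_const; congr (_ * _)%N.
transitivity #|[set phi : {ffun flag -> F} | injectiveb phi]|.
  by apply: eq_card => phi; rewrite inE.
rewrite card_inj_ffuns cardF !card_prod !card_ord card_bool.
by rewrite (_ : (n * 3 * 2 = 6 * n)%N) ?ffactnn //; lia.
Qed.

Lemma card_coloured_maps_faces :
  #|coloured_maps| = (\sum_(t | cubic_map t) N.+1 ^ #|mfaces (t, r0)|)%N.
Proof.
rewrite -sum1_card (partition_big fst cubic_map) /=; last first.
  by move=> y; rewrite inE => /andP[].
apply: eq_bigr => t ct; rewrite sum1_card.
transitivity #|[set c : colour | face_colouring t c]|; last first.
  exact: etrans (card_invariant_colours ord0 _) (congr1 (expn^~ _) (card_ord _)).
have inj : injective (fun c : colour => (t, c)) by move=> c c' [].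
rewrite -[RHS](card_imset _ inj); apply: eq_card => -[t' c].
rewrite [LHS]unfold_in /= !inE /=; apply/andP/imsetP => [[/andP[_ fc] /eqP tt]|[c']].
  by rewrite tt in fc *; exists c; rewrite // inE.
by rewrite inE => fc [-> ->]; rewrite ct eqxx.
Qed.

Lemma card_mfaces_gt0 M : (0 < #|@mfaces F M|)%N.
Proof.
by apply/card_gt0P; exists (orbit 'P <<[set mt0 M; mt1 M]>>%g r0); exact: imset_f.
Qed.

Lemma card_mfaces_le M : (#|@mfaces F M| <= 6 * n)%N.
Proof. by rewrite -cardF -cardsT; exact: leq_imset_card. Qed.

End ColouredMaps.

Lemma sum_num_cubic_maps N n : (0 < n)%N ->
  (n`! * 6 ^ n * \sum_(1 <= k < (6 * n).+1) num_cubic_maps n k * N.+1 ^ k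
   = 6 * n * num_connected N n)%N.
Proof.
move=> n0; have n60 : (0 < 6 * n)%N by rewrite muln_gt0.
pose r0 : 'I_(6 * n) := Ordinal n60; have cF := card_ord (6 * n).
have f0 : (0 < (6 * n)`!)%N := fact_gt0 _.
apply/eqP; rewrite -(eqn_pmul2l f0); apply/eqP.
rewrite [RHS]mulnCA -(card_coloured_maps N cF n0 r0) [LHS]mulnCA.
rewrite [RHS]mulnA [RHS]mulnC; congr (_ * _)%N.
transitivity (\sum_(1 <= k < (6 * n).+1) #|cubic_rooted_maps n k| * N.+1 ^ k)%N.
  rewrite big_distrr /=; apply: eq_bigr => k _.
  by rewrite card_cubic_rooted_maps mulnCA !mulnA [(_ * (6 * n)`!)%N]mulnC.
pose cub (M : {perm 'I_(6 * n)} * {perm 'I_(6 * n)} * {perm 'I_(6 * n)} * 'I_(6 * n)) :=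
  is_rooted_map M && is_cubic M.
have nv M : cub M -> #|mvertices M| = n.
  case: M => -[[t0 t1] t2] r cM.
  have /cubic_mapP[[_ f1 f2] _ _ cu] : cubic_map r (t0, t1, t2) by exact: cM.
  have := card_vertices f1 f2 cu; rewrite cF => /eqP; rewrite eqn_pmul2l // => /eqP.
  by [].
transitivity (\sum_(M | cub M) N.+1 ^ #|mfaces M|)%N.
  transitivity (\sum_(1 <= k < (6 * n).+1)
    \sum_(M | cub M && (#|mfaces M| == k)) N.+1 ^ #|mfaces M|)%N.
    apply: eq_bigr => k _; rewrite (eq_bigr (fun=> N.+1 ^ k)%N); last first.
      by move=> M /andP[_ /eqP->].
    rewrite sum_nat_const; congr (_ * _)%N; apply: eq_card => M.
    rewrite inE [RHS]unfold_in /= andbA -/(cub M); apply: andb_id2l => cM.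
    by rewrite nv // eqxx.
  under eq_bigr => k _ do rewrite big_mkcondr /=.
  rewrite exchange_big /=; apply: eq_bigr => M cM.
  rewrite (bigD1_seq #|mfaces M|) /=.
  - by rewrite eqxx big1 ?addn0 // => k /negbTE; rewrite eq_sym => ->.
  - by rewrite mem_index_iota (card_mfaces_gt0 r0) ltnS (card_mfaces_le cF).
  - exact: iota_uniq.
rewrite (card_coloured_maps_faces N r0).
transitivity (\sum_(t | cubic_map r0 t) \sum_(r : 'I_(6 * n)) N.+1 ^ #|mfaces (t, r)|)%N.
  by rewrite pair_big /=; apply: eq_big => [[t r]|[t r] _] //=; rewrite andbT.
rewrite big_distrr /=; apply: eq_bigr => t _.
rewrite (eq_bigr (fun=> N.+1 ^ #|mfaces (t, r0)|)%N) //.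
by rewrite big_const card_ord iter_addn_0 mulnC.
Qed.

(** [t0] and [t2] generate a group acting freely with orbits of size 4, the
  edges, so that 4 divides the number [6 n] of flags. *)
Lemma num_cubic_maps_odd n k : odd n -> num_cubic_maps n k = 0%N.
Proof.
move=> on; apply/eqP; rewrite -(eqn_pmul2r (fact_gt0 (6 * n))) mul0n.
rewrite -card_cubic_rooted_maps cards_eq0; apply/set0Pn => -[[[[t0 t1] t2] r]].
rewrite inE => /and4P[rM cM _ _].
have /cubic_mapP[[f0 _ f2] [t02 t02n] _ _] : cubic_map r (t0, t1, t2) by apply/andP.
have po f : #|porbit (t2 * t0)%g f| = 2.
  have -> : porbit (t2 * t0)%g f = [set f; t0 (t2 f)]; last first.
    rewrite cards2 eq_sym (_ : _ != _) //.
    apply: contra (t02n (t2 f)) => /eqP ->; rewrite (fpf_invol f2) //.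
  apply/setP => g; rewrite !inE; apply/porbitP/orP => [[i ->]|[]/eqP ->].
  - rewrite permX; elim: i => [|i]; first by left.
    case=> /eqP /= ->; rewrite permM; first by right.
    by left; rewrite -t02 (fpf_invol f2) (fpf_invol f0).
  - by exists 0%N; rewrite perm1.
  - by exists 1%N; rewrite expg1 permM.
have : #|[set: 'I_(6 * n)]| = (#|flag_orbits [set t0; t2]| * 4)%N.
  apply: card_uniform_partition.
    (* [rho_porbit] with [t0] in place of [t1], so that its orbits are the edges. *)
    by move=> _ /imsetP[f _ ->]; rewrite (rho_porbit f0 f2) po.
  apply: orbit_partition; rewrite gen_subG; apply/subsetP => t _.
  by apply/astabsP => f; rewrite !inE.
by rewrite cardsT card_ord; move: on; lia.
Qed.

From mathcomp Require Import boolp classical_sets functions fsbigop.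

(** * Laurent series *)

Section LaurentTheory.
Variable K : fieldType.
Implicit Types p q : laurent K.

Lemma conv_sum (f g : int -> K^o) (M N k : nat) :
    (forall n, n < - M%:Z -> f n = 0) -> (forall n, n < - N%:Z -> g n = 0) ->
  conv f g (k%:Z - (M + N)%N%:Z) =
  \sum_(i < k.+1) f (i%:Z - M%:Z) * g ((k - i)%N%:Z - N%:Z).
Proof.
move=> Mf Ng; rewrite (conv_window Mf Ng (ltnSn k)) coefM.
apply: eq_bigr => i _; have ik : (i <= k)%N by rewrite -ltnS.
by rewrite !coef_poly ltnS ik ltnS leq_subr.
Qed.

Lemma eulerM p q : euler (p * q) = euler p * q + p * euler q.
Proof.
apply: laurentP => n; rewrite lcoefD.
have [M Mp] := laurent_bounded p; have [N Nq] := laurent_bounded q.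
have Mp' m : m < - M%:Z -> euler p m = 0 by move=> /Mp; rewrite /= => ->; exact: mulr0.
have Nq' m : m < - N%:Z -> euler q m = 0 by move=> /Nq; rewrite /= => ->; exact: mulr0.
case: (ltP n (- (M + N)%N%:Z)) => [lt_n | le_n].
  rewrite /= (conv_lt Mp Nq lt_n) (conv_lt Mp' Nq lt_n) (conv_lt Mp Nq' lt_n).
  by rewrite mulr0 addr0.
have n0 : 0 <= n + (M + N)%N%:Z by rewrite -lerBlDr sub0r.
rewrite -[n](addrK (M + N)%N%:Z) -(gez0_abs n0); set k := absz _.
rewrite [euler (p * q) _]/= (conv_sum k Mp Nq).
rewrite [(euler p * q) _](conv_sum k Mp' Nq) [(p * euler q) _](conv_sum k Mp Nq').
rewrite mulr_sumr -big_split /=; apply: eq_bigr => i _.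
have -> : k%:Z - (M + N)%N%:Z = (i%:Z - M%:Z) + ((k - i)%N%:Z - N%:Z).
  by have := ltn_ord i; lia.
by rewrite intrD mulrDl mulrA mulrCA.
Qed.

Lemma eulerD p q : euler (p + q) = euler p + euler q.
Proof. by apply: laurentP => n; rewrite /= mulrDr. Qed.

Lemma eulerB p q : euler (p - q) = euler p - euler q.
Proof. by apply: laurentP => n; rewrite /= mulrBr. Qed.

Lemma eulerZ c p : euler (c *: p) = c *: euler p.
Proof. by apply: laurentP => n; rewrite /= mulrCA. Qed.

Lemma coef_lXM m p n : (lX K m * p) n = p (n - m).
Proof.
rewrite [LHS]/= /conv -(fsbig_widen [set m]%classic) //; last first.
  by move=> i [_ /= /eqP im]; rewrite /monomial_fun (negbTE im) mul0r.
by rewrite fsbig_set1 /monomial_fun eqxx mul1r.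
Qed.

Lemma coef_lX m n : lX K m n = (n == m)%:R.
Proof. by []. Qed.

Lemma euler_lX m : euler (lX K m) = m%:~R *: lX K m.
Proof.
apply: laurentP => n; rewrite lcoefZ /= /monomial_fun.
by case: eqP => [->//|_]; rewrite !mulr0.
Qed.

Lemma lX0 : lX K 0 = 1.
Proof. by []. Qed.

Lemma lX_exp m k : lX K m ^+ k = lX K (m *+ k).
Proof. by elim: k => [|k IH]; rewrite ?mulr0n // exprS IH -lXD mulrS. Qed.

Lemma coef_scale1 c n : (c%:A : laurent K) n = c * (n == 0)%:R.
Proof. by []. Qed.

Lemma power_seriesM (a b : nat -> K) :
  power_series a * power_series b =
  power_series (fun n => \sum_(i < n.+1) a i * b (n - i)%N).
Proof.
have ps0 (c : nat -> K) m : m < - 0%:Z -> power_series c m = 0 by case: m.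
apply: laurentP => -[n|n]; last by rewrite /= (conv_lt (ps0 a) (ps0 b)).
transitivity (conv (power_series a) (power_series b) (n%:Z - (0 + 0)%N%:Z)).
  by congr (conv _ _ _); lia.
rewrite (conv_sum n (ps0 a) (ps0 b)) /=; apply: eq_bigr => i _.
by rewrite !addn0.
Qed.

Lemma power_seriesD (a b : nat -> K) :
  power_series a + power_series b = power_series (fun n => a n + b n).
Proof. by apply: laurentP => -[n|n] //=; exact: addr0. Qed.

Lemma power_seriesZ c (a : nat -> K) :
  c *: power_series a = power_series (fun n => c * a n).
Proof. by apply: laurentP => -[n|n] //=; exact: mulr0. Qed.

Lemma power_seriesN (a : nat -> K) :
  - power_series a = power_series (fun n => - a n).
Proof.
rewrite -scaleN1r power_seriesZ; congr power_series.
by apply/funext => n; rewrite mulN1r.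
Qed.

Lemma euler_power_series (a : nat -> K) :
  euler (power_series a) = power_series (fun n => n%:R * a n).
Proof. by apply: laurentP => -[n|n] //=; exact: mulr0. Qed.

(** Serves to cancel the square of [Z_N]; the product is triangular in the coefficients of [b]. *)
Lemma power_series_reg (a b : nat -> K) : a 0%N != 0 ->
  power_series a * power_series b = 0 -> power_series b = 0.
Proof.
move=> a0 /(congr1 (fun p : laurent K => lcoef p)); rewrite power_seriesM => ab.
suff b0 n : b n = 0 by apply: laurentP => -[n|n] //=; exact: b0.
have [k] := ubnP n; elim: k n => // k IH n nk.
have /= := congr1 (fun f => f (Posz n)) ab; rewrite big_ord_recl subn0 big1.
  by rewrite addr0 => /eqP; rewrite mulf_eq0 (negbTE a0) => /eqP.
by move=> i _; rewrite IH ?mulr0 //; rewrite /= /bump; have := ltn_ord i; lia.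
Qed.

Lemma lmulZl c p : c *: p = c%:A * p.
Proof. by rewrite -scalerAl mul1r. Qed.

Lemma lscaleAr c p q : c *: (p * q) = p * (c *: q).
Proof. by rewrite mulrC scalerAl mulrC. Qed.

End LaurentTheory.

(** * The bilinear equation *)

Local Notation QL := (laurent rat).

Lemma laurent_two_reg (p : QL) : p = - p -> p = 0.
Proof.
move=> pN; apply: laurentP => n; apply: rat_two_reg.
by rewrite {1}pN lcoefN.
Qed.

Lemma natr_scale (K : fieldType) (k : nat) (p : laurent K) : k%:R * p = k%:R *: p.
Proof. by rewrite mulr_natl scaler_nat. Qed.

Section Deformation.
Implicit Types (F : seq nat -> rat) (G : seq nat -> QL) (l : seq nat).

Definition cubic_coef (j : nat) : rat := (6 ^+ j * j`!%:R)^-1.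

Lemma cubic_coefS j : 6 * j.+1%:R * cubic_coef j.+1 = cubic_coef j.
Proof.
rewrite /cubic_coef factS natrM exprS; set a := 6 ^+ j; set b := (j`!)%:R.
have a0 : a != 0 by rewrite expf_neq0.
have b0 : b != 0 by rewrite pnatr_eq0 -lt0n fact_gt0.
have j0 : (j.+1%:R : rat) != 0 by rewrite pnatr_eq0.
by move: (j.+1%:R : rat) j0 => c c0; field; rewrite a0 b0 c0.
Qed.

(** Insertion of the weight [exp (x p_3 / 6)]. *)
Definition deform F l : QL :=
  power_series (fun j => cubic_coef j * iter j (psum 3) F l).

Lemma coef_psum k G l n : psum k G l n = psum k (fun r => G r n) l.
Proof. by elim: l G => [|a l IH] G //; rewrite !psum_cons lcoefD IH. Qed.

Lemma iter_psumC j k F : iter j (psum 3) (psum k F) =1 psum k (iter j (psum 3) F).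
Proof.
elim: j => //= j IH l; rewrite (eq_psum _ IH) psumC //.
Qed.

Lemma deform_psum k F l : psum k (deform F) l = deform (psum k F) l.
Proof.
apply: laurentP => -[j|j]; rewrite coef_psum /=.
  by rewrite iter_psumC -psumZ.
exact: slot0.
Qed.

Lemma euler_deform F l : 6 * euler (deform F l) = lX rat 1 * psum 3 (deform F) l.
Proof.
rewrite deform_psum; apply: laurentP => n; rewrite coef_lXM.
rewrite natr_scale lcoefZ; case: n => [[|j]|n] /=.
- by rewrite mul0r mulr0.
- by rewrite subn1 -(cubic_coefS j) -iterS iterSr -!mulrA.
- by rewrite !mulr0.
Qed.

Lemma low_iter_psum k j F l :
  low k (iter j (psum 3) F) l =
  iter j (psum 3) (low k F) l - (3 * j)%:R * psum k.+2 (iter j.-1 (psum 3) F) l.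
Proof.
elim: j l => [|j IH] l; first by rewrite muln0 mul0r subr0.
rewrite iterS low_psum addnS addnS addn1 /=.
rewrite (_ : psum 3 (low k _) l = psum 3 (fun r => iter j (psum 3) (low k F) r
   + - (3 * j)%:R * psum k.+2 (iter j.-1 (psum 3) F) r) l); last first.
  by apply: eq_psum => r; rewrite IH mulNr.
rewrite psumD psumZ psumC.
case: j {IH} => [|j] /=; first by rewrite muln0 muln1; ring.
rewrite mulnS natrD; ring.
Qed.

Lemma coef_low k G l n : low k G l n = low k (fun r => G r n) l.
Proof.
elim: l G => [|a l IH] G //; rewrite !low_cons lcoefD IH; congr (_ + _).
by rewrite natr_scale lcoefZ.
Qed.

Lemma lowZ (R : comNzRingType) k c (F : seq nat -> R) l :
  low k (fun r => c * F r) l = c * low k F l.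
Proof. exact: slotZ. Qed.

(** Commuting the derivation past [exp (x p_3 / 6)] brings out [(x / 6) 3 p_(k+2)], doubled here. *)
Lemma low_deform k F : (forall l, 2 * low k F l = psum k.+1 F l) ->
  forall l, 2 * low k (deform F) l =
    psum k.+1 (deform F) l - lX rat 1 * psum k.+2 (deform F) l.
Proof.
move=> lowF l; rewrite !deform_psum; apply: laurentP => n.
rewrite lcoefD lcoefN coef_lXM.
rewrite (mulrDl 1 1) mul1r lcoefD !coef_low; case: n => [j|j]; last first.
  by rewrite /= /low !slot0 !addr0.
rewrite /= lowZ low_iter_psum.
have E : 2 * iter j (psum 3) (low k F) l = iter j (psum 3) (psum k.+1 F) l.
  have H : psum k.+1 F =1 fun l => 2 * low k F l by move=> r; rewrite lowF.
  elim: j l => [|j IH] l /=; first by rewrite lowF.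
  by rewrite -psumZ; apply: eq_psum.
rewrite -E; case: j {E} => [|j] /=; first by rewrite muln0; ring.
rewrite subn1 /= iter_psumC -(cubic_coefS j) natrM; ring.
Qed.

Definition has_constant (p : QL) (v : rat) :=
  (forall n, n < 0 -> p n = 0) /\ p 0 = v.

Lemma has_constant0 : has_constant 0 0. Proof. by []. Qed.

Lemma has_constant1 : has_constant 1 1.
Proof. by split=> // -[n|n]. Qed.

Lemma has_constantB p q u v :
  has_constant p u -> has_constant q v -> has_constant (p - q) (u - v).
Proof.
move=> [p0 <-] [q0 <-]; split=> // n n0.
by rewrite lcoefD lcoefN p0 // q0 // subr0.
Qed.

Lemma has_constant_power_series (a : nat -> rat) : has_constant (power_series a) (a 0%N).
Proof. by split=> // -[]. Qed.

Lemma has_constantE p u : has_constant p u -> p = power_series (fun n => p n).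
Proof. by case=> p0 _; apply: laurentP => -[n|n] //=; apply: p0. Qed.

Lemma has_constantM p q u v :
  has_constant p u -> has_constant q v -> has_constant (p * q) (u * v).
Proof.
move=> Hp Hq; have [_ <-] := Hp; have [_ <-] := Hq.
rewrite {1}(has_constantE Hp) {1}(has_constantE Hq) power_seriesM.
by have := has_constant_power_series
  (fun n => \sum_(i < n.+1) p i * q (n - i)%N); rewrite big_ord1.
Qed.

Lemma has_constant_ssum (f : nat -> seq nat -> QL) g l :
  (forall c r, has_constant (f c r) (g c r)) -> has_constant (ssum f l) (ssum g l).
Proof.
elim: l f g => [|b l IH] f g fg; first exact: has_constant0.
by apply: has_constantB => //; apply: IH => c r; exact: fg.
Qed.

(** As [pf sgn_moment 1 [:: a; b]] is [sgn_moment a b], this is the skew moment for the weight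
    including the cubic term. *)
Definition deformed_moment a b := deform (pf sgn_moment 1) [:: a; b].

Lemma deformed_moment_skew a b : deformed_moment a b = - deformed_moment b a.
Proof.
rewrite /deformed_moment /deform power_seriesN; congr power_series.
apply/funext => j; rewrite -mulrN; congr (_ * _).
have alt : alternating (iter j (psum 3) (pf sgn_moment 1)).
  elim: j => [|j IH]; last exact: psum_alternating.
  exact/pf_alternating/sgn_moment_skew.
exact: (alt [::]).
Qed.

Lemma pf_constant n l : has_constant (pf deformed_moment n l) (pf sgn_moment n l).
Proof.
elim: n l => [|n IH] [|a l]; first exact: has_constant1.
- exact: has_constant0.
- exact: has_constant0.
apply: has_constant_ssum => b r; apply: has_constantM (IH r).
have := has_constant_power_series
  (fun j => cubic_coef j * iter j (psum 3) (pf sgn_moment 1) [:: a; b]).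
by rewrite /cubic_coef fact0 mulr1 invr1 mul1r /= mulr1 subr0.
Qed.

Definition cubic_op (a : nat) : seq (QL * nat) :=
  [:: (6^-1 *: lX rat 1, (a + 3)%N)].

Lemma slot_cubic_op G l : slot cubic_op G l = 6^-1 *: lX rat 1 * psum 3 G l.
Proof.
elim: l G => [|a l IH] G /=; first by rewrite mulr0.
by rewrite psum_cons IH /cubic_op big_seq1 mulrDr.
Qed.

(** Both sides have the same constant term and satisfy [6 x F' = x p_3 F], which yields the
    coefficients one by one. The left form obeys the Pluecker relations, the right one the loop
    equations. *)
Lemma pf_deformed n l : pf deformed_moment n l = deform (pf sgn_moment n) l.
Proof.
have E r : euler (pf deformed_moment n r) =
           6^-1 *: lX rat 1 * psum 3 (pf deformed_moment n) r.
  rewrite -slot_cubic_op; apply: pf_derivation; first exact: eulerB.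
    exact: eulerM.
  move=> a b; rewrite /cubic_op !big_seq1 /= -mulrDr.
  have := euler_deform (pf sgn_moment 1) [:: a; b].
  rewrite !psum_cons /= addr0 => H.
  have -> : euler (deformed_moment a b) = 6^-1 *: (6 * euler (deformed_moment a b)).
    by rewrite natr_scale scalerA mulVf ?scale1r.
  by rewrite H scalerAl.
rewrite (has_constantE (pf_constant n l)); congr power_series; apply/funext => j.
elim: j l => [|j IH] l.
  by rewrite /cubic_coef fact0 mulr1 invr1 mul1r /=; case: (pf_constant n l).
have := congr1 (fun p : QL => 6 * p j.+1) (E l).
rewrite -scalerAl lcoefZ coef_lXM coef_psum mulVKf //.
rewrite (_ : j.+1%:Z - 1 = j); last by lia.
rewrite (eq_psum _ IH) psumZ [euler _ _]/= mulrA => H.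
have c0 : 6 * j.+1%:R != 0 :> rat by rewrite mulf_neq0 // pnatr_eq0.
by apply: (mulfI c0); rewrite H mulrA cubic_coefS.
Qed.

End Deformation.

Section Derivation3.
Variable K : fieldType.
Implicit Types p q : laurent K.

Definition D3 p : laurent K := 3 * euler p.

Lemma D3D p q : D3 (p + q) = D3 p + D3 q.
Proof. by rewrite /D3 eulerD mulrDr. Qed.

Lemma D3B p q : D3 (p - q) = D3 p - D3 q.
Proof. by rewrite /D3 eulerB mulrBr. Qed.

Lemma D3M p q : D3 (p * q) = D3 p * q + p * D3 q.
Proof. by rewrite /D3 eulerM; ring. Qed.

Lemma D3_1 : D3 1 = 0.
Proof. by rewrite /D3 -lX0 euler_lX scale0r mulr0. Qed.

Lemma D3_nat k : D3 k%:R = 0.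
Proof.
elim: k => [|k IH]; last by rewrite -natr1 D3D IH D3_1 addr0.
by have := D3B 0 0; rewrite !subrr.
Qed.

Lemma D3Z c p : D3 (c *: p) = c *: D3 p.
Proof. by rewrite /D3 eulerZ lscaleAr. Qed.

Lemma D3_lX m : D3 (lX K m) = (3 * m%:~R) *: lX K m.
Proof. by rewrite /D3 euler_lX natr_scale scalerA. Qed.

Lemma D3_X : D3 (lX K 1) = 3 * lX K 1.
Proof. by rewrite /D3 euler_lX scale1r. Qed.

(** Twice the second factor of the right-hand side of the theorem, for
  [T = L + y^2 + y - y / (2 x^2)], expanded so that it only involves power
  series; [y = 1 / w] is the size of the matrices. *)
Definition hirota_rhs (y L : laurent K) : laurent K :=
  let x := lX K 1 in
  let t := L + y ^+ 2 + y in
  let u := D3 t + 4 * t in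
  4 * x ^+ 4 * (D3 (D3 u) + 20 * D3 u + 96 * u) + 48 * y * x ^+ 2
  - (D3 t + 6 * t) + 12 * x ^+ 4 * u ^+ 2 + 24 * y * x ^+ 2 * u + 12 * y ^+ 2.

End Derivation3.

(** * From the Pluecker relation to a differential polynomial *)

Section Hirota.

Definition tau_moment n mu : QL :=
  psums mu (deform (pf sgn_moment n)) (iota 0 n.*2).

Local Notation x := (lX rat 1).

Lemma deform_psums mu F l : psums mu (deform F) l = deform (psums mu F) l.
Proof.
by elim: mu l => //= k mu IH l; rewrite (eq_psum _ IH) deform_psum.
Qed.

Lemma deform_alternating n : alternating (deform (pf sgn_moment n)).
Proof.
move=> l1 a b l2; rewrite -!pf_deformed.
exact/pf_alternating/deformed_moment_skew.
Qed.

Lemma tau_moment3 n mu : x * tau_moment n (3%N :: mu) = 2 * D3 (tau_moment n mu).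
Proof.
rewrite /tau_moment [psums (_ :: _) _]/= (eq_psum _ (deform_psums _ _)).
rewrite -euler_deform deform_psums /D3; ring.
Qed.

Lemma tau_moment_low k n mu :
  2 * (low k (psums mu (deform (pf sgn_moment n))) (iota 0 n.*2)
       + dsum (fun c r => c%:R * tau_moment n ((k + c).-1 :: r)) mu) =
  tau_moment n (k.+1 :: mu) - x * tau_moment n (k.+2 :: mu).
Proof.
rewrite low_psums -psumsZ.
rewrite (eq_psums _ (low_deform (low_pf k n))).
rewrite (@eq_psums _ _ _ (fun l => psum k.+1 (deform (pf sgn_moment n)) l
  + - x * psum k.+2 (deform (pf sgn_moment n)) l)); last by move=> l; rewrite mulNr.
have psumsD (F G : seq nat -> QL) l :
    psums mu (fun l => F l + G l) l = psums mu F l + psums mu G l.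
  by elim: mu l => //= j mu IH l; rewrite (eq_psum _ IH) psumD.
by rewrite psumsD psumsZ !psums_psum mulNr.
Qed.

(** The loop equation of index 0, [tau_moment2] being that of index 1. With [tau_moment3] they lead
    from [p_1] to [p_2], to [p_3] and to a derivative in [x]. *)
Lemma tau_moment1 n mu :
  tau_moment n (1%N :: mu) = x * tau_moment n (2%N :: mu)
    + 2 * dsum (fun c r => c%:R * tau_moment n (c.-1 :: r)) mu.
Proof.
have := tau_moment_low 0 n mu; rewrite (low0_staircase laurent_two_reg) ?add0r.
  move=> E; transitivity (tau_moment n (1%N :: mu) - x * tau_moment n (2%N :: mu)
                          + x * tau_moment n (2%N :: mu)); first by rewrite subrK.
  by rewrite -E addrC.
exact/psums_alternating/deform_alternating.
Qed.

Lemma tau_moment2 n mu :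
  tau_moment n (2%N :: mu) = x * tau_moment n (3%N :: mu)
    + (n.*2%:R ^+ 2 + n.*2%:R) * tau_moment n mu
    + 2 * dsum (fun c r => c%:R * tau_moment n (c :: r)) mu.
Proof.
have := tau_moment_low 1 n mu; rewrite mulrDr (lowS_staircase laurent_two_reg); last first.
  exact/psums_alternating/deform_alternating.
rewrite big_ord1 !psum0 size_iota -/(tau_moment n mu) => E.
transitivity (tau_moment n (2%N :: mu) - x * tau_moment n (3%N :: mu)
              + x * tau_moment n (3%N :: mu)); first by rewrite subrK.
rewrite -E; ring.
Qed.

(** [pf_plucker] for a staircase and the next four exponents. In Schur functions the right-hand side
    is 12 times [s_0 s_22 - s_1 s_21 + s_2 s_11]; the factor 12 clears the multiples in
    [schur_power_sums]. *)
Lemma tau_plucker k (b := tau_moment k.+2) :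
  12 * (tau_moment k.+1 [::] * tau_moment k.+3 [::]) =
    b [::] * (b [:: 1; 1; 1; 1]%N + 3 * b [:: 2; 2]%N - 4 * b [:: 3; 1]%N)
    - 4 * b [:: 1%N] * (b [:: 1; 1; 1]%N - b [:: 3%N])
    + 3 * (b [:: 1; 1]%N + b [:: 2%N]) * (b [:: 1; 1]%N - b [:: 2%N]).
Proof.
have alt := deform_alternating k.+2.
have [p1 p2 p11 p111 p1111] := schur_power_sums laurent_two_reg k.*2 alt.
have iota2 : iota 0 k.+1.*2 = iota 0 k.*2 ++ [:: k.*2 + 0; k.*2 + 1]%N.
  by rewrite (_ : k.+1.*2 = k.*2 + 2)%N ?iotaD /= ?addn0 ?addn1 //; lia.
have iota4 : iota 0 k.+2.*2 =
    iota 0 k.*2 ++ [:: k.*2 + 0; k.*2 + 1; k.*2 + 2; k.*2 + 3]%N.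
  rewrite (_ : k.+2.*2 = k.*2 + 4)%N ?iotaD /=; last by lia.
  by congr (_ ++ _); congr [:: _; _; _; _]; lia.
have iota6 : iota 0 k.+3.*2 =
    iota 0 k.+1.*2 ++ [:: k.*2 + 2; k.*2 + 3; k.*2 + 4; k.*2 + 5]%N.
  rewrite (_ : k.+3.*2 = k.+1.*2 + 4)%N; last by lia.
  rewrite iotaD; congr (_ ++ _); rewrite /= add0n doubleS.
  by congr [:: _; _; _; _]; lia.
have bE mu : b mu = tail4 k.*2 (psums mu (deform (pf sgn_moment k.+2))) 0 1 2 3.
  by rewrite /b /tau_moment iota4.
rewrite -!bE in p1 p2 p11 p111 p1111.
have tau0 n : tau_moment n [::] = pf deformed_moment n (iota 0 n.*2).
  by rewrite pf_deformed.
have tE c d e f : tail4 k.*2 (deform (pf sgn_moment k.+2)) c d e f =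
    pf deformed_moment k.+2
      (iota 0 k.*2 ++ [:: k.*2 + c; k.*2 + d; k.*2 + e; k.*2 + f]%N).
  by rewrite pf_deformed.
have b0 : b [::] = tail4 k.*2 (deform (pf sgn_moment k.+2)) 0 1 2 3 by exact: bE.
rewrite p1 p2 p11 p111 p1111 b0 !tau0 iota6.
have ev : ~~ odd (size (iota 0 k.+1.*2)) by rewrite size_iota odd_double.
rewrite (pf_plucker deformed_moment_skew laurent_two_reg k.+1 _ _ _ _ ev).
rewrite iota2 -!catA !cat_cons !cat0s -!tE; ring.
Qed.

Lemma lX1_inj : injective (fun p : QL => x * p).
Proof.
move=> p q /(congr1 ( *%R (lX rat (-1)))).
by rewrite !mulrA -lXD lX0 !mul1r.
Qed.

Lemma mulr2_inj : injective (fun p : QL => 2 * p).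
Proof. by move=> p q; rewrite !natr_scale; exact: scalerI. Qed.

Lemma hirota_bilinear k (L : QL) :
    2 * D3 (tau_moment k.+2 [::]) = L * tau_moment k.+2 [::] ->
  6 * (tau_moment k.+1 [::] * tau_moment k.+3 [::])
    = tau_moment k.+2 [::] ^+ 2 * hirota_rhs k.+2.*2%:R L.
Proof.
(* The loop equations express every moment in [tau_plucker] by derivatives of
  [Z = tau_moment k.+2 [::]]; the factor [2 x] avoids denominators. *)
move=> DZ; apply: lX1_inj; apply: mulr2_inj.
have p3 := tau_moment3 k.+2; have p2 := tau_moment2 k.+2.
have p1 := tau_moment1 k.+2; have pl := tau_plucker k; cbv zeta in pl.
have p0 mu : tau_moment k.+2 (0%N :: mu) = k.+2.*2%:R * tau_moment k.+2 mu.
  by rewrite /tau_moment [psums (_ :: _) _]/= psum0 size_iota.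
have Dy := D3_nat rat k.+2.*2; have DX := D3_X rat.
have Dn := D3_nat rat.
rewrite /hirota_rhs.
move: (tau_moment k.+2) p0 p1 p2 p3 pl DZ => b.
move: (tau_moment k.+1 _) (tau_moment k.+3 _) => bm bp.
move: (k.+2.*2%:R : QL) Dy (lX rat 1) DX => y Dy X DX p0 p1 p2 p3 pl DZ {k}.
(* The ratio of the [p_2] moment to [Z]: [L] always meets the term [y^2 + y] of the loop
   equation. *)
pose c := L + y ^+ 2 + y; have Lc : L = c - y ^+ 2 - y by rewrite /c; ring.
rewrite -/c; clearbody c; move: Lc DZ => -> DZ {L}.
have b0 := p0 [::]; have b1 := p1 [::]; have b2 := p2 [::]; have b3 := p3 [::].
(* In place of a division by [Z]: twice the derivative of [Z u] is again a multiple of [Z], so each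
   moment becomes [Z] times a differential polynomial in [c]. *)
have D2Z u : 2 * D3 (b [::] * u) = b [::] * ((c - y ^+ 2 - y) * u + 2 * D3 u).
  by rewrite D3M mulrDr [2 * (_ * u)]mulrA DZ; ring.
move: (b [::]) {DZ} D2Z b0 b1 b2 b3 pl => Z D2Z b0 b1 b2 b3 pl.
have b2' : b [:: 2%N] = Z * c.
  by rewrite b2 b3 -[Z in D3 Z]mulr1 D2Z D3_1 /=; ring.
have b1' : b [:: 1%N] = Z * (X * c) by rewrite b1 b2' /=; ring.
have Dc1 u : D3 (X * u) = X * (3 * u + D3 u) by rewrite D3M DX; ring.
have [c1 Dc] : {v | D3 c = v} by exists (D3 c).
have [c2 Dc2] : {v | D3 c1 = v} by exists (D3 c1).
have [c3 Dc3] : {v | D3 c2 = v} by exists (D3 c2).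
have [e eE] : {v | v = c * (c + 8) + 2 * c1} by eexists.
have De : D3 e = 2 * c1 * (c + 4) + 2 * c2.
  rewrite ?eE D3D !D3M D3D !Dn ?Dc ?Dc2; ring.
have [e1 De0] : {v | D3 e = v} by exists (D3 e).
have De1 : D3 e1 = 2 * c2 * (c + 4) + 2 * c1 ^+ 2 + 2 * c3.
  rewrite -De0 De D3D !D3M D3D !Dn ?Dc ?Dc2 ?Dc3; ring.
have b21 : b [:: 2; 1]%N = Z * (X * e).
  rewrite p2 p3 b1' D2Z Dc1 /= b1' ?Dc ?eE; ring.
have [u uE] : {v | v = X ^+ 2 * e + 2 * y} by eexists.
have b11 : b [:: 1; 1]%N = Z * u.
  by rewrite p1 b21 /= b0 ?uE; ring.
have [u1 u1E] : {v | v = X ^+ 2 * (6 * e + e1)} by eexists.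
have Du : D3 u = u1.
  have D2y : D3 (2 * y) = 0 by rewrite D3M Dn Dy; ring.
  by rewrite uE D3D D2y expr2 -mulrA !Dc1 De0 u1E; ring.
have [u2 u2E] : {v | v = X ^+ 2 * (36 * e + 12 * e1 + D3 e1)} by eexists.
have Du1 : D3 u1 = u2.
  by rewrite ?u1E expr2 -mulrA !Dc1 D3D D3M Dn De0 ?u2E; ring.
have b211 : b [:: 2; 1; 1]%N = Z * ((c + 4) * u + 2 * u1).
  by rewrite p2 p3 b11 D2Z Du /= b11; ring.
have [g gE] : {v | v = (c + 4) * u + 2 * u1 + 4 * y * c} by eexists.
have b111 : b [:: 1; 1; 1]%N = Z * (X * g).
  by rewrite p1 b211 /= p0 b1' ?gE; ring.
have Dg : D3 g = c1 * u + (c + 4) * u1 + 2 * u2 + 4 * y * c1.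
  by rewrite ?gE 2!D3D !D3M D3D !Dn Dy Du Du1 ?Dc; ring.
have b2111 : b [:: 2; 1; 1; 1]%N = Z * (X * ((c + 12) * g + 2 * D3 g)).
  by rewrite p2 p3 b111 D2Z Dc1 /= b111; ring.
have b1111 : b [:: 1; 1; 1; 1]%N
    = Z * (X ^+ 2 * ((c + 12) * g + 2 * D3 g) + 6 * y * u).
  by rewrite p1 b2111 /= p0 b11; ring.
have b22 : b [:: 2; 2]%N = Z * (c * (c + 4) + 2 * c1).
  by rewrite p2 p3 b2' D2Z /= b2' ?Dc; ring.
have b31 : X * b [:: 3; 1]%N = Z * ((c - y ^+ 2 - y) * (X * c) + 2 * (X * (3 * c + c1))).
  by rewrite p3 b1' D2Z Dc1 Dc.
have b3' : X * b [:: 3]%N = Z * (c - y ^+ 2 - y).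
  by rewrite b3 -[Z in D3 Z]mulr1 D2Z D3_1; ring.
have -> : 2 * (X * (6 * (bm * bp))) = X * (12 * (bm * bp)) by ring.
rewrite {}pl.
(* [X] is distributed so that [p_3] occurs only as [X p_3], the form that [tau_moment3]
   evaluates. *)
transitivity (Z * (X * (b [:: 1; 1; 1; 1]%N + 3 * b [:: 2; 2]%N) - 4 * (X * b [:: 3; 1]%N))
  - 4 * b [:: 1%N] * (X * b [:: 1; 1; 1]%N - X * b [:: 3%N])
  + 3 * X * (b [:: 1; 1]%N + b [:: 2%N]) * (b [:: 1; 1]%N - b [:: 2%N])).
  by ring.
have E1 : D3 (c1 + 4 * c) = c2 + 4 * c1 by rewrite D3D D3M Dn Dc Dc2; ring.
have E2 : D3 (c2 + 4 * c1) = c3 + 4 * c2 by rewrite D3D D3M Dn Dc2 Dc3; ring.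
rewrite b3' b31 b1' b2' b1111 b22 b111 b11 Dg Dc E1 E2.
rewrite gE u2E u1E uE De1 -De0 De eE; ring.
Qed.

End Hirota.

Definition map_series (K : fieldType) (y : K) : laurent K :=
  power_series (fun n => (L3xy K n).[y]).

Lemma horner_L3xy (K : fieldType) n (y : K) :
  (L3xy K n).[y] = \sum_(1 <= k < (6 * n).+1) (num_cubic_maps n k)%:R * y ^+ k.
Proof.
rewrite /L3xy horner_sum; apply: eq_bigr => k _.
by rewrite hornerZ hornerXn.
Qed.

Lemma horner_L3xy0 (K : fieldType) (y : K) : (L3xy K 0).[y] = 0.
Proof. by rewrite horner_L3xy big_geq. Qed.

(** [6 n] counts the roots, and [cubic_coef n] is the inverse of the number of frames. *)
Lemma horner_L3xy_connected N n : (0 < n)%N ->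
  (L3xy rat n).[N.+1%:R] = 6 * n%:R * cubic_coef n * (num_connected N n)%:R.
Proof.
move=> n0; have := congr1 (fun m => m%:R : rat) (sum_num_cubic_maps N n0).
rewrite !natrM natr_sum natrX => E.
have f0 : n`!%:R * 6 ^+ n != 0 :> rat.
  by rewrite mulf_neq0 ?expf_neq0 // pnatr_eq0 -lt0n fact_gt0.
apply: (mulfI f0); rewrite horner_L3xy.
transitivity (6 * n%:R * (num_connected N n)%:R : rat).
  rewrite -E; congr (_ * _); apply: eq_bigr => k _.
  by rewrite natrM natrX.
have cfE : n`!%:R * 6 ^+ n * cubic_coef n = 1.
  by rewrite /cubic_coef [6 ^+ n * _]mulrC divff.
transitivity ((n`!%:R * 6 ^+ n * cubic_coef n) * (6 * n%:R * (num_connected N n)%:R)).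
  by rewrite cfE mul1r.
by move: (6 ^+ n : rat) => a; ring.
Qed.

Lemma cubic_coef_bin s i : (i <= s)%N ->
  cubic_coef s * 'C(s, i)%:R = cubic_coef i * cubic_coef (s - i).
Proof.
move=> is_; have := congr1 (fun m => m%:R : rat) (bin_fact is_); rewrite !natrM => E.
have h k : 6 ^+ k * k`!%:R != 0 :> rat.
  by rewrite mulf_neq0 ?expf_neq0 // pnatr_eq0 -lt0n fact_gt0.
rewrite /cubic_coef -invfM; apply: (mulfI (h s)); rewrite mulrA divff // mul1r.
apply: (mulIf (mulf_neq0 (h i) (h (s - i)%N))); rewrite -mulrA mulVf ?mulr1; last first.
  exact: mulf_neq0.
have -> : 6 ^+ s = 6 ^+ i * 6 ^+ (s - i)%N :> rat by rewrite -exprD subnKC.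
rewrite -E.
by move: (6 ^+ i : rat) (6 ^+ (s - i)%N : rat) => a b; ring.
Qed.

Section EvenSize.
Variable n : nat.
Hypothesis n_gt0 : (0 < n)%N.
Local Notation p := (pf sgn_moment n (iota 0 n.*2)).
Hypothesis p_neq0 : p != 0.

(** The powers of [p_3] have the same moments on both sides by uniqueness of the loop equations;
    [n.*2] is put in the successor form required by [cubic_moment]. *)
Lemma tau_moment_coef (G : gaussian_matrix n.*2.-1.+1) :
  tau_moment n [::] = p *: power_series (fun j => cubic_coef j * cubic_moment G j).
Proof.
rewrite /tau_moment /= /deform power_seriesZ; congr power_series; apply/funext => j.
rewrite mulrCA; congr (_ * _).
have loopG := matrix_loop_equations G.
have E : n.*2.-1.+1 = n.*2 by rewrite prednK // double_gt0.
rewrite {1}E in loopG.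
have := loop_equations_unique (pf_moment_loop p_neq0) loopG (nseq j 3%N).
rewrite /pf_moment /cubic_moment => <-; rewrite mulrC divfK //.
suff -> : psums (nseq j 3%N) (pf sgn_moment n) =1 iter j (psum 3) (pf sgn_moment n) by [].
by elim: j => //= j IH l; apply: eq_psum.
Qed.

(** [cubic_moment_rec] in generating series: [2 D] is [6 x d/dx], which produces the [6 n] roots of
    a map with [n] vertices. *)
Lemma D3_tau_moment :
  2 * D3 (tau_moment n [::]) = map_series (n.*2%:R) * tau_moment n [::].
Proof.
have G := gaussian_matrix_exists n.*2.-1.+1.
have E : n.*2.-1.+1 = n.*2 by rewrite prednK // double_gt0.
rewrite (tau_moment_coef G) /D3 eulerZ mulrA -!lscaleAr; congr (_ *: _).
rewrite euler_power_series power_seriesM -natrM natr_scale power_seriesZ.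
congr power_series; apply/funext => s.
case: s => [|s]; first by rewrite big_ord1 horner_L3xy0 !mul0r mulr0.
rewrite [RHS]big_ord_recl /= horner_L3xy0 mul0r add0r (cubic_moment_rec G) //.
rewrite !mulr_sumr; apply: eq_bigr => i _; rewrite /= /bump /= add1n.
have := @horner_L3xy_connected n.*2.-1 i.+1 isT; rewrite E => ->.
rewrite subSS; have is_ : (i <= s)%N by rewrite -ltnS.
have key : s.+1%:R * cubic_coef s.+1 * 'C(s, i)%:R
         = i.+1%:R * cubic_coef i.+1 * cubic_coef (s - i).
  have h k : k.+1%:R * cubic_coef k.+1 = 6^-1 * cubic_coef k.
    by rewrite -(cubic_coefS k) -!mulrA mulKf.
  by rewrite !h -!mulrA cubic_coef_bin.
transitivity (6 * (s.+1%:R * cubic_coef s.+1 * 'C(s, i)%:R)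
   * (num_connected n.*2.-1 i.+1)%:R * cubic_moment G (s - i)); first by ring.
by rewrite key; ring.
Qed.

End EvenSize.

(** * Arbitrary size of the matrices *)

Lemma has_constantD p q u v :
  has_constant p u -> has_constant q v -> has_constant (p + q) (u + v).
Proof.
move=> Hp Hq; have := has_constantB Hp (has_constantB has_constant0 Hq).
by rewrite !sub0r !opprK.
Qed.

Lemma has_constant_nat k : has_constant k%:R k%:R.
Proof.
elim: k => [|k IH]; first exact: has_constant0.
rewrite -!natr1; exact: has_constantD IH has_constant1.
Qed.

Lemma has_constantX p u k : has_constant p u -> has_constant (p ^+ k) (u ^+ k).
Proof.
move=> Hp; elim: k => [|k IH]; first exact: has_constant1.
by rewrite !exprS; exact: has_constantM.
Qed.

Lemma has_constant_D3 p u : has_constant p u -> has_constant (D3 p) 0.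
Proof.
move=> [p0 _]; rewrite /D3 natr_scale; split=> [k /p0 E|].
  by rewrite lcoefZ /= E !mulr0.
by rewrite lcoefZ /= mul0r mulr0.
Qed.

Lemma has_constant_lX1 : has_constant (lX rat 1) 0.
Proof. by split=> // -[]. Qed.

Lemma has_constant_map_series (y : rat) : has_constant (map_series y) 0.
Proof. by split=> [[]//|]; rewrite /= horner_L3xy0. Qed.

Lemma hirota_rhs_constant y L v : has_constant y v -> has_constant L 0 ->
  has_constant (hirota_rhs y L) (6 * v ^+ 2 - 6 * v).
Proof.
move=> Hy HL; rewrite /hirota_rhs; have Hn := has_constant_nat; have HX := has_constant_lX1.
set t := L + _ + _; have Ht : has_constant t (v ^+ 2 + v).
  by rewrite -[v ^+ 2]add0r; do ?apply: has_constantD => //; exact: has_constantX.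
have Ht1 := has_constant_D3 Ht.
set u := D3 t + 4 * t.
have Hu := has_constantD Ht1 (has_constantM (Hn 4) Ht); rewrite -/u in Hu.
have Hu1 := has_constant_D3 Hu; have Hu2 := has_constant_D3 Hu1.
(* The value is expanded into the syntactic shape of [hirota_rhs], on which the structural search
   below relies. *)
have -> : 6 * v ^+ 2 - 6 * v =
   4 * 0 ^+ 4 * (0 + 20 * 0 + 96 * (0 + 4 * (v ^+ 2 + v))) + 48 * v * 0 ^+ 2
   - (0 + 6 * (v ^+ 2 + v)) + 12 * 0 ^+ 4 * (0 + 4 * (v ^+ 2 + v)) ^+ 2
   + 24 * v * 0 ^+ 2 * (0 + 4 * (v ^+ 2 + v)) + 12 * v ^+ 2 by ring.
repeat match goal with
| H : has_constant ?p _ |- has_constant ?p _ => exact: H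
| |- has_constant (_ + - _) _ => apply: has_constantB
| |- has_constant (_ + _) _ => apply: has_constantD
| |- has_constant (_ * _) _ => apply: has_constantM
| |- has_constant (_ ^+ _) _ => apply: has_constantX
| |- has_constant (_%:R) _ => exact: Hn
end.
Qed.

Lemma neq0_of_product (a b c d : rat) :
  6 * (a * b) = c ^+ 2 * d -> c != 0 -> d != 0 -> b != 0.
Proof.
move=> E c0 d0; apply/eqP => b0; move: E; rewrite b0 !mulr0 => /esym/eqP.
by rewrite mulf_eq0 expf_eq0 (negbTE c0) (negbTE d0).
Qed.

Lemma tau_moment_constant n :
  has_constant (tau_moment n [::]) (pf sgn_moment n (iota 0 n.*2)).
Proof. by rewrite /tau_moment /= -pf_deformed; exact: pf_constant. Qed.

(** Nonvanishing at [k.+2] makes the bilinear equation available there; its constant term then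
    forces nonvanishing at [k.+3], through the factor [N (N - 1)] with [N = k.+2.*2]. The first
    three values are computed. *)
Lemma pf_sgn_moment_neq0 n : pf sgn_moment n (iota 0 n.*2) != 0.
Proof.
have [m] := ubnP n; elim: m n => // m IH [|[|[|k]]] km //.
have p2 : pf sgn_moment k.+2 (iota 0 k.+2.*2) != 0 by apply: IH; lia.
have p1 : pf sgn_moment k.+1 (iota 0 k.+1.*2) != 0 by apply: IH; lia.
have := hirota_bilinear (D3_tau_moment (ltn0Sn _) p2).
have [_ cL] := has_constantM (has_constant_nat 6)
  (has_constantM (tau_moment_constant k.+1) (tau_moment_constant k.+3)).
have [_ cR] := has_constantM (has_constantX 2 (tau_moment_constant k.+2))
   (hirota_rhs_constant (has_constant_nat k.+2.*2) (has_constant_map_series k.+2.*2%:R)).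
move=> /(congr1 (fun p : QL => p 0)) E.
apply: (neq0_of_product (etrans (esym cL) (etrans E cR)) p2).
have -> : 6 * k.+2.*2%:R ^+ 2 - 6 * k.+2.*2%:R = 6 * k.+2.*2%:R * (k.+2.*2%:R - 1) :> rat.
  by ring.
have k0 : k.+2.*2%:R != 0 :> rat by rewrite pnatr_eq0.
apply: mulf_neq0; first exact: mulf_neq0.
by rewrite subr_eq0 pnatr_eq1; lia.
Qed.

(** The analogue of [V] before the rescaling of [x], at [y = 1 / w]. *)
Definition shift_series (K : fieldType) (y : K) : laurent K :=
  map_series (y + 2) + map_series (y - 2) - 2 * map_series y.

Definition hirota_ode (K : fieldType) (y : K) : laurent K :=
  2 * D3 (hirota_rhs y%:A (map_series y))
  - shift_series y * hirota_rhs y%:A (map_series y).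

Lemma natr_alg (K : fieldType) k : (k%:R%:A : laurent K) = k%:R.
Proof. by rewrite scaler_nat. Qed.

(** Applying [2 D] to the bilinear equation and replacing each [2 D Z] by its multiple of [Z] leaves
    [Z^2] times the desired equation; [Z^2] has a nonzero constant term and cancels. *)
Lemma hirota_ode_even n : hirota_ode ((n.+2.*2)%:R : rat) = 0.
Proof.
have Hn := has_constant_nat; have Hm := has_constant_map_series.
rewrite /hirota_ode natr_alg /shift_series.
have -> : n.+2.*2%:R + 2 = n.+3.*2%:R :> rat by rewrite -natrD !doubleS; congr _%:R; lia.
have -> : n.+2.*2%:R - 2 = n.+1.*2%:R :> rat.
  by apply/eqP; rewrite subr_eq -natrD; apply/eqP; congr _%:R; lia.
have D k := D3_tau_moment (ltn0Sn k) (pf_sgn_moment_neq0 k.+1).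
have H := hirota_bilinear (D n.+1); have nz := pf_sgn_moment_neq0 n.+2.
have HZ := tau_moment_constant n.+2.
have HA := hirota_rhs_constant (Hn n.+2.*2) (Hm n.+2.*2%:R).
move: (Hm n.+1.*2%:R) (Hm n.+2.*2%:R) (Hm n.+3.*2%:R) (D n) (D n.+1) (D n.+2) H HZ HA.
move: (hirota_rhs _ _) (tau_moment n.+1 _) (tau_moment n.+2 _) (tau_moment n.+3 _).
move: (map_series _) (map_series _) (map_series _) (pf _ _ _) nz.
move=> L1 L2 L3 p p0 A a Z b H1 H2 H3 Da DZ Db H HZ HA {D}.
have EL : 2 * D3 (6 * (a * b)) = (L1 + L3) * (6 * (a * b)).
  rewrite !D3M (D3_nat _ 6); transitivity (6 * ((2 * D3 a) * b + a * (2 * D3 b))).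
    by ring.
  by rewrite Da Db; ring.
have ER : 2 * D3 (Z ^+ 2 * A) = 2 * L2 * (Z ^+ 2 * A) + Z ^+ 2 * (2 * D3 A).
  rewrite expr2 !D3M; transitivity (2 * (2 * D3 Z) * Z * A + Z * Z * (2 * D3 A)).
    by ring.
  by rewrite DZ; ring.
have E : Z ^+ 2 * (2 * D3 A - (L1 + L3 - 2 * L2) * A) = 0.
  have E1 : (L1 + L3) * (Z ^+ 2 * A) = 2 * L2 * (Z ^+ 2 * A) + Z ^+ 2 * (2 * D3 A).
    by rewrite -ER -H EL.
  transitivity (Z ^+ 2 * (2 * D3 A) + 2 * L2 * (Z ^+ 2 * A) - (L1 + L3) * (Z ^+ 2 * A)).
    by ring.
  by rewrite E1; ring.
have HZ2 := has_constantX 2 HZ.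
have HQ := has_constantB (has_constantM (Hn 2%N) (has_constant_D3 HA))
  (has_constantM (has_constantB (has_constantD H3 H1) (has_constantM (Hn 2%N) H2)) HA).
have nzc : (Z ^+ 2) 0%N != 0 by have [_ ->] := HZ2; rewrite expf_neq0.
rewrite (has_constantE HQ); apply: (power_series_reg nzc).
rewrite -(has_constantE HQ); apply: etrans E.
by rewrite [in RHS](has_constantE HZ2).
Qed.

(** * Polynomial dependence on the size of the matrices *)

Section Specialisation.
Variables (K : fieldType) (ev : {rmorphism {poly rat} -> K}).
Implicit Types (p : laurent K) (q : nat -> laurent rat).

(** A common origin in series with polynomial coefficients, which lets vanishing at integers pass to
    the image under [ev]. *)
Definition specialises p q := exists c : nat -> {poly rat},
  p = power_series (fun n => ev (c n)) /\
  forall N, q N = power_series (fun n => (c n).[N%:R]).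

Lemma specialisesD p p' q q' : specialises p q -> specialises p' q' ->
  specialises (p + p') (fun N => q N + q' N).
Proof.
move=> [c [-> qc]] [c' [-> qc']]; exists (fun n => c n + c' n); split=> [|N].
  by rewrite power_seriesD; congr power_series; apply/funext => n; rewrite rmorphD.
by rewrite qc qc' power_seriesD; congr power_series; apply/funext => n; rewrite hornerD.
Qed.

Lemma specialisesN p q : specialises p q -> specialises (- p) (fun N => - q N).
Proof.
move=> [c [-> qc]]; exists (fun n => - c n); split=> [|N].
  by rewrite power_seriesN; congr power_series; apply/funext => n; rewrite rmorphN.
by rewrite qc power_seriesN; congr power_series; apply/funext => n; rewrite hornerN.
Qed.

Lemma specialisesM p p' q q' : specialises p q -> specialises p' q' ->
  specialises (p * p') (fun N => q N * q' N).
Proof.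
move=> [c [-> qc]] [c' [-> qc']].
exists (fun n => \sum_(i < n.+1) c i * c' (n - i)%N); split=> [|N].
  rewrite power_seriesM; congr power_series; apply/funext => n.
  by rewrite rmorph_sum; apply: eq_bigr => i _; rewrite rmorphM.
rewrite qc qc' power_seriesM; congr power_series; apply/funext => n.
by rewrite horner_sum; apply: eq_bigr => i _; rewrite hornerM.
Qed.

Lemma nat_power_series (F : fieldType) k :
  (k%:R : laurent F) = power_series (fun n => (k * (n == 0))%:R).
Proof.
rewrite -natr_alg; apply: laurentP => -[n|n]; rewrite coef_scale1 /=; last first.
  by rewrite mulr0.
by rewrite natrM.
Qed.

Lemma specialises_nat k : specialises k%:R (fun=> k%:R).
Proof.
exists (fun n => (k * (n == 0))%:R); split=> [|N]; rewrite nat_power_series;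
  congr power_series; apply/funext => n.
  by rewrite rmorph_nat.
by rewrite -polyC_natr hornerC.
Qed.

Lemma specialisesX p q k : specialises p q -> specialises (p ^+ k) (fun N => q N ^+ k).
Proof.
move=> H; elim: k => [|k IH].
  by apply: (specialises_nat 1).
rewrite exprS; have -> : (fun N => q N ^+ k.+1) = (fun N => q N * q N ^+ k).
  by apply/funext => N; rewrite exprS.
exact: specialisesM.
Qed.

Lemma specialises_D3 p q : specialises p q -> specialises (D3 p) (fun N => D3 (q N)).
Proof.
move=> [c [-> qc]]; apply: (specialisesM (specialises_nat 3)).
exists (fun n => n%:R * c n); split=> [|N].
  rewrite euler_power_series; congr power_series; apply/funext => n.
  by rewrite rmorphM rmorph_nat.
rewrite qc euler_power_series; congr power_series; apply/funext => n.
by rewrite -polyC_natr hornerM hornerC.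
Qed.

Lemma lX1_power_series (F : fieldType) : lX F 1 = power_series (fun n => (n == 1%N)%:R).
Proof. by apply: laurentP => -[n|n]. Qed.

Lemma specialises_lX1 : specialises (lX K 1) (fun=> lX rat 1).
Proof.
exists (fun n => (n == 1%N)%:R); split=> [|N]; rewrite lX1_power_series;
  congr power_series; apply/funext => n.
  by rewrite rmorph_nat.
by rewrite -polyC_natr hornerC.
Qed.

Lemma specialises_map_series e :
  specialises (map_series (ev e)) (fun N => map_series e.[N%:R]).
Proof.
exists (fun n => \sum_(1 <= k < (6 * n).+1) (num_cubic_maps n k)%:R * e ^+ k).
split=> [|N]; rewrite /map_series; congr power_series; apply/funext => n;
  rewrite horner_L3xy.
  by rewrite rmorph_sum; apply: eq_bigr => k _; rewrite rmorphM rmorph_nat rmorphXn.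
rewrite horner_sum; apply: eq_bigr => k _.
by rewrite -polyC_natr hornerM hornerC horner_exp.
Qed.

Lemma alg_power_series (F : fieldType) (a : F) :
  (a%:A : laurent F) = power_series (fun n => a * (n == 0%N)%:R).
Proof. by apply: laurentP => -[n|n]; rewrite coef_scale1 //= mulr0. Qed.

Lemma specialises_y : specialises (ev 'X)%:A (fun N => (N%:R)%:A).
Proof.
exists (fun n => 'X * (n == 0%N)%:R); split=> [|N]; rewrite alg_power_series;
  congr power_series; apply/funext => n.
  by rewrite rmorphM rmorph_nat.
by rewrite -polyC_natr hornerM hornerC hornerX.
Qed.

Lemma specialises_hirota_ode :
  specialises (hirota_ode (ev 'X)) (fun N => hirota_ode N%:R).
Proof.
have Hp : specialises (map_series (ev 'X + 2)) (fun N => map_series (N%:R + 2)).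
  have := specialises_map_series ('X + 2); rewrite rmorphD rmorph_nat.
  congr specialises; apply/funext => N.
  by rewrite hornerD hornerX -[2](polyC_natr _ 2) hornerC.
have Hm : specialises (map_series (ev 'X - 2)) (fun N => map_series (N%:R - 2)).
  have := specialises_map_series ('X - 2); rewrite rmorphB rmorph_nat.
  congr specialises; apply/funext => N.
  by rewrite hornerD hornerN hornerX -[2](polyC_natr _ 2) hornerC.
have H0 : specialises (map_series (ev 'X)) (fun N => map_series N%:R).
  have := specialises_map_series 'X; congr specialises; apply/funext => N.
  by rewrite hornerX.
have Hy := specialises_y; have HX := specialises_lX1; have Hn := specialises_nat.
rewrite /hirota_ode /shift_series /hirota_rhs.
repeat match goal with
| H : specialises ?p _ |- specialises ?p _ => exact: H
| |- specialises (_ + _) _ => apply: specialisesD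
| |- specialises (- _) _ => apply: specialisesN
| |- specialises (_ * _) _ => apply: specialisesM
| |- specialises (_ ^+ _) _ => apply: specialisesX
| |- specialises (D3 _) _ => apply: specialises_D3
| |- specialises (_%:R) _ => exact: Hn
end.
Qed.

(** Each coefficient is a polynomial with the infinitely many roots 4, 6, 8, ... *)
Lemma specialises_eq0 p q : specialises p q -> (forall n, q n.+2.*2 = 0) -> p = 0.
Proof.
move=> [c [-> qc]] q0; have c0 n : c n = 0.
  apply/eqP/negPn/negP => cn.
  have := @max_poly_roots _ (c n) [seq (k.+2.*2)%:R | k <- iota 0 (size (c n))] cn.
  rewrite size_map size_iota ltnn => H; suff : false by [].
  apply: H.
    apply/allP => _ /mapP[k _ ->]; rewrite /root.
    have := congr1 (fun p : QL => p n) (qc k.+2.*2); rewrite q0 /= => <-.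
    by rewrite eqxx.
  rewrite map_inj_uniq ?iota_uniq // => i j /eqP.
  by rewrite eqr_nat => /eqP/double_inj [].
by apply: laurentP => -[n|n] //=; rewrite c0 rmorph0.
Qed.

Lemma hirota_ode_eq0 : hirota_ode (ev 'X) = 0.
Proof. exact: specialises_eq0 specialises_hirota_ode hirota_ode_even. Qed.

End Specialisation.

(** * Rescaling *)

Section Rescaling.
Variables (K : fieldType) (w : K).
Hypothesis w0 : w != 0.
Implicit Types p q : laurent K.

(** Parity matters because [subst_sqrt] rounds half the exponent down. *)
Definition even_series p := forall n : int, ~~ (2 %| n)%Z -> p n = 0.

Lemma even_seriesD p q : even_series p -> even_series q -> even_series (p + q).
Proof. by move=> Hp Hq n n2; rewrite lcoefD Hp ?Hq ?addr0. Qed.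

Lemma even_seriesB p q : even_series p -> even_series q -> even_series (p - q).
Proof. by move=> Hp Hq n n2; rewrite lcoefD lcoefN Hp ?Hq ?subr0. Qed.

Lemma even_series_nat k p : even_series p -> even_series (k%:R * p).
Proof. by move=> Hp n n2; rewrite natr_scale lcoefZ Hp ?mulr0. Qed.

Lemma even_series_D3 p : even_series p -> even_series (D3 p).
Proof. by move=> Hp; apply: even_series_nat => n n2; rewrite /= Hp ?mulr0. Qed.

Lemma even_series_alg c : even_series c%:A.
Proof.
by move=> n n2; rewrite coef_scale1; case: eqP n2 => [->//|_ _]; rewrite mulr0.
Qed.

Lemma even_series_lX m : (2 %| m)%Z -> even_series (lX K m).
Proof. by move=> m2 n n2; rewrite coef_lX; case: eqP n2 => // ->; rewrite m2. Qed.

Lemma even_map_series (y : K) : even_series (map_series y).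
Proof.
case=> [n|n] n2 //=; rewrite horner_L3xy big1 // => k _.
by rewrite num_cubic_maps_odd ?mul0r //; move: n2; lia.
Qed.

Local Notation S := (subst_sqrt w).

Lemma coef_subst_sqrt u p n : subst_sqrt u p n = u ^ (n %/ 2)%Z * p n.
Proof. by []. Qed.

Lemma subst_sqrtD p q : S (p + q) = S p + S q.
Proof. by apply: laurentP => n; rewrite /= mulrDr. Qed.

Lemma subst_sqrtB p q : S (p - q) = S p - S q.
Proof. by apply: laurentP => n; rewrite /= mulrBr. Qed.

Lemma subst_sqrtZ c p : S (c *: p) = c *: S p.
Proof. by apply: laurentP => n; rewrite /= mulrCA. Qed.

Lemma subst_sqrt_nat k p : S (k%:R * p) = k%:R * S p.
Proof. by rewrite !natr_scale subst_sqrtZ. Qed.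

Lemma subst_sqrt_D3 p : S (D3 p) = D3 (S p).
Proof.
by rewrite /D3 subst_sqrt_nat; congr (_ * _); apply: laurentP => n; rewrite /= mulrCA.
Qed.

Lemma subst_sqrt_lX m : S (lX K m) = w ^ (m %/ 2)%Z *: lX K m.
Proof.
apply: laurentP => n; rewrite lcoefZ /= /monomial_fun.
by case: eqP => [->//|_]; rewrite !mulr0.
Qed.

Lemma subst_sqrt_alg c : S c%:A = c%:A.
Proof. by rewrite subst_sqrtZ -(lX0 K) subst_sqrt_lX scale1r. Qed.

(** The floor of half a sum splits as soon as one summand is even, so evenness of one factor
    suffices. *)
Lemma subst_sqrtM p q : even_series p -> S (p * q) = S p * S q.
Proof.
move=> Hp; apply: laurentP => n.
have [M Mp] := laurent_bounded p; have [N Nq] := laurent_bounded q.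
have Mp' m : m < - M%:Z -> S p m = 0 by move=> /Mp; rewrite /= => ->; exact: mulr0.
have Nq' m : m < - N%:Z -> S q m = 0 by move=> /Nq; rewrite /= => ->; exact: mulr0.
case: (ltP n (- (M + N)%N%:Z)) => [lt_n | le_n].
  by rewrite /= (conv_lt Mp Nq lt_n) (conv_lt Mp' Nq' lt_n) mulr0.
have n0 : 0 <= n + (M + N)%N%:Z by rewrite -lerBlDr sub0r.
rewrite -[n](addrK (M + N)%N%:Z) -(gez0_abs n0); set k := absz _.
rewrite [S (p * q) _]/= (conv_sum k Mp Nq) [RHS](conv_sum k Mp' Nq') mulr_sumr.
apply: eq_bigr => i _ /=.
have -> : k%:Z - (M + N)%N%:Z = (i%:Z - M%:Z) + ((k - i)%N%:Z - N%:Z).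
  by have := ltn_ord i; lia.
have [e|ne] := boolP (2 %| i%:Z - M%:Z)%Z; last by rewrite Hp // !(mul0r, mulr0).
by rewrite divzDl // expfzDr //; ring.
Qed.

Lemma L3E (v : K) : L3 v = v ^+ 2 *: subst_sqrt v (map_series v^-1).
Proof. by []. Qed.

(** The two substitutions compose to that of [x w^(1/2)] for [x]. For [u = 1 + 2 w] and
    [u = 1 - 2 w], [u / w] is [1 / w] shifted by 2 and by - 2, the origin of the first two terms of
    [V]. *)
Lemma subst_sqrt_L3 (u : K) : u != 0 ->
  u ^+ 2 *: subst_sqrt u (L3 (w / u)) = w ^+ 2 *: S (map_series (u / w)).
Proof.
move=> u0; have [v vE] : {v | v = w / u} by exists (w / u).
have wE : w = u * v by rewrite vE mulrCA divff ?mulr1.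
apply: laurentP => n; rewrite -vE -invf_div -vE L3E !(lcoefZ, coef_subst_sqrt).
rewrite wE expfzMl exprMn; move: (map_series _ _) (u ^ _) (v ^ _) => a b c; ring.
Qed.

Hypothesis two_neq0 : 2 != 0 :> K.
Hypotheses (wp : 1 + 2 * w != 0) (wm : 1 - 2 * w != 0).
Hypothesis ode : hirota_ode w^-1 = 0.

Local Notation X := (lX K 1).
Local Notation Xi := (lX K (-2)).

Lemma shift_series_rescaled :
  w ^- 2 *: ((1 + 2 * w) ^+ 2 *: subst_sqrt (1 + 2 * w) (L3 (w / (1 + 2 * w)))
           + (1 - 2 * w) ^+ 2 *: subst_sqrt (1 - 2 * w) (L3 (w / (1 - 2 * w)))
           - 2 *: L3 w) = S (shift_series w^-1).
Proof.
rewrite !subst_sqrt_L3 // L3E /shift_series subst_sqrtB subst_sqrtD subst_sqrt_nat.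
rewrite natr_scale.
have w20 : w ^+ 2 != 0 by rewrite expf_neq0.
move: (w ^+ 2) w20 => c c0; rewrite [2 *: (_ *: _)]scalerA [2 * c]mulrC -scalerA.
rewrite -scalerDr -scalerBr scalerA mulVf //.
rewrite scale1r; congr (S _ + S _ - _); congr map_series; field; exact: w0.
Qed.

Local Notation A := (hirota_rhs w^-1%:A (map_series w^-1)).
Local Notation St := (S (map_series w^-1) + w^-1%:A ^+ 2 + w^-1%:A).
Local Notation U := (D3 St + 4 * St).
Local Notation P := (D3 (D3 U) + 20 * D3 U + 96 * U).

Lemma subst_sqrt_lXM k p : S (lX K k.*2%:Z * p) = w%:A ^+ k * lX K k.*2%:Z * S p.
Proof.
rewrite subst_sqrtM; last by apply: even_series_lX; lia.
rewrite subst_sqrt_lX (_ : (k.*2%:Z %/ 2)%Z = k); last by lia.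
by rewrite -exprnP lmulZl -!in_algE rmorphXn.
Qed.

(** The substitution brings a [w] with each [x^2]; together with the prefactor [w^2] these absorb
    all explicit powers of [y = 1 / w] outside [St]. *)
Lemma subst_sqrt_hirota_rhs :
  w%:A ^+ 2 * S A = 4 * w%:A ^+ 4 * X ^+ 4 * P + 48 * w%:A ^+ 2 * X ^+ 2
    - w%:A ^+ 2 * (D3 St + 6 * St) + 12 * w%:A ^+ 4 * X ^+ 4 * U ^+ 2
    + 24 * w%:A ^+ 2 * X ^+ 2 * U + 12.
Proof.
have [y yE] : {y | y = w^-1%:A :> laurent K} by eexists.
have wy : w%:A * y = 1 by rewrite yE -scalerAl mul1r scalerA divff // scale1r.
have Ey : even_series y by rewrite yE; exact: even_series_alg.
have Sy : S y = y by rewrite yE subst_sqrt_alg.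
have [t tE] : {t | t = map_series w^-1 + y ^+ 2 + y} by eexists.
have StE : St = S t by rewrite -yE tE !subst_sqrtD [S (y ^+ 2)]subst_sqrtM // Sy.
have [u uE] : {u | u = D3 t + 4 * t} by eexists.
have UE : U = S u by rewrite StE uE subst_sqrtD subst_sqrt_D3 subst_sqrt_nat.
have Eu : even_series u.
  have Et : even_series t.
    rewrite tE expr2; apply: even_seriesD Ey; apply: even_seriesD.
      exact: even_map_series.
    rewrite yE -scalerAl mul1r scalerA; exact: even_series_alg.
  rewrite uE; apply: even_seriesD; first exact: even_series_D3.
  exact: even_series_nat.
have [v vE] : {v | v = D3 (D3 u) + 20 * D3 u + 96 * u} by eexists.
have PE : P = S v.
  rewrite UE vE !subst_sqrtD [S (20 * _)]subst_sqrt_nat [S (96 * _)]subst_sqrt_nat.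
  by rewrite !subst_sqrt_D3.
have AE : A = lX K 2.*2%N%:Z * (4 * v + 12 * (u * u))
    + lX K 1.*2%N%:Z * (48 * y + 24 * (y * u))
    - (D3 t + 6 * t) + 12 * (y * y).
  rewrite /hirota_rhs -yE -tE -uE -vE (lX_exp K 1 4) (lX_exp K 1 2).
  rewrite (_ : 1 *+ 4 = 2.*2%N%:Z) // (_ : 1 *+ 2 = 1.*2%N%:Z) //.
  by move: (lX K 2.*2) (lX K 1.*2) => a b; ring.
rewrite AE [S (_ + 12 * _)]subst_sqrtD subst_sqrtB [S (_ + lX _ _ * _)]subst_sqrtD.
rewrite (subst_sqrt_lXM 2) (subst_sqrt_lXM 1).
have Snu k : S (k%:R * (y * u)) = k%:R * (y * S u).
  by rewrite subst_sqrt_nat subst_sqrtM // Sy.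
have Syy : S (12 * (y * y)) = 12 * (y * y) by rewrite subst_sqrt_nat subst_sqrtM // Sy.
have S4 : S (4 * v + 12 * (u * u)) = 4 * S v + 12 * (S u * S u).
  by rewrite subst_sqrtD [S (4 * _)]subst_sqrt_nat subst_sqrt_nat subst_sqrtM.
have S48 : S (48 * y + 24 * (y * u)) = 48 * y + 24 * (y * S u).
  by rewrite subst_sqrtD Snu subst_sqrt_nat Sy.
have S6 : S (D3 t + 6 * t) = D3 (S t) + 6 * S t.
  by rewrite subst_sqrtD [S (6 * _)]subst_sqrt_nat subst_sqrt_D3.
rewrite S4 S48 S6 Syy.
rewrite PE UE StE -(lX_exp K 1 4) -(lX_exp K 1 2).
move: (S v) (S u) (S t) X (w%:A) wy => a b c x z; move: (D3 c) => d zy.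
transitivity (4 * z ^+ 4 * x ^+ 4 * a + 48 * z ^+ 2 * x ^+ 2 * (z * y)
    - z ^+ 2 * (d + 6 * c) + 12 * z ^+ 4 * x ^+ 4 * b ^+ 2
    + 24 * z ^+ 2 * x ^+ 2 * b * (z * y) + 12 * (z * y) ^+ 2); first by ring.
by rewrite zy; ring.
Qed.

Lemma rescaled_ode :
  let x := lX K 1 in
  let D (f : laurent K) : laurent K := 3 *: euler f in
  let Dplus (a : nat) (f : laurent K) : laurent K := D f + a%:R * f in
  let T : laurent K := L3 w + (w + 1)%:A - 2^-1 *: lX K (- 2) in
  let V : laurent K :=
    w ^- 2 *: ((1 + 2 * w) ^+ 2 *: subst_sqrt (1 + 2 * w) (L3 (w / (1 + 2 * w)))
             + (1 - 2 * w) ^+ 2 *: subst_sqrt (1 - 2 * w) (L3 (w / (1 - 2 * w)))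
             - 2 *: L3 w) in
  (4 * w ^+ 2) *: (x ^+ 4 * Dplus 12%N (Dplus 12%N (Dplus 8%N (Dplus 4%N T))))
    - Dplus 6%N (D T) + 12 * x ^+ 4 * Dplus 12%N (Dplus 4%N T ^+ 2)
  = V * ((2 * w ^+ 2) *: (x ^+ 4 * Dplus 12%N (Dplus 8%N (Dplus 4%N T)))
         - 2^-1 *: Dplus 6%N T + 6 * x ^+ 4 * Dplus 4%N T ^+ 2).
Proof.
move=> x D Dplus T V; have -> : V = S (shift_series w^-1) := shift_series_rescaled.
have [X' XE] : {X' | X' = lX K 1} by eexists.
have Dx : D3 X' = 3 * X' by rewrite XE D3_X.
have XXi : X' ^+ 2 * Xi = 1 by rewrite XE (lX_exp K 1 2) -lXD.
have SA := subst_sqrt_hirota_rhs; rewrite -XE in SA.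
rewrite {}/x -XE; move: X' {XE} Dx XXi SA => x Dx XXi SA.
have DE f : D f = D3 f by rewrite /D -natr_scale.
have DplusE a f : Dplus a f = D3 f + a%:R * f by rewrite /Dplus DE.
have [st stE] : {st | st = St} by eexists.
have [u uE] : {u | u = D3 st + 4 * st} by eexists.
have [z zE] : {z | z = w%:A :> laurent K} by eexists.
have [h hE] : {h | h = 2^-1%:A :> laurent K} by eexists.
have h2 : 2 * h = 1 by rewrite natr_scale hE scalerA divff ?scale1r.
have zalg k : w ^+ k *: 1 = z ^+ k by rewrite zE -!in_algE rmorphXn.
have Dz : D3 z = 0 by rewrite zE D3Z D3_1 scaler0.
have DX4 f : D3 (x ^+ 4 * f) = x ^+ 4 * (D3 f + 12 * f).
  have DX g : D3 (x * g) = x * (D3 g + 3 * g) by rewrite D3M Dx; ring.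
  have D3n k g : D3 (k%:R * g) = k%:R * D3 g by rewrite D3M D3_nat mul0r add0r.
  by rewrite !exprS expr0 mulr1 -!mulrA !(DX, D3D, D3n); ring.
have Dz2 f : D3 (z ^+ 2 * f) = z ^+ 2 * D3 f.
  by rewrite expr2 !D3M Dz; ring.
have DXi : D3 Xi = - 6 * Xi.
  rewrite D3_lX mulNr natr_scale -scaleNr; congr (_ *: _).
  by rewrite (_ : (- 2)%:~R = - 2 :> K) //; ring.
have DhXi : D3 (h * Xi) = - 3 * Xi.
  rewrite hE -lmulZl D3Z DXi lmulZl -hE.
  by transitivity (- 3 * (2 * h) * Xi); [ring | rewrite h2; ring].
(* The polar part [- x^(-2) / 2] is killed by [D + 6] and becomes [x^(-2)] under [D + 4], as [D]
   multiplies [x^(-2)] by - 6. *)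
have TE : T = z ^+ 2 * st - h * Xi.
  rewrite /T L3E stE hE -lmulZl; congr (_ - _).
  have yE : w^-1%:A * z = 1 by rewrite zE -scalerAl mul1r scalerA mulVf ?scale1r.
  rewrite scalerDl scale1r -zE lmulZl zalg; move: (S _) => s.
  transitivity (z ^+ 2 * s + (w^-1%:A * z) ^+ 2 + (w^-1%:A * z) * z); last by ring.
  by rewrite yE; ring.
have T4 : Dplus 4 T = z ^+ 2 * u + Xi.
  rewrite DplusE TE D3B Dz2 DhXi uE; transitivity
    (z ^+ 2 * (D3 st + 4 * st) + 3 * Xi - 2 * (2 * h) * Xi); first by ring.
  by rewrite h2; ring.
have T8 : Dplus 8 (Dplus 4 T) = z ^+ 2 * (D3 u + 8 * u) + 2 * Xi.
  by rewrite T4 DplusE D3D Dz2 DXi; ring.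
have T12 : Dplus 12 (Dplus 8 (Dplus 4 T))
    = z ^+ 2 * (D3 (D3 u) + 20 * D3 u + 96 * u) + 12 * Xi.
  have D2 : D3 (2 * Xi) = 2 * D3 Xi by rewrite D3M D3_nat mul0r add0r.
  have D8 : D3 (8 * u) = 8 * D3 u by rewrite D3M D3_nat mul0r add0r.
  by rewrite T8 DplusE D3D Dz2 D3D D2 D8 DXi; ring.
have T6 : Dplus 6 T = z ^+ 2 * (D3 st + 6 * st).
  rewrite DplusE TE D3B Dz2 DhXi; transitivity
    (z ^+ 2 * (D3 st + 6 * st) + 3 * Xi - 3 * (2 * h) * Xi); first by ring.
  by rewrite h2; ring.
have T6' : Dplus 6 (D T) = D3 (Dplus 6 T).
  have D6 : D3 (6 * T) = 6 * D3 T by rewrite D3M D3_nat mul0r add0r.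
  by rewrite !DplusE DE [RHS]D3D D6.
have [p pE] : {p | p = D3 (D3 u) + 20 * D3 u + 96 * u} by eexists.
have [s sE] : {s | s = D3 st + 6 * st} by eexists.
rewrite -stE -zE -uE -pE -sE in SA.
have AE : 4 * z ^+ 2 * (x ^+ 4 * Dplus 12 (Dplus 8 (Dplus 4 T))) - Dplus 6 T
    + 12 * (x ^+ 4 * Dplus 4 T ^+ 2) = z ^+ 2 * S A.
  rewrite T12 T6 T4 -pE -sE SA.
  transitivity (4 * z ^+ 4 * x ^+ 4 * p + 48 * z ^+ 2 * x ^+ 2 * (x ^+ 2 * Xi)
    - z ^+ 2 * s + 12 * z ^+ 4 * x ^+ 4 * u ^+ 2
    + 24 * z ^+ 2 * x ^+ 2 * u * (x ^+ 2 * Xi) + 12 * (x ^+ 2 * Xi) ^+ 2).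
    by ring.
  by rewrite XXi; ring.
(* As [x^4 (D + 12) = D x^4], the left-hand side is [D] applied to twice the
  second factor of the right-hand side. *)
have D12 f : x ^+ 4 * Dplus 12 f = D3 (x ^+ 4 * f) by rewrite DX4 DplusE.
have D12' f : 12 * x ^+ 4 * Dplus 12 f = D3 (12 * (x ^+ 4 * f)).
  by rewrite -mulrA D12 [RHS]D3M D3_nat mul0r add0r.
have w4 (f : laurent K) : (4 * w ^+ 2) *: f = 4 * (z ^+ 2 * f).
  by rewrite natr_scale -zalg -scalerAl mul1r scalerA.
have w2 (f : laurent K) : 2 * ((2 * w ^+ 2) *: f) = 4 * (z ^+ 2 * f).
  by rewrite -w4 natr_scale scalerA mulrA -natrM.
have V2 (f : laurent K) : 2 * (2^-1 *: f) = f
  by rewrite natr_scale scalerA divff ?scale1r.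
have ode' : 2 * D3 (S A) = S (shift_series w^-1) * S A.
  have Vev : even_series (shift_series w^-1).
    apply: even_seriesB; last exact/even_series_nat/even_map_series.
    by apply: even_seriesD; exact: even_map_series.
  have /eqP := ode; rewrite subr_eq0 => /eqP /(congr1 S).
  by rewrite subst_sqrt_nat subst_sqrt_D3 subst_sqrtM.
have reg2 (f g : laurent K) : 2 * f = 2 * g -> f = g.
  by move=> E; rewrite -[f]V2 -[g]V2 -lscaleAr E lscaleAr.
apply: reg2; rewrite D12 D12' T6' w4.
move: (Dplus 12 _) (Dplus 6 T) (Dplus 4 T ^+ 2) AE => q r g AE.
transitivity (2 * D3 (4 * z ^+ 2 * (x ^+ 4 * q) - r + 12 * (x ^+ 4 * g))).
  have D4 f : D3 (4 * z ^+ 2 * f) = 4 * (z ^+ 2 * D3 f).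
    by rewrite -mulrA D3M D3_nat mul0r add0r Dz2.
  by rewrite D3D D3B D4.
rewrite AE Dz2 mulrCA ode'; move: (S (shift_series _)) => v.
transitivity (v * (2 * ((2 * w ^+ 2) *: (x ^+ 4 * q)) - 2 * (2^-1 *: r)
  + 2 * (6 * x ^+ 4 * g))); last by ring.
by rewrite w2 V2 mulrCA -AE; congr (_ * _); ring.
Qed.

End Rescaling.

Lemma Qw_w_neq0 : w != 0 :> Qw.
Proof. by rewrite tofrac_eq0 polyX_eq0. Qed.

Lemma Qw_lin_neq0 (b : rat) : 1 + FracField.tofrac b%:P * w != 0 :> Qw.
Proof.
rewrite -tofrac1 -tofracM -tofracD tofrac_eq0.
apply/eqP => /(congr1 (fun p : {poly rat} => p.[0])) /eqP.
by rewrite hornerD hornerM hornerX !hornerC mulr0 addr0 oner_eq0.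
Qed.

Theorem theorem3p1 :
  let x : laurent Qw := lX Qw 1 in
  let D (f : laurent Qw) : laurent Qw := 3 *: euler f in
  let Dplus (a : nat) (f : laurent Qw) : laurent Qw := D f + a%:R * f in
  let T : laurent Qw := L3 w + (w + 1)%:A - 2^-1 *: lX Qw (- 2) in
  let V : laurent Qw :=
    w ^- 2 *: ((1 + 2 * w) ^+ 2 *: subst_sqrt (1 + 2 * w) (L3 (w / (1 + 2 * w)))
             + (1 - 2 * w) ^+ 2 *: subst_sqrt (1 - 2 * w) (L3 (w / (1 - 2 * w)))
             - 2 *: L3 w) in
  (4 * w ^+ 2) *: (x ^+ 4 * Dplus 12%N (Dplus 12%N (Dplus 8%N (Dplus 4%N T))))
    - Dplus 6%N (D T) + 12 * x ^+ 4 * Dplus 12%N (Dplus 4%N T ^+ 2)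
  = V * ((2 * w ^+ 2) *: (x ^+ 4 * Dplus 12%N (Dplus 8%N (Dplus 4%N T)))
         - 2^-1 *: Dplus 6%N T + 6 * x ^+ 4 * Dplus 4%N T ^+ 2).
Proof.
have tn k : FracField.tofrac (k%:R : {poly rat}) = k%:R by rewrite rmorph_nat.
have cw : commr_rmorph (@FracField.tofrac {poly rat} \o polyC) w^-1 := fun c => mulrC _ _.
(* Polynomials in the size [N] are evaluated at [1 / w]. *)
pose ev := GRing.RMorphism.clone {poly rat} Qw (horner_morph cw) _.
have evX : ev 'X = w^-1 by rewrite /= horner_morphX.
apply: rescaled_ode.
- exact: Qw_w_neq0.
- by rewrite -tn tofrac_eq0 -polyC_natr polyC_eq0.
- by have := Qw_lin_neq0 2; rewrite polyC_natr tn.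
- by have := Qw_lin_neq0 (- 2); rewrite polyCN polyC_natr rmorphN /= tn mulNr.
- by rewrite -evX; exact: hirota_ode_eq0.
Qed.
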